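(* Let $(M,F,\mu)$ be a forward complete Finsler metric measure space and consider the exponential energy functional $$\mathbb E(u)=\int_M\exp\frac{F^{*2}(Du)}{2}\,d\mu .$$ The Euler–Lagrange operator associated with $\mathbb E$ is the quasilinear strictly elliptic operator $$\tilde\Delta_\mu u:=\mathrm{div}_\mu(\mathcal V(u)\nabla u)=\frac1{\sigma}\frac{\partial}{\partial x^i}\left(\sigma\, e^{\frac12F^{*2}(Du)}g^{ij}(\nabla u)\,u_j\right),\qquad \mathcal V(u)=\exp\left(\tfrac12F^{*2}(Du)\right),$$ where $u_j=\partial u/\partial x^j$ and $d\mu=\sigma\,dx^1\cdots dx^n$ in local coordinates. That is, $u$ is a critical point of $\mathbb E$ with respect to all compactly supported variations $u+tv$ if and only if $\tilde\Delta_\mu u=0$.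
   Context: **Finsler metric measure space.** $M$ is a smooth manifold of dimension $n$, $F:TM\to[0,\infty)$ is a Finsler metric: smooth on $TM\setminus0$, positively 1-homogeneous in $y$ (not assumed reversible), with $g_{ij}(x,y)=\frac12\frac{\partial^2F^2}{\partial y^i\partial y^j}$ positive definite for $y\neq0$; $g^{ij}$ is the inverse matrix. $\mu$ is a measure with $d\mu=\sigma(x)\,dx^1\cdots dx^n$ in local coordinates, $\sigma$ smooth and positive. Forward complete means that every forward geodesic $\gamma:[0,\epsilon)\to M$ extends to $[0,\infty)$. $F^*$ is the dual metric on $T^*M$, $F^*(x,\xi)=\sup_{F(x,y)=1}\xi(y)$. **Gradient and divergence.** $Du$ is the differential of $u$. The gradient $\nabla u$ is the image of $Du$ under the Legendre transform: $\nabla u=0$ where $Du=0$, and otherwise $\nabla u$ is the unique vector with $Du(\cdot)=g_{\nabla u}(\nabla u,\cdot)$, i.e. $(\nabla u)^i=g^{ij}(x,\nabla u)u_j$; one has $F(\nabla u)=F^*(Du)$. $\mathrm{div}_\mu X=\frac1\sigma\partial_i(\sigma X^i)$. **Euler–Lagrange operator / critical point.** For $v$ smooth with compact support, the first variation is $\frac{d}{dt}\big|_{t=0}\mathbb E(u+tv)$ (when $\mathbb E(u)$ is infinite, the integral is taken over a relatively compact domain containing $\mathrm{supp}\,v$). $u$ is a critical point if this vanishes for all such $v$. Saying that $\tilde\Delta_\mu$ is the Euler–Lagrange operator means $\frac{d}{dt}\big|_{t=0}\mathbb E(u+tv)=-\int_M v\,\tilde\Delta_\mu u\,d\mu$ for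 all such $v$, where, where needed (e.g. where $Du=0$ and $\nabla u$ is not differentiable), the right-hand side is read in the weak sense $\int_M\mathcal V(u)\,Dv(\nabla u)\,d\mu$. **Quasilinear strictly elliptic.** Where $Du\ne0$, the operator is linear in the second derivatives $u_{ij}$ of $u$ with coefficients depending on $x$ and $Du$, and the symmetric matrix of these coefficients is positive definite. *)

(* Defs.v *)
From HB Require Import structures.
From mathcomp Require Import all_boot all_order all_algebra.
From mathcomp Require Import all_classical all_reals all_analysis.

Set Implicit Arguments.
Unset Strict Implicit.
Unset Printing Implicit Defensive.

Import Order.TTheory GRing.Theory Num.Theory.
Import numFieldNormedType.Exports.

Local Open Scope classical_set_scope.
Local Open Scope ring_scope.

Section Calculus.
Context {R : realType}.

Definition iter_derive {V W : normedModType R} (s : seq V) (f : V -> W)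
  : V -> W := foldr (fun h g x => 'D_h g x) f s.

(* Intended for an open set O of a finite-dimensional V. *)
Definition Ck_on {V W : normedModType R} (k : nat) (O : set V) (f : V -> W) :=
  forall s : seq V, (size s <= k)%N ->
    (forall x, O x -> {for x, continuous (iter_derive s f)}) /\
    ((size s < k)%N -> forall x h, O x -> derivable (iter_derive s f) x h).

Definition smooth_on {V W : normedModType R} (O : set V) (f : V -> W) :=
  forall k, Ck_on k O f.

Definition evec {n} (i : 'I_n) : 'rV[R]_n := delta_mx 0 i.

(* Pairing of a covector with a vector, both given by their components. *)
Definition dot {n} (xi y : 'rV[R]_n) : R := \sum_i xi 0 i * y 0 i.

(* Iterated one-dimensional Lebesgue integrals; by Tonelli this is the integral
   against the n-dimensional Lebesgue measure for nonnegative Borel f. *)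
Fixpoint iintegral (n : nat) : ('rV[R]_n -> \bar R) -> \bar R :=
  match n with
  | 0%N => fun f => f 0
  | n'.+1 => fun f =>
      (\int[@lebesgue_measure R]_t
        iintegral (fun z : 'rV[R]_n' => f (row_mx (t%:M : 'M[R]_1) z)))%E
  end.

End Calculus.

(* [chart_at] selects a chart around each point; it is used to evaluate on M
   quantities that are given chart by chart and do not depend on the chart. *)
Record smooth_atlas (R : realType) (n : nat) (M : ptopologicalType) := Atlas {
  chart : Type;
  dom : chart -> set M;
  phi : chart -> M -> 'rV[R]_n;
  psi : chart -> 'rV[R]_n -> M;
  chart_at : M -> chart;
  dom_chart_at : forall p, dom (chart_at p) p;
  open_dom : forall a, open (dom a);
  open_cod : forall a, open (phi a @` dom a);
  phiK : forall a p, dom a p -> psi a (phi a p) = p;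
  phi_continuous : forall a p, dom a p -> {for p, continuous (phi a)};
  psi_continuous : forall a x, (phi a @` dom a) x -> {for x, continuous (psi a)};
  transition_smooth : forall a b,
    smooth_on (phi a @` (dom a `&` dom b)) (phi b \o psi a)
}.

Notation borel M := (g_sigma_algebraType (@open M)).

Section Manifold.
Context {R : realType} {n : nat} {M : ptopologicalType}.
Variable A : smooth_atlas R n M.
Implicit Types (a : chart A) (x y xi : 'rV[R]_n) (u v : M -> R) (W D : set M).

Definition cod a : set 'rV[R]_n := phi a @` dom a.

Definition Ck_fun (k : nat) W u :=
  forall a, Ck_on k (phi a @` (dom a `&` W)) (u \o psi a).

Definition supp v : set M := closure [set p | v p != 0].

Definition test_function v :=
  (forall k, Ck_fun k setT v) /\ compact (supp v).

(* Components of Du in the chart a. *)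
Definition du a u x : 'rV[R]_n := \row_i 'D_(evec i) (u \o psi a) x.

Definition Du_neq0 u (p : M) := du (chart_at A p) u (phi (chart_at A p) p) != 0.

(* Fundamental tensor g_ij(x,y) of a local expression f(x,y) of a metric. *)
Definition gmat (f : 'rV[R]_n -> 'rV[R]_n -> R) x y : 'M[R]_n :=
  \matrix_(i, j)
    (2^-1 * 'D_(evec i) (fun z => 'D_(evec j) (fun w => f x w ^+ 2) z) y).

(* A function on TM is given by its expressions in the induced coordinates
   (x, y) of TM, compatible with the differentials of the transition maps. *)
Record finsler_metric := Finsler {
  Fin : chart A -> 'rV[R]_n -> 'rV[R]_n -> R;
  Fin_compat : forall a b x y, (phi a @` (dom a `&` dom b)) x ->
    Fin a x y = Fin b (phi b (psi a x)) ('D_y (phi b \o psi a) x);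
  Fin_ge0 : forall a x y, cod a x -> 0 <= Fin a x y;
  Fin_smooth : forall a,
    smooth_on [set z : 'rV[R]_n * 'rV[R]_n | cod a z.1 /\ z.2 != 0]
              (fun z => Fin a z.1 z.2);
  Fin_homogeneous : forall a x y (l : R), cod a x -> 0 < l ->
    Fin a x (l *: y) = l * Fin a x y;
  Fin_convex : forall a x y, cod a x -> y != 0 ->
    forall w, w != 0 -> 0 < dot (w *m gmat (Fin a) x y) w
}.

Record smooth_density (mu : {measure set (borel M) -> \bar R}) := Density {
  sigma : chart A -> 'rV[R]_n -> R;
  sigma_smooth : forall a, smooth_on (cod a) (sigma a);
  sigma_gt0 : forall a x, cod a x -> 0 < sigma a x;
  mu_sigma : forall a (B : set (borel M)), measurable B -> B `<=` dom a ->
    mu B = iintegral (fun x => (\1_(phi a @` B) x * sigma a x)%:E)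
}.

Section Finsler.
Variable F : finsler_metric.

(* G^i = (1/4) g^{il} ([F^2]_{x^k y^l} y^k - [F^2]_{x^l}) *)
Definition spray a x y : 'rV[R]_n :=
  \row_i (4^-1 * \sum_l invmx (gmat (Fin F a) x y) i l *
    ((\sum_k y 0 k *
        'D_(evec k) (fun z => 'D_(evec l) (fun w => Fin F a z w ^+ 2) y) x)
     - 'D_(evec l) (fun z => Fin F a z y ^+ 2) x)).

(* Smoothness on J means smoothness on an open neighbourhood of J (J is [0,e[
   or [0,+oo[ below).  Constant curves, for which the spray is evaluated where
   F^2 need not be twice differentiable, are excluded; they always extend. *)
Definition geodesic_on (J : set R) (c : R -> M) :=
  exists O : set R, [/\ open O, J `<=` O,
    (forall t, O t -> {for t, continuous c}) &
    forall a,
      smooth_on (O `&` c @^-1` dom a) (phi a \o c) /\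
      forall t, J t -> dom a (c t) ->
        derive1 (phi a \o c) t != 0 /\
        derive1 (derive1 (phi a \o c)) t +
          2 *: spray a (phi a (c t)) (derive1 (phi a \o c) t) = 0].

Definition forward_complete :=
  forall (e : R) (c : R -> M), 0 < e -> geodesic_on `[0, e[%classic c ->
    exists c' : R -> M, geodesic_on `[0, +oo[%classic c' /\
      forall t, `[0, e[%classic t -> c' t = c t.

Definition Fstar a x xi : R :=
  sup [set dot xi y | y in [set y | Fin F a x y = 1]].

Definition legendre a x xi : 'rV[R]_n :=
  if xi == 0 then 0
  else xget 0 [set y | y != 0 /\ xi = y *m gmat (Fin F a) x y].

Definition grad a u x : 'rV[R]_n := legendre a x (du a u x).

Definition calV a u x : R := expR (2^-1 * Fstar a x (du a u x) ^+ 2).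

Definition flux a u x : 'rV[R]_n := calV a u x *: grad a u x.

Definition flux_C1 W u := forall a, Ck_on 1 (phi a @` (dom a `&` W)) (flux a u).

Section Measure.
Variables (mu : {measure set (borel M) -> \bar R}) (s : smooth_density mu).

Definition div_loc a (X : 'rV[R]_n -> 'rV[R]_n) x : R :=
  (sigma s a x)^-1 * \sum_i 'D_(evec i) (fun z => sigma s a z * X z 0 i) x.

Definition tDelta u (p : M) : R :=
  div_loc (chart_at A p) (flux (chart_at A p) u) (phi (chart_at A p) p).

(* The expression of tDelta in terms of g^{ij}(grad u) u_j. *)
Definition tDelta_coord a u x : R :=
  (sigma s a x)^-1 * \sum_i 'D_(evec i) (fun z =>
     sigma s a z * expR (2^-1 * Fstar a z (du a u z) ^+ 2) *
     \sum_j invmx (gmat (Fin F a) z (grad a u z)) i j * du a u z 0 j) x.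

End Measure.

Section Energy.
Variable mu : {measure set (borel M) -> \bar R}.

Definition energy D u : \bar R :=
  (\int[mu]_(p in (D : set (borel M)))
     (calV (chart_at A p) u (phi (chart_at A p) p))%:E)%E.

(* The domain over which the energy of u + t v is taken. *)
Definition variation_domain u v D :=
  ((energy setT u < +oo)%E /\ D = setT) \/
  (energy setT u = +oo%E /\ [/\ open D, compact (closure D) & supp v `<=` D]).

Definition energy_along u v D (t : R) : R :=
  fine (energy D (fun p => u p + t * v p)).

(* int_M V(u) Dv(grad u) dmu, i.e. the weak form of - int_M v tDelta(u) dmu *)
Definition weak_pairing u v : R :=
  \int[mu]_(p in [set: borel M])
    (let a := chart_at A p in let x := phi a p in
     calV a u x * dot (du a v x) (grad a u x)).

Definition critical_point u := forall v D,
  test_function v -> variation_domain u v D ->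
  is_derive (0 : R) (1 : R) (energy_along u v D) 0.

Definition weak_solution u := forall v, test_function v -> weak_pairing u v = 0.

End Energy.
End Finsler.

(* The second-order coefficients P and the lower order term B depend only on
   (x, Du), and not on u. *)
Definition quasilinear_strictly_elliptic (L : (M -> R) -> M -> R) :=
  forall a, exists (P : 'rV[R]_n -> 'rV[R]_n -> 'M[R]_n)
                   (B : 'rV[R]_n -> 'rV[R]_n -> R),
    (forall x xi, cod a x -> xi != 0 ->
       (P x xi)^T = P x xi /\
       forall w, w != 0 -> 0 < dot (w *m P x xi) w) /\
    (forall u W p, open W -> W p -> dom a p -> Ck_fun 2 W u -> Du_neq0 u p ->
       let x := phi a p in
       L u p =
         \sum_i \sum_j P x (du a u x) i j *
            'D_(evec i) (fun z => 'D_(evec j) (u \o psi a) z) x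
         + B x (du a u x)).

End Manifold.

(* Main.v *)
Require Import Defs.
From HB Require Import structures.
From mathcomp Require Import all_boot all_order all_algebra.
From mathcomp Require Import all_classical all_reals all_analysis.
From mathcomp Require Import measurable_realfun ring lra.

Import Order.TTheory GRing.Theory Num.Theory.
Import numFieldNormedType.Exports.

Local Open Scope classical_set_scope.
Local Open Scope ring_scope.

Set Implicit Arguments.
Unset Strict Implicit.
Unset Printing Implicit Defensive.

(* In a fixed tangent space the Legendre transform of xi is the unique maximiser of
   xi(y) - F(y)^2/2, with maximum F*(xi)^2/2.  Hence t |-> F*(xi + t eta)^2/2 is convex
   with derivative eta(legendre(xi + t eta)), and V = exp(F*^2/2) is convex as well;
   convexity gives the domination needed to differentiate the energy under the
   integral sign, which yields the weak form of the first variation.  The same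
   maximality shows that F* and the gradient do not depend on the chart.  In a chart,
   mu is a density times Lebesgue measure and the divergence theorem reduces to the
   vanishing of integrals of partial derivatives of compactly supported functions;
   therefore the weak form determines the divergence of the flux, which gives both
   its independence of the chart (no change of variables is needed) and its vanishing
   at critical points.  Ellipticity: where Du <> 0, differentiating the Legendre
   transform gives the principal part V (y^i y^j + g^{ij}(y)), y = grad u. *)

(** * Functions of class C^k *)

(** [Ck_on] speaks of iterated directional derivatives only, so differentiability is handled through
    Caratheodory slope functions: an increment is exactly a pairing with a row that is continuous at
    the point, and the chain rule and implicit differentiation become limits of products. The
    obstacle that shapes the proof is the zero section, where [F^2] need not be twice differentiable
    and the gradient is merely continuous. Two routes are therefore kept apart. The first variation
    uses only the maximum property of the Legendre transform, which gives continuity and two-sided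
    bounds on slopes also where [Du = 0], and so serves every [u] of class C^1. The derivative of
    the flux is computed only where [Du <> 0], by implicit differentiation of
    [xi = y *m fundamental y]. The density of [mu] is given against iterated one-dimensional
    integrals, so a measure on row vectors representing them has to be constructed; the norm being
    the sup norm, its balls are products of intervals. Covering arguments on the manifold go through
    one induction principle for compact sets, [compact_local]. *)

Section DirectionalCalculus.
Context {R : realType}.

Lemma near_dist_lt {V : normedModType R} (x : V) (e : R) : 0 < e ->
  \forall z \near x, `|z - x| < e.
Proof.
move=> e0; apply/nbhs_normP; exists e => //= z.
by rewrite /= distrC.
Qed.

Lemma near_dist_ltP {V : normedModType R} (x : V) (P : set V) :
  (\forall z \near x, P z) -> exists2 r : R, 0 < r & forall z, `|z - x| < r -> P z.
Proof.
move=> /nbhs_ballP[r /= r0 rO].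
by exists r => // z zr; apply: rO; rewrite -ball_normE /= distrC.
Qed.

Lemma open_dist_lt {V : normedModType R} (O : set V) x : open O -> O x ->
  exists2 r : R, 0 < r & forall z, `|z - x| < r -> O z.
Proof. by move=> oO Ox; apply: near_dist_ltP; exact: open_nbhs_nbhs. Qed.

Section Ck.
Context {V W : normedModType R}.
Implicit Types (O : set V) (f g : V -> W).

(** [foldr] puts the last direction of the list innermost, so [rcons] isolates the derivative that
    is taken first. *)
Lemma iter_derive_rcons s h f :
  iter_derive (rcons s h) f = iter_derive s ('D_h f).
Proof. by rewrite /iter_derive foldr_rcons. Qed.

(** Replaces the quantification over lists of directions by a recursion on [k], the form in which
    regularity is proved by induction below. *)
Lemma Ck_onS k O f : Ck_on k.+1 O f <->
  [/\ forall x, O x -> {for x, continuous f},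
      forall x h, O x -> derivable f x h & forall h, Ck_on k O ('D_h f)].
Proof.
split=> [Cf|[cf df Cf] s].
  split=> [||h s sk]; first by have [] := Cf [::] isT.
    by have [_ /(_ isT)] := Cf [::] isT.
  by have := Cf (rcons s h); rewrite size_rcons ltnS iter_derive_rcons; exact.
case/lastP: s => [|s h]; first by split=> // _.
by rewrite size_rcons !ltnS iter_derive_rcons => /Cf.
Qed.

Lemma Ck_on0 O f : Ck_on 0 O f <-> forall x, O x -> {for x, continuous f}.
Proof.
split=> [Cf|cf s]; first by have [] := Cf [::] isT.
by rewrite leqn0 size_eq0 => /eqP ->; split.
Qed.

Lemma Ck_onW j k O f : (j <= k)%N -> Ck_on k O f -> Ck_on j O f.
Proof.
move=> jk Cf s sj; have [c d] := Cf s (leq_trans sj jk).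
by split=> // sj'; apply: d; exact: leq_trans jk.
Qed.

Lemma Ck_on_continuous k O f x : Ck_on k O f -> O x -> {for x, continuous f}.
Proof. by move=> /(Ck_onW (leq0n k))/Ck_on0; exact. Qed.

Lemma Ck_on_sub k O O' f : O' `<=` O -> Ck_on k O f -> Ck_on k O' f.
Proof.
move=> OO' Cf s sk; have [c d] := Cf s sk.
by split=> [x /OO'|sk' x h /OO']; [exact: c|exact: d].
Qed.

Lemma Ck_onU k O O' f : Ck_on k O f -> Ck_on k O' f -> Ck_on k (O `|` O') f.
Proof.
move=> Cf Cf' s sk; have [c d] := Cf s sk; have [c' d'] := Cf' s sk.
split=> [x []|sk' x h []]; [exact: c|exact: c'|exact: d|exact: d'].
Qed.

(** A derivative at a point sees a whole neighbourhood; equality on [O] passes to the derivatives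
    because [O] is open. *)
Lemma eq_Ck_on k O f g : open O -> (forall x, O x -> f x = g x) ->
  Ck_on k O f -> Ck_on k O g.
Proof.
move=> oO.
have eq0 f' g' : (forall x, O x -> f' x = g' x) -> Ck_on 0 O f' -> Ck_on 0 O g'.
  move=> {f g} fg /Ck_on0 cf; apply/Ck_on0 => x Ox.
  have : f' @ x --> g' x by rewrite -(fg _ Ox); exact: cf.
  apply: cvg_trans; apply: near_eq_cvg; near=> y; apply: fg.
  by near: y; exact: open_nbhs_nbhs.
elim: k f g => [|k IH] f g fg; first exact: eq0.
have fgn x : O x -> \near x, f x = g x.
  by move=> Ox; near=> y; apply: fg; near: y; exact: open_nbhs_nbhs.
move=> /Ck_onS[cf df Cf]; apply/Ck_onS; split.
- by apply/Ck_on0/(eq0 f g fg)/Ck_on0.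
- by move=> x h Ox; apply: near_eq_derivable (fgn x Ox) (df x h Ox).
- move=> h; apply: IH (Cf h) => x Ox.
  by apply: near_eq_derive; exact: fgn.
Unshelve. all: by end_near. Qed.

Lemma Ck_on_cst k O (a : W) : Ck_on k O (cst a).
Proof.
elim: k a => [|k IH] a.
  by apply/Ck_on0 => x _; exact: cvg_cst.
apply/Ck_onS; split=> [x _|x h _|h]; first exact: cvg_cst.
  exact: derivable_cst.
rewrite (_ : 'D_h (cst a) = cst 0) //; apply/funext => x.
exact: derive_cst.
Qed.

Lemma Ck_onD k O f g : open O -> Ck_on k O f -> Ck_on k O g ->
  Ck_on k O (f \+ g).
Proof.
move=> oO; elim: k f g => [|k IH] f g.
  move=> /Ck_on0 cf /Ck_on0 cg; apply/Ck_on0 => x Ox.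
  by apply: cvgD; [exact: cf|exact: cg].
move=> /Ck_onS[cf df Cf] /Ck_onS[cg dg Cg]; apply/Ck_onS; split.
- by move=> x Ox; apply: cvgD; [exact: cf|exact: cg].
- by move=> x h Ox; apply: derivableD; [exact: df|exact: dg].
- move=> h; apply: (eq_Ck_on oO _ (IH _ _ (Cf h) (Cg h))) => x Ox /=.
  by rewrite deriveD //; [exact: df|exact: dg].
Qed.

End Ck.

(** The difference quotient of the composite along [h] is literally that of [f] along [L h], so this
    holds in arbitrary normed spaces. It transports smoothness between pairs of rows and their
    concatenation. *)
Lemma Ck_on_comp_affine (U V W : normedModType R) (L : {linear U -> V}) (b : V) k
    (O : set V) (f : V -> W) :
  continuous L -> Ck_on k O f ->
  Ck_on k [set u | O (L u + b)] (fun u => f (L u + b)).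
Proof.
move=> cL; have quot (g : V -> W) x h :
    (fun t => t^-1 *: (((fun u => g (L u + b)) \o shift x) (t *: h) - g (L x + b))) =
    (fun t => t^-1 *: ((g \o shift (L x + b)) (t *: L h) - g (L x + b))).
  by apply/funext => t /=; rewrite linearP addrA.
have cLb x : L u + b @[u --> x] --> L x + b.
  by apply: cvgD; [exact: cL|exact: cvg_cst].
elim: k f => [|k IH] f.
  move=> /Ck_on0 cf; apply/Ck_on0 => x Ox.
  by apply: (@continuous_comp _ _ _ (fun u => L u + b) f); [exact: cLb|exact: cf].
move=> /Ck_onS[cf df Cf]; apply/Ck_onS; split=> [x Ox|x h Ox|h].
- by apply: (@continuous_comp _ _ _ (fun u => L u + b) f); [exact: cLb|exact: cf].
- by rewrite /derivable quot; exact: df.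
- rewrite (_ : 'D_h _ = fun u => 'D_(L h) f (L u + b)); first exact: (IH _ (Cf (L h))).
  by apply/funext => x; rewrite /derive quot.
Qed.

Section real_valued.
Context {V : normedModType R}.
Implicit Types (O : set V) (f g : V -> R).

Lemma Ck_onM k O f g : open O -> Ck_on k O f -> Ck_on k O g ->
  Ck_on k O (f \* g).
Proof.
move=> oO; elim: k f g => [|k IH] f g.
  move=> /Ck_on0 cf /Ck_on0 cg; apply/Ck_on0 => x Ox.
  by apply: cvgM; [exact: cf|exact: cg].
move=> Cf' Cg'.
have /Ck_onS[cf df Cf] := Cf'; have /Ck_onS[cg dg Cg] := Cg'.
apply/Ck_onS; split.
- by move=> x Ox; apply: cvgM; [exact: cf|exact: cg].
- by move=> x h Ox; apply: derivableM; [exact: df|exact: dg].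
- move=> h; have Cfk := Ck_onW (leqnSn k) Cf'.
  have Cgk := Ck_onW (leqnSn k) Cg'.
  apply: (eq_Ck_on oO _ (Ck_onD oO (IH _ _ Cfk (Cg h)) (IH _ _ Cgk (Cf h)))).
  by move=> x Ox /=; rewrite deriveM //; [exact: df|exact: dg].
Qed.

Lemma Ck_on_sum (I : Type) (r : seq I) (F : I -> V -> R) k O : open O ->
  (forall i, Ck_on k O (F i)) -> Ck_on k O (fun x => \sum_(i <- r) F i x).
Proof.
move=> oO CF; elim: r => [|i r IH].
  by under eq_fun do rewrite big_nil; exact: Ck_on_cst.
rewrite (_ : (fun x => _) = F i \+ (fun x => \sum_(j <- r) F j x)).
  exact: (Ck_onD oO (CF i) IH).
by apply/funext => x; rewrite big_cons.
Qed.

Lemma Ck_on_prod (I : Type) (r : seq I) (F : I -> V -> R) k O : open O ->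
  (forall i, Ck_on k O (F i)) -> Ck_on k O (fun x => \prod_(i <- r) F i x).
Proof.
move=> oO CF; elim: r => [|i r IH].
  by under eq_fun do rewrite big_nil; exact: Ck_on_cst.
rewrite (_ : (fun x => _) = F i \* (fun x => \prod_(j <- r) F j x)).
  exact: (Ck_onM oO (CF i) IH).
by apply/funext => x; rewrite big_cons.
Qed.

Lemma Ck_onZ k O (c : R) f : open O -> Ck_on k O f ->
  Ck_on k O (fun x => c * f x).
Proof. by move=> oO; apply: Ck_onM => //; exact: Ck_on_cst. Qed.

End real_valued.

Lemma derivable_cvg (V W : normedModType R) (f : V -> W) x h :
  derivable f x h -> f (t *: h + x) @[t --> (0 : R)] --> f x.
Proof.
move=> /derivable1P/derivable1_diffP/differentiable_continuous.
move=> c; have : f (t *: h + x) @[t --> (0:R)] --> f (0 *: h + x) by exact: c.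
by rewrite scale0r add0r.
Qed.

(** Restriction to the line [t *: h + x] does not change the difference quotients and reduces the
    claim to the chain rule in one variable. *)
Lemma is_derive_outer (V : normedModType R) (g : R -> R) (f : V -> R) x h dg df :
  is_derive (f x) 1 g dg -> is_derive x h f df -> is_derive x h (g \o f) (dg * df).
Proof.
move=> dgf [dfx dfE].
have q (k : V -> R) : (fun t : R => t^-1 *: (((fun t : R => k (t *: h + x)) \o shift 0) (t *: 1)
      - k (0 *: h + x))) =
    (fun t : R => t^-1 *: ((k \o shift x) (t *: h) - k x)).
  by apply/funext => t /=; rewrite addr0 [_ *: 1]mulr1 scale0r add0r.
have d1 : is_derive (0 : R) 1 (fun t : R => f (t *: h + x)) df.
  by split; [rewrite /derivable q|rewrite /derive q].
have e0 : f (0 *: h + x) = f x by rewrite scale0r add0r.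
have dg' : is_derive ((fun t : R => f (t *: h + x)) 0) 1 g dg by rewrite /= e0.
have [D1 D2] := is_derive1_comp dg' d1.
by split; [move: D1; rewrite /derivable (q (g \o f))|move: D2; rewrite /derive (q (g \o f))].
Qed.

Lemma is_derive_line (V W : normedModType R) (f : V -> W) x v (t : R) :
  derivable f (x + t *: v) v ->
  is_derive t 1 (fun s => f (x + s *: v)) ('D_v f (x + t *: v)).
Proof.
have e : (fun h => h^-1 *: (((fun s => f (x + s *: v)) \o shift t) (h *: 1)
      - f (x + t *: v))) =
    (fun h => h^-1 *: ((f \o shift (x + t *: v)) (h *: v) - f (x + t *: v))).
  apply/funext => h /=; rewrite [h *: 1]mulr1 scalerDl.
  by rewrite (addrCA x) addrC.
by move=> dfx; split; rewrite /derivable /derive e.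
Qed.

Lemma deriveZdir (V W : normedModType R) (f : V -> W) x v (c : R) :
  derivable f x v -> 'D_(c *: v) f x = c *: 'D_v f x.
Proof.
have [->|c0] := eqVneq c 0; first by rewrite !scale0r derive0.
move=> dfv; apply: cvg_lim => //.
have -> : (fun h => h^-1 *: ((f \o shift x) (h *: (c *: v)) - f x)) =
    (fun h => c *: ((h * c)^-1 *: ((f \o shift x) ((h * c) *: v) - f x))).
  apply/funext => h /=; rewrite !scalerA; congr (_ *: _).
  by rewrite invfM mulrCA divff ?mulr1.
apply: cvgZr; apply: (cvg_comp (fun h => h * c) _ _ dfv) => A [e /= e0 eA].
exists (e / `|c|); first by rewrite /= divr_gt0 // normr_gt0.
move=> h /=; rewrite sub0r normrN => hlt h0; apply: eA.
  by rewrite /= sub0r normrN normrM -ltr_pdivlMr // normr_gt0.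
by rewrite mulf_neq0.
Qed.

Section bigop_limits.
Context {T : Type} {G : set_system T} {FG : Filter G}.

Lemma cvg_sumr (I : Type) (r : seq I) (P : pred I) (f : I -> T -> R) (l : I -> R) :
  (forall i, f i t @[t --> G] --> l i) ->
  \sum_(i <- r | P i) f i t @[t --> G] --> \sum_(i <- r | P i) l i.
Proof. by move=> fl; apply: cvg_big => //; exact: add_continuous. Qed.

Lemma cvg_prodr (I : Type) (r : seq I) (P : pred I) (f : I -> T -> R) (l : I -> R) :
  (forall i, f i t @[t --> G] --> l i) ->
  \prod_(i <- r | P i) f i t @[t --> G] --> \prod_(i <- r | P i) l i.
Proof. by move=> fl; apply: cvg_big => //; exact: mul_continuous. Qed.

End bigop_limits.

Section row_vectors.
Context {n : nat}.
Implicit Types (O : set 'rV[R]_n) (f : 'rV[R]_n -> R) (x y : 'rV[R]_n).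

Lemma dotC x y : dot x y = dot y x.
Proof. by apply: eq_bigr => i _; rewrite mulrC. Qed.

Lemma dotDl x x' y : dot (x + x') y = dot x y + dot x' y.
Proof. by rewrite /dot -big_split; apply: eq_bigr => i _; rewrite !mxE mulrDl. Qed.

Lemma dotDr x y y' : dot x (y + y') = dot x y + dot x y'.
Proof. by rewrite !(dotC x) dotDl. Qed.

Lemma dotZl c x y : dot (c *: x) y = c * dot x y.
Proof. by rewrite /dot mulr_sumr; apply: eq_bigr => i _; rewrite !mxE mulrA. Qed.

Lemma dotZr c x y : dot x (c *: y) = c * dot x y.
Proof. by rewrite !(dotC x) dotZl. Qed.

Lemma dotNr x y : dot x (- y) = - dot x y.
Proof. by rewrite -scaleN1r dotZr mulN1r. Qed.

Lemma dotBr x y y' : dot x (y - y') = dot x y - dot x y'.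
Proof. by rewrite dotDr dotNr. Qed.

Lemma dot0r x : dot x 0 = 0.
Proof. by rewrite -(scale0r 0) dotZr mul0r. Qed.

Lemma dot0l x : dot 0 x = 0.
Proof. by rewrite dotC dot0r. Qed.

Lemma dot_evec x i : dot x (evec i) = x 0 i.
Proof.
rewrite /dot (bigD1 i) //= big1 => [|j ji]; rewrite !mxE ?eqxx ?mulr1 ?addr0 //.
by rewrite (negPf ji) mulr0.
Qed.

Lemma dot_inj x y : (forall w, dot x w = dot y w) -> x = y.
Proof. by move=> e; apply/rowP => i; rewrite -!dot_evec e. Qed.

Lemma cvg_row {T : Type} {G : set_system T} {FG : Filter G}
    (c : T -> 'rV[R]_n) x :
  (forall i, c t 0 i @[t --> G] --> x 0 i) -> c @ G --> x.
Proof.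
move=> cx; apply/cvgrPdist_le => e e0; near=> t.
rewrite [leLHS]/Num.Def.normr /= mx_normrE (bigmax_le _ (ltW e0)) //= => -[i j] _.
rewrite ord1 !mxE /=.
move: j; near: t; apply: filter_forall => j.
exact: ((cvgrPdist_le _ _).1 (cx j)).
Unshelve. all: by end_near. Qed.

Lemma cvg_coord {T : Type} {G : set_system T} {FG : Filter G}
    (c : T -> 'rV[R]_n) x i : c @ G --> x -> c t 0 i @[t --> G] --> x 0 i.
Proof.
by move=> cx; apply: (cvg_comp c (fun x : 'rV[R]_n => x 0 i) cx); exact: coord_continuous.
Qed.

Lemma cvg_dot {T : Type} {G : set_system T} {FG : Filter G}
    (a b : T -> 'rV[R]_n) x y : a @ G --> x -> b @ G --> y ->
  dot (a t) (b t) @[t --> G] --> dot x y.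
Proof.
by move=> ax b_y; apply: cvg_sumr => i; apply: cvgM; exact: cvg_coord.
Qed.

Lemma coord_le_norm x i : `|x 0 i| <= `|x|.
Proof.
rewrite [leRHS]/Num.Def.normr /= mx_normrE.
exact: (le_bigmax _ (fun j : 'I_1 * 'I_n => `|x j.1 j.2|) (0, i)).
Qed.

Lemma norm_le_coord x (e : R) : 0 <= e -> (forall i, `|x 0 i| <= e) -> `|x| <= e.
Proof.
move=> e0 xe; rewrite [leLHS]/Num.Def.normr /= mx_normrE.
by apply: bigmax_le => // -[i j] _ /=; rewrite ord1.
Qed.

Lemma dot_le_norm x y : `|dot x y| <= n%:R * (`|x| * `|y|).
Proof.
apply: (le_trans (ler_norm_sum _ _ _)).
rewrite -[n in n%:R]card_ord -sum1_card natr_sum mulr_suml.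
by apply: ler_sum => i _; rewrite mul1r normrM ler_pM // coord_le_norm.
Qed.

End row_vectors.

Definition gradient {n} (f : 'rV[R]_n -> R) (x : 'rV[R]_n) : 'rV[R]_n :=
  \row_i 'D_(evec i) f x.

(** * Slope functions and the chain rule *)

Section caratheodory.
Context {n : nat}.
Implicit Types (O : set 'rV[R]_n) (f : 'rV[R]_n -> R) (x y z : 'rV[R]_n).

(** Vertices of a path from [x] ([k = 0]) to [z] ([k = n]) that changes one coordinate at a time, so
    that each edge calls for the mean value theorem in one variable. *)
Let hybrid x z (k : nat) : 'rV[R]_n := \row_j (if (j < k)%N then z 0 j else x 0 j).

(** Caratheodory's form of differentiability. The coordinates of [phi z] are partial derivatives at
    intermediate points of the edges from [x] to [z]; these points tend to [x] with [z], so
    continuity of the partial derivatives gives continuity of [phi] at [x]. *)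
Lemma C1_caratheodory O f x : open O -> Ck_on 1 O f -> O x ->
  exists phi : 'rV[R]_n -> 'rV[R]_n,
    [/\ {for x, continuous phi}, phi x = gradient f x &
        \forall z \near x, f z - f x = dot (phi z) (z - x)].
Proof.
move=> oO /Ck_onS[cf df Cf] Ox.
have [r r0 rO] := open_dist_lt oO Ox.
have mv z (i : 'I_n) : exists y, `|y - x| <= `|z - x| /\ (`|z - x| < r ->
    f (hybrid x z i.+1) - f (hybrid x z i) =
    'D_(evec i) f y * (z 0 i - x 0 i)).
  (* Far from [x] the point [x] itself is the default: the bound on [y] must hold for every [z] so
     that the chosen points converge. *)
  have [zr|] := boolP (`|z - x| < r); last first.
    by exists x; rewrite subrr normr0.
  pose v := (z 0 i - x 0 i) *: evec i : 'rV[R]_n.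
  (* In the sup norm no point of the path is further from [x] than [z] is, so the path stays in the
     ball on which [f] is C^1. *)
  have hyb (t : R) : 0 <= t <= 1 -> `|hybrid x z i + t *: v - x| <= `|z - x|.
    move=> /andP[t0 t1]; apply: norm_le_coord => // j; rewrite !mxE eqxx /=.
    case: (ltngtP j i) => ji.
    - rewrite (_ : j == i = false) ?mulr0 ?addr0; last by rewrite -val_eqE /= ltn_eqF.
      by have := coord_le_norm (z - x) j; rewrite !mxE.
    - rewrite (_ : j == i = false) ?mulr0 ?addr0 ?subrr ?normr0 //.
      by rewrite -val_eqE /= gtn_eqF.
    - rewrite (val_inj ji) eqxx mulr1 addrAC subrr add0r normrM ger0_norm //.
      apply: le_trans (_ : `|z 0 i - x 0 i| <= _); first by rewrite ler_piMl.
      by have := coord_le_norm (z - x) i; rewrite !mxE.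
  pose g (t : R) := f (hybrid x z i + t *: v).
  have dg (t : R) : 0 <= t <= 1 -> is_derive t 1 g ('D_v f (hybrid x z i + t *: v)).
    move=> t01; apply: is_derive_line; apply: df; apply: rO.
    exact: le_lt_trans (hyb t t01) zr.
  have [||c + e] := @MVT_segment R g (fun t => 'D_v f (hybrid x z i + t *: v)) 0 1 ler01.
  + by move=> t; rewrite in_itv /= => /andP[/ltW t0 /ltW t1]; apply: dg; rewrite t0.
  + apply: derivable_within_continuous => t; rewrite in_itv /= => t01.
    by have [] := dg t t01.
  rewrite in_itv /= => c01; exists (hybrid x z i + c *: v); split; first exact: hyb.
  move=> _; move: e; rewrite /g scale0r addr0 scale1r subr0 mulr1.
  rewrite deriveZdir; last by apply/df/rO; exact: le_lt_trans (hyb c c01) zr.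
  rewrite [_ *: _]mulrC => <-; congr (f _ - _).
  apply/rowP => j; rewrite !mxE ltnS eqxx /=.
  case: (ltngtP j i) => ji.
  - by rewrite (_ : j == i = false) ?mulr0 ?addr0 // -val_eqE /= ltn_eqF.
  - by rewrite (_ : j == i = false) ?mulr0 ?addr0 // -val_eqE /= gtn_eqF.
  - by rewrite (val_inj ji) eqxx mulr1; ring.
have /choice[xi xiP] : forall zi : 'rV[R]_n * 'I_n, exists y, `|y - x| <= `|zi.1 - x| /\
   (`|zi.1 - x| < r -> f (hybrid x zi.1 zi.2.+1) - f (hybrid x zi.1 zi.2) =
    'D_(evec zi.2) f y * (zi.1 0 zi.2 - x 0 zi.2)) by move=> [z i]; exact: mv.
have xix i : xi (x, i) = x.
  have [+ _] := xiP (x, i); rewrite /= subrr normr0 normr_le0 subr_eq0.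
  by move/eqP.
exists (fun z => \row_i 'D_(evec i) f (xi (z, i))); split.
- apply: (cvg_row (FG := nbhs_filter x)) => i; rewrite !mxE xix.
  under eq_fun do rewrite mxE.
  have /Ck_on0/(_ x Ox) cDf := Cf (evec i).
  apply: (@cvg_comp _ _ _ (fun z => xi (z, i)) ('D_(evec i) f) _ (nbhs x)) => //.
  apply/cvgrPdist_lt => e e0; apply: filterS (near_dist_lt x e0) => z zx.
  by rewrite distrC; apply: le_lt_trans (xiP (z, i)).1 _.
- by apply/rowP => i; rewrite !mxE xix.
- apply: filterS (near_dist_lt x r0) => z zr.
  have hz : hybrid x z n = z by apply/rowP => j; rewrite mxE ltn_ord.
  have h0 : hybrid x z 0 = x by apply/rowP => j; rewrite mxE.
  rewrite -{1}hz -{2}h0 -(telescope_sumr (fun k => f (hybrid x z k)) (leq0n n)).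
  rewrite big_mkord; apply: eq_bigr => i _.
  by rewrite !mxE -(proj2 (xiP (z, i)) zr).
Unshelve. all: by end_near. Qed.

(** Evaluating the slope function of [f] along [c (t *: h + p)] writes the quotient as a pairing of
    two convergent rows. The inner map has to be derivable in the single direction [h] only. *)
Lemma is_derive_comp {U : normedModType R} O f (c : U -> 'rV[R]_n) p h dc :
  open O -> Ck_on 1 O f -> O (c p) -> is_derive p h c dc ->
  is_derive p h (f \o c) (dot (gradient f (c p)) dc).
Proof.
move=> oO Cf Oc [dcp dcE]; have [phi [cphi phix fphi]] := C1_caratheodory oO Cf Oc.
have cc : c (t *: h + p) @[t --> 0^'] --> c p.
  by apply: cvg_trans (derivable_cvg dcp); apply: cvg_app; exact: cvg_within.
have cdc : t^-1 *: (c (t *: h + p) - c p) @[t --> 0^'] --> dc.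
  by rewrite -dcE; exact: dcp.
have q : t^-1 *: (f (c (t *: h + p)) - f (c p)) @[t --> 0^'] -->
    dot (gradient f (c p)) dc.
  have : dot (phi (c (t *: h + p))) (t^-1 *: (c (t *: h + p) - c p)) @[t --> 0^']
      --> dot (gradient f (c p)) dc.
    apply: cvg_dot cdc; rewrite -phix; exact: (cvg_comp _ _ cc cphi).
  apply: cvg_trans; apply: near_eq_cvg.
  have : \forall t \near 0^', f (c (t *: h + p)) - f (c p) =
      dot (phi (c (t *: h + p))) (c (t *: h + p) - c p) by exact: cc fphi.
  by apply: filterS => t e; rewrite dotZr e.
split; first by apply/cvg_ex; exists (dot (gradient f (c p)) dc).
exact: cvg_lim q.
Qed.

Lemma derive_gradient O f x h : open O -> Ck_on 1 O f -> O x ->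
  'D_h f x = dot (gradient f x) h.
Proof.
move=> oO Cf Ox; have := @is_derive_comp 'rV[R]_n O f id x h h oO Cf Ox.
by move=> /(_ _)[].
Qed.

End caratheodory.

Lemma is_derive_row (U : normedModType R) n (c : U -> 'rV[R]_n) p h (dc : 'rV[R]_n) :
  (forall i, is_derive p h (fun q => c q 0 i) (dc 0 i)) -> is_derive p h c dc.
Proof.
move=> dcP; have dcp : derivable c p h.
  by apply/derivable_mxP => i j; rewrite ord1; have [] := dcP j.
split=> //; rewrite derive_mx //; apply/rowP => j; rewrite mxE.
by have [] := dcP j.
Qed.

Lemma is_derive_coord (U : normedModType R) n (c : U -> 'rV[R]_n) p h (dc : 'rV[R]_n) i :
  is_derive p h c dc -> is_derive p h (fun q => c q 0 i) (dc 0 i).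
Proof.
move=> [dcp <-]; split; first by move/derivable_mxP : dcp; exact.
by rewrite derive_mx // mxE.
Qed.

Lemma is_derive_row_mx (U : normedModType R) n1 n2 (a : U -> 'rV[R]_n1)
    (b : U -> 'rV[R]_n2) p h (da : 'rV[R]_n1) (db : 'rV[R]_n2) :
  is_derive p h a da -> is_derive p h b db ->
  is_derive p h (fun q => row_mx (a q) (b q)) (row_mx da db).
Proof.
move=> ap bp; apply: is_derive_row => i; rewrite mxE.
have -> : (fun q => row_mx (a q) (b q) 0 i) = fun q : U =>
    match fintype.split i with inl j => a q 0 j | inr j => b q 0 j end.
  by apply/funext => q; rewrite mxE.
by case: (fintype.split i) => j; exact: is_derive_coord.
Qed.

Lemma Ck_on_coord (U : normedModType R) n k (O : set U) (c : U -> 'rV[R]_n) i :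
  open O -> Ck_on k O c -> Ck_on k O (fun q => c q 0 i).
Proof.
move=> oO; elim: k c => [|k IH] c.
  by move=> /Ck_on0 cc; apply/Ck_on0 => x Ox; apply: cvg_coord; exact: cc.
move=> /Ck_onS[cc dc Cc]; apply/Ck_onS; split=> [x Ox|x h Ox|h].
- by apply: cvg_coord; exact: cc.
- by have /derivable_mxP := dc x h Ox; exact.
- apply: (eq_Ck_on oO _ (IH _ (Cc h))) => x Ox.
  by rewrite derive_mx ?mxE //; exact: dc.
Qed.

Lemma Ck_on_row (U : normedModType R) n k (O : set U) (c : U -> 'rV[R]_n) :
  open O -> (forall i, Ck_on k O (fun q => c q 0 i)) -> Ck_on k O c.
Proof.
move=> oO; elim: k c => [|k IH] c Cc.
  apply/Ck_on0 => x Ox; apply: cvg_row => i.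
  by have /Ck_on0/(_ x Ox) := Cc i.
have dc x h : O x -> derivable c x h.
  move=> Ox; apply/derivable_mxP => i j; rewrite ord1.
  by have /Ck_onS[_ d _] := Cc j; exact: d.
apply/Ck_onS; split; [move=> x Ox|exact: dc|move=> h].
  apply: (cvg_row (FG := nbhs_filter x)) => i; have /Ck_onS[ci _ _] := Cc i; exact: ci.
apply: IH => i; have /Ck_onS[_ _ Ci] := Cc i.
by apply: (eq_Ck_on oO _ (Ci h)) => x Ox; rewrite derive_mx ?mxE //; exact: dc.
Qed.

Lemma Ck_on_comp (U : normedModType R) n k (O : set U) (O' : set 'rV[R]_n)
    (f : 'rV[R]_n -> R) (c : U -> 'rV[R]_n) :
  open O -> open O' -> (forall x, O x -> O' (c x)) ->
  Ck_on k O' f -> Ck_on k O c -> Ck_on k O (f \o c).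
Proof.
move=> oO oO' OO'; elim: k f => [|k IH] f.
  move=> /Ck_on0 cf /Ck_on0 cc; apply/Ck_on0 => x Ox.
  by apply: continuous_comp; [exact: cc|exact/cf/OO'].
move=> Cf Cc; have Cc' := Ck_onW (leqnSn k) Cc.
have /Ck_onS[ccx dcx Dc] := Cc; have /Ck_onS[cf df Df] := Cf.
have D x h : O x -> is_derive x h (f \o c) (dot (gradient f (c x)) ('D_h c x)).
  move=> Ox; apply: (is_derive_comp oO'); [|exact: OO'|exact/derivableP/dcx].
  exact: Ck_onW Cf.
apply/Ck_onS; split=> [x Ox|x h Ox|h].
- by apply: continuous_comp; [exact: ccx|exact/cf/OO'].
- by have [] := D x h Ox.
- have Csum : Ck_on k O (fun x => \sum_i (('D_(evec i) f \o c) \* (fun x => 'D_h c x 0 i)) x).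
    apply: (Ck_on_sum _ oO) => i; apply: (Ck_onM oO); first exact: IH.
    exact: (Ck_on_coord i oO (Dc h)).
  apply: (eq_Ck_on oO _ Csum) => x Ox; have [_ ->] := D x h Ox.
  by apply: eq_bigr => i _; rewrite mxE.
Qed.

(** Schwarz's theorem. The second difference [Delta] is symmetric in the two directions, and two
    mean value theorems turn it into [t * t] times a mixed derivative at a nearby point, in either
    order; continuity of both mixed derivatives at [x] concludes. *)
Lemma derivative_symmetric n (O : set 'rV[R]_n) (f : 'rV[R]_n -> R) x v w :
  open O -> Ck_on 2 O f -> O x -> 'D_v ('D_w f) x = 'D_w ('D_v f) x.
Proof.
move=> oO Cf Ox.
have [r r0 rO] := open_dist_lt oO Ox.
(* The parallelogram of side parameter [t] lies within [t * M] of [x]; the summand 1 keeps [M]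
   positive. *)
pose M := `|v| + `|w| + 1.
have M0 : 0 < M by rewrite ltr_wpDl // addr_ge0.
have near_x (a b : R) v' w' (t : R) : 0 <= a <= t -> 0 <= b <= t -> `|v'| + `|w'| + 1 = M ->
    `|x + a *: v' + b *: w' - x| <= t * M.
  move=> /andP[a0 at_] /andP[b0 bt] <-; rewrite addrC !addrA addNr add0r.
  apply: le_trans (ler_normD _ _) _; rewrite !normrZ !ger0_norm //.
  have t0 := le_trans a0 at_.
  apply: le_trans (_ : t * `|v'| + t * `|w'| <= _); last by nra.
  by apply: lerD; rewrite ler_wpM2r.
pose Delta (t : R) v w := (f (x + t *: v + t *: w) - f (x + t *: v))
  - (f (x + t *: w) - f x).
have /Ck_onS[_ df Cdf] := Cf.
have mv (t : R) v' w' : 0 < t -> t * M < r -> `|v'| + `|w'| + 1 = M ->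
    exists2 z, `|z - x| <= t * M & Delta t v' w' = t * t * 'D_w' ('D_v' f) z.
  move=> t0 tr MM.
  have inO (a b : R) : 0 <= a <= t -> 0 <= b <= t -> O (x + a *: v' + b *: w').
    by move=> at_ bt; apply: rO; apply: le_lt_trans tr; exact: near_x.
  have tt : 0 <= t <= t by rewrite lexx ltW.
  have t00 : (0 : R) <= 0 <= t by rewrite lexx ltW.
  pose g (s : R) := f (x + t *: w' + s *: v') - f (x + s *: v').
  have dg (s : R) : 0 <= s <= t -> is_derive s 1 g
      ('D_v' f (x + t *: w' + s *: v') - 'D_v' f (x + s *: v')).
    move=> st; apply: is_deriveB.
      by apply: is_derive_line; apply: df; rewrite addrAC; exact: inO.
    apply: is_derive_line; apply: df.
    by have := inO s 0 st t00; rewrite scale0r addr0.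
  have [|||c + cE] := @MVT_segment R g (fun s =>
      'D_v' f (x + t *: w' + s *: v') - 'D_v' f (x + s *: v')) 0 t.
  + exact: ltW.
  + by move=> s; rewrite in_itv /= => /andP[/ltW s0 /ltW s1]; apply: dg; rewrite s0.
  + apply: derivable_within_continuous => s; rewrite in_itv /= => st.
    by have [] := dg s st.
  rewrite in_itv /= => ct.
  have /Ck_onS[_ ddf _] := Cdf v'.
  pose k (s : R) := 'D_v' f (x + c *: v' + s *: w').
  have dk (s : R) : 0 <= s <= t -> is_derive s 1 k ('D_w' ('D_v' f) (x + c *: v' + s *: w')).
    by move=> st; apply: is_derive_line; apply: ddf; exact: inO.
  have [|||d + dE] := @MVT_segment R k (fun s =>
      'D_w' ('D_v' f) (x + c *: v' + s *: w')) 0 t.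
  + exact: ltW.
  + by move=> s; rewrite in_itv /= => /andP[/ltW s0 /ltW s1]; apply: dk; rewrite s0.
  + apply: derivable_within_continuous => s; rewrite in_itv /= => st.
    by have [] := dk s st.
  rewrite in_itv /= => dt; exists (x + c *: v' + d *: w'); first exact: near_x.
  move: cE dE; rewrite /g /k !scale0r !addr0 subr0 => cE dE.
  rewrite mulrC mulrA -dE; move: cE; rewrite (addrAC x (c *: v')) => <-.
  by rewrite /Delta (addrAC x).
have c1 : {for x, continuous ('D_w ('D_v f))}.
  have /Ck_onS[_ _ /(_ w) C] := Cdf v.
  exact: Ck_on_continuous C Ox.
have c2 : {for x, continuous ('D_v ('D_w f))}.
  have /Ck_onS[_ _ /(_ v) C] := Cdf w.
  exact: Ck_on_continuous C Ox.
apply/eqP; rewrite -subr_eq0 -normr_le0; apply/ler_addgt0Pl => e e0; rewrite addr0.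
have e20 : 0 < e / 2 by rewrite divr_gt0.
have /near_dist_ltP[d1 d10 H1] : \forall z \near x, `|'D_w ('D_v f) x - 'D_w ('D_v f) z| <= e / 2.
  exact: (cvgrPdist_le _ _).1 c1 _ e20.
have /near_dist_ltP[d2 d20 H2] : \forall z \near x, `|'D_v ('D_w f) x - 'D_v ('D_w f) z| <= e / 2.
  exact: (cvgrPdist_le _ _).1 c2 _ e20.
(* Makes [t * M] half of the smallest of the three radii. *)
pose t := Num.min r (Num.min d1 d2) / (2 * M).
have m0 : 0 < Num.min r (Num.min d1 d2) by rewrite !lt_min r0 d10 d20.
have t0 : 0 < t by rewrite divr_gt0 // mulr_gt0.
have tM : t * M < Num.min r (Num.min d1 d2).
  by rewrite /t invfM mulrA mulfVK ?gt_eqF // ltr_pdivrMr // ltr_pMr // ltr1n.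
move: (tM); rewrite !lt_min => /andP[tr /andP[td1 td2]].
have [z1 z1x E1] := mv t v w t0 tr erefl.
have MM : `|w| + `|v| + 1 = M by rewrite (addrC `|w|).
have [z2 z2x E2] := mv t w v t0 tr MM.
have E : 'D_w ('D_v f) z1 = 'D_v ('D_w f) z2.
  apply: (@mulfI _ (t * t)); first by rewrite mulf_neq0 // gt_eqF.
  apply: etrans (esym E1) (etrans _ E2); rewrite /Delta.
  have -> : x + t *: w + t *: v = x + t *: v + t *: w by rewrite addrAC.
  have sw (a b c d : R) : a - b - (c - d) = a - c - (b - d) by ring.
  exact: sw.
have {}H1 : `|'D_w ('D_v f) x - 'D_w ('D_v f) z1| <= e / 2.
  by apply: H1; exact: le_lt_trans td1.
have {}H2 : `|'D_v ('D_w f) x - 'D_v ('D_w f) z2| <= e / 2.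
  by apply: H2; exact: le_lt_trans td2.
rewrite (splitr e) -(subrKA ('D_v ('D_w f) z2)).
apply: le_trans (ler_normD _ _) _; apply: lerD; first exact: H2.
by rewrite -E distrC; exact: H1.
Qed.

(** * Limits of determinants, inverse matrices and rows *)

Section matrix_limits.
Context {T : Type} {G : set_system T} {FG : Filter G}.

Lemma cvg_det m (C : T -> 'M[R]_m) (C0 : 'M[R]_m) :
  (forall i j, C t i j @[t --> G] --> C0 i j) -> \det (C t) @[t --> G] --> \det C0.
Proof.
move=> CC; apply: cvg_sumr => s; apply: cvgM; first exact: cvg_cst.
exact: cvg_prodr.
Qed.

Lemma near_unitmx n (B : T -> 'M[R]_n) (B0 : 'M[R]_n) :
  (forall i j, B t i j @[t --> G] --> B0 i j) -> B0 \in unitmx ->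
  \forall t \near G, B t \in unitmx.
Proof.
rewrite unitmxE unitfE => BB d0.
have dt : \forall t \near G, \det (B t) != 0.
  by apply: (@cvgr_neq0 _ _ _ G _ (fun t => \det (B t)) (\det B0) _ d0); exact: cvg_det.
by apply: filterS dt => t dt; rewrite unitmxE unitfE.
Qed.

(** Cramer's formula gives the entries as cofactors over the determinant. Invertibility of the limit
    makes [B t] invertible eventually, where [invmx] is not at its default value. *)
Lemma cvg_invmx n (B : T -> 'M[R]_n) (B0 : 'M[R]_n) i j :
  (forall i j, B t i j @[t --> G] --> B0 i j) -> B0 \in unitmx ->
  invmx (B t) i j @[t --> G] --> invmx B0 i j.
Proof.
move=> BB uB; have d0 : \det B0 != 0 by move: uB; rewrite unitmxE unitfE.
have : (\det (B t))^-1 * \adj (B t) i j @[t --> G] --> (\det B0)^-1 * \adj B0 i j.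
  apply: cvgM; first by apply: cvgV => //; exact: cvg_det.
  rewrite mxE /cofactor; under eq_cvg do rewrite mxE.
  apply: cvgM; first exact: cvg_cst.
  by apply: cvg_det => k l; rewrite !mxE; under eq_cvg do rewrite !mxE; exact: BB.
have e : \forall t \near G,
    (\det (B t))^-1 * \adj (B t) i j = invmx (B t) i j.
  by apply: filterS (near_unitmx BB uB) => t ut; rewrite /invmx ut [RHS]mxE.
have -> : invmx B0 i j = (\det B0)^-1 * \adj B0 i j by rewrite /invmx uB mxE.
by apply: cvg_trans; exact: near_eq_cvg e.
Qed.

Lemma cvg_row_mx n1 n2 (a : T -> 'rV[R]_n1) (b : T -> 'rV[R]_n2)
    (a0 : 'rV[R]_n1) (b0 : 'rV[R]_n2) :
  a @ G --> a0 -> b @ G --> b0 -> row_mx (a t) (b t) @[t --> G] --> row_mx a0 b0.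
Proof.
move=> aa bb; apply: cvg_row => i; rewrite mxE; under eq_cvg do rewrite mxE.
by case: (fintype.split i) => j; exact: cvg_coord.
Qed.

Lemma cvg_mulmx n (u : T -> 'rV[R]_n) (B : T -> 'M[R]_n) (u0 : 'rV[R]_n) (B0 : 'M[R]_n) :
  u @ G --> u0 -> (forall i j, B t i j @[t --> G] --> B0 i j) ->
  u t *m B t @[t --> G] --> u0 *m B0.
Proof.
move=> cu cB; apply: cvg_row => i; rewrite mxE; under eq_cvg do rewrite mxE.
by apply: cvg_sumr => j; apply: cvgM => //; exact: cvg_coord.
Qed.

Lemma cvg_rowE n (F : 'I_n -> T -> R) (l : 'I_n -> R) :
  (forall j, F j t @[t --> G] --> l j) ->
  (\row_j F j t) @[t --> G] --> \row_j l j.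
Proof.
by move=> cF; apply: cvg_row => i; rewrite mxE; under eq_cvg do rewrite mxE; exact: cF.
Qed.

End matrix_limits.

Lemma dot_row_mx n1 n2 (a c : 'rV[R]_n1) (b d : 'rV[R]_n2) :
  dot (row_mx a b) (row_mx c d) = dot a c + dot b d.
Proof.
rewrite /dot big_split_ord; congr (_ + _); apply: eq_bigr => i _.
  by rewrite !row_mxEl.
by rewrite !row_mxEr.
Qed.

Lemma lsubmx_continuous n1 n2 : continuous (@lsubmx R 1 n1 n2).
Proof.
move=> x; apply: (cvg_row (FG := nbhs_filter x)) => i; rewrite mxE.
by under eq_cvg do rewrite mxE; exact: coord_continuous.
Qed.

Lemma rsubmx_continuous n1 n2 : continuous (@rsubmx R 1 n1 n2).
Proof.
move=> x; apply: (cvg_row (FG := nbhs_filter x)) => i; rewrite mxE.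
by under eq_cvg do rewrite mxE; exact: coord_continuous.
Qed.

End DirectionalCalculus.

Lemma Ck_on_inv {R : realType} (V : normedModType R) (O : set V) (f : V -> R) :
  open O -> (forall x, O x -> f x != 0) -> Ck_on 1 O f -> Ck_on 1 O (fun x => (f x)^-1).
Proof.
move=> oO f0 Cf; have /Ck_onS[cf df Df] := Cf.
have civ x : O x -> (f z)^-1 @[z --> x] --> (f x)^-1 by move=> Ox; exact: (cvgV (f0 x Ox) (cf x Ox)).
apply/Ck_onS; split=> [x Ox|x h Ox|h]; first exact: civ.
  exact: (derivableV (f0 x Ox) (df x h Ox)).
have C : Ck_on 0 O (fun x => - ((f x)^-1 * (f x)^-1) * 'D_h f x).
  apply/Ck_on0 => x Ox; have /Ck_on0 cD := Df h.
  exact: (cvgM (cvgN (cvgM (civ x Ox) (civ x Ox))) (cD x Ox)).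
apply: (eq_Ck_on oO _ C) => x Ox.
by rewrite (deriveV (f0 x Ox) (df x h Ox)) expr2 invfM.
Qed.

(** * Minkowski norms and the Legendre transform *)

Lemma is_derive_sumr {R : realType} {V : normedModType R} (I : Type) (r : seq I)
    (F : I -> V -> R) (dF : I -> R) x h :
  (forall i, is_derive x h (F i) (dF i)) ->
  is_derive x h (fun z => \sum_(i <- r) F i z) (\sum_(i <- r) dF i).
Proof.
move=> dFP; elim: r => [|i r IH].
  rewrite big_nil (_ : (fun z => _) = cst 0); first exact: is_derive_cst.
  by apply/funext => z; rewrite big_nil.
rewrite big_cons (_ : (fun z => _) = F i + (fun z => \sum_(j <- r) F j z)).
  exact: is_deriveD.
by apply/funext => z; rewrite big_cons.
Qed.

Lemma is_derive_affine {R : realType} (a b t : R) :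
  is_derive t 1 (fun s => a + s * b) b.
Proof.
rewrite (_ : (fun s => _) = cst a + b *: id).
  have d := is_deriveD (is_derive_cst a t 1) (is_deriveZ b (is_derive_id t 1)).
  by apply: is_derive_eq d _; rewrite add0r [LHS]mulr1.
by apply/funext => s; rewrite [LHS]/= mulrC.
Qed.

Lemma sup_max {R : realType} (E : set R) m : E m -> ubound E m -> sup E = m.
Proof.
move=> Em ubm; apply/eqP; rewrite eq_le; apply/andP; split.
  by apply: ge_sup => //; exists m.
by apply: ub_le_sup => //; exists m.
Qed.

Section Minkowski.
Context {R : realType} {n : nat}.
Variable f : 'rV[R]_n -> R.
Implicit Types (x y w xi : 'rV[R]_n).

(** Together with [dual_norm] and [legendre_transform], a version of [gmat], [Fstar] and [legendre]
    for a single tangent space; taken at [Fin F a x] they are convertible to the originals. *)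
Definition fundamental y : 'M[R]_n :=
  \matrix_(i, j)
    (2^-1 * 'D_(evec i) (fun z => 'D_(evec j) (fun w => f w ^+ 2) z) y).

Definition dual_norm xi : R := sup [set dot xi y | y in [set y | f y = 1]].

Definition legendre_transform xi : 'rV[R]_n :=
  if xi == 0 then 0
  else xget 0 [set y | y != 0 /\ xi = y *m fundamental y].

Definition minkowski_norm := [/\ forall y, 0 <= f y,
  forall y (l : R), 0 < l -> f (l *: y) = l * f y,
  forall k, Ck_on k [set y | y != 0] f &
  forall y, y != 0 -> forall w, w != 0 -> 0 < dot (w *m fundamental y) w].

Hypothesis mf : minkowski_norm.

Let f_ge0 y : 0 <= f y. Proof. by case: mf. Qed.

Let f_hom y (l : R) : 0 < l -> f (l *: y) = l * f y.
Proof. by case: mf => _ + _ _; exact. Qed.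

Let f_smooth k : Ck_on k [set y | y != 0] f.
Proof. by case: mf. Qed.

Let f_convex y : y != 0 -> forall w, w != 0 -> 0 < dot (w *m fundamental y) w.
Proof. by case: mf => _ _ _; exact. Qed.

Let S y := f y ^+ 2.

Lemma open_neq0 : open [set y : 'rV[R]_n | y != 0].
Proof.
rewrite (_ : mkset _ = ~` [set 0]); last first.
  by apply/seteqP; split => y /= /eqP.
by apply: closed_openC; apply: accessible_closed_set1; exact/hausdorff_accessible/norm_hausdorff.
Qed.

Lemma S_smooth k : Ck_on k [set y | y != 0] S.
Proof.
rewrite (_ : S = f \* f); last by apply/funext => y; rewrite /S expr2.
by apply: Ck_onM; [exact: open_neq0|exact: f_smooth|exact: f_smooth].
Qed.

Lemma S_derivable y h : y != 0 -> derivable S y h.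
Proof. by move=> y0; have /Ck_onS[_ + _] := @S_smooth 1; apply. Qed.

Lemma DS_smooth k w : Ck_on k [set y | y != 0] ('D_w S).
Proof. by have /Ck_onS[_ _] := @S_smooth k.+1; exact. Qed.

Lemma DS_derivable w y h : y != 0 -> derivable ('D_w S) y h.
Proof. by move=> y0; have /Ck_onS[_ + _] := @DS_smooth 1 w; apply. Qed.

Lemma minkowski0 : f 0 = 0.
Proof.
have := @f_hom 0 2 (ltr0n R 2); rewrite scaler0 => e.
by have : 2 * f 0 - f 0 = 0 by [rewrite -e subrr]; lra.
Qed.

Lemma S_hom y (l : R) : 0 < l -> S (l *: y) = l ^+ 2 * S y.
Proof. by move=> l0; rewrite /S f_hom // exprMn. Qed.

Lemma DS_hom w y (l : R) : 0 < l -> y != 0 -> 'D_w S (l *: y) = l * 'D_w S y.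
Proof.
move=> l0 y0.
have ly0 : l *: y != 0 by rewrite scaler_eq0 negb_or gt_eqF.
have e : 'D_w (fun z => S (l *: z)) y = l * 'D_w S (l *: y).
  rewrite -[RHS](deriveZdir l (S_derivable ly0)).
  have q : (fun t => t^-1 *: (((fun z => S (l *: z)) \o shift y) (t *: w) - S (l *: y))) =
      (fun t => t^-1 *: ((S \o shift (l *: y)) (t *: (l *: w)) - S (l *: y))).
    by apply/funext => t /=; congr (_ *: (S _ - _)); rewrite scalerDr !scalerA mulrC.
  by rewrite /derive q.
have e' : 'D_w (fun z => S (l *: z)) y = l ^+ 2 * 'D_w S y.
  rewrite (_ : (fun z => _) = l ^+ 2 *: S); first exact/deriveZ/S_derivable.
  by apply/funext => z; rewrite S_hom.
by apply: (mulfI (lt0r_neq0 l0)); rewrite -e e' expr2 mulrA.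
Qed.

(** Euler's relation: both sides of the homogeneity equation are differentiated at [l = 1]. It
    serves for [S], of degree 2, and for its directional derivatives, of degree 1. *)
Lemma euler_line (h : 'rV[R]_n -> R) y (c : R -> R) k : derivable h y y ->
  is_derive (1 : R) (1 : R) c k ->
  (forall l : R, 0 < l -> h (l *: y) = c l * h y) ->
  'D_y h y = k * h y.
Proof.
move=> dh dc hh.
have d1 : is_derive (1 : R) (1 : R) (fun l : R => h (0 + l *: y)) ('D_y h y).
  have e : 0 + (1 : R) *: y = y by rewrite scale1r add0r.
  have := @is_derive_line _ _ _ h 0 y 1; by rewrite e => /(_ dh).
have d2 : is_derive (1 : R) (1 : R) (h y *: c) (h y *: k) by apply: is_deriveZ.
have [_ E] : is_derive (1 : R) (1 : R) (h y *: c) ('D_y h y).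
  apply: near_eq_is_derive d1.
  apply: filterS (near_dist_lt (1 : R) (ltr01 : 0 < 1 :> R)) => t.
  rewrite ltr_norml => /andP[t1 _]; rewrite add0r hh; last by lra.
  by rewrite mulrC.
by apply: etrans (esym E) _; case: d2 => _ ->; rewrite mulrC.
Qed.

Lemma S_euler y : y != 0 -> 'D_y S y = 2 * S y.
Proof.
move=> y0; apply: (@euler_line S y (fun l => l ^+ 2)).
- exact: S_derivable.
- split; first exact: exprn_derivable.
  by rewrite exp_derive expr1n [LHS]mulr1 [LHS]mulr1.
- by move=> l l0; exact: S_hom.
Qed.

Lemma DS_euler w y : y != 0 -> 'D_y ('D_w S) y = 'D_w S y.
Proof.
move=> y0; rewrite -[RHS]mul1r; apply: (@euler_line ('D_w S) y id).
- exact: DS_derivable.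
- by move=> l l0; exact: DS_hom.
Qed.

(** Passing from coordinate directions to arbitrary ones needs linearity of directional derivatives
    in the direction, which comes from C^1 regularity off the origin through [derive_gradient]. *)
Lemma fundamental_mul y w z : y != 0 ->
  dot (z *m fundamental y) w = 2^-1 * 'D_z ('D_w S) y.
Proof.
move=> y0.
have DDw i : is_derive y z ('D_(evec i) S) (\sum_j z 0 j * 'D_(evec j) ('D_(evec i) S) y).
  have := derive_gradient z open_neq0 (@DS_smooth 1 (evec i)) y0.
  rewrite /dot => e; split; first exact: DS_derivable.
  by rewrite e; apply: eq_bigr => j _; rewrite mxE mulrC.
have D : is_derive y z (fun y => \sum_i w 0 i * 'D_(evec i) S y)
    (\sum_i w 0 i * \sum_j z 0 j * 'D_(evec j) ('D_(evec i) S) y).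
  by apply: is_derive_sumr => i; exact: is_deriveZ.
have [_ E] : is_derive y z ('D_w S) (\sum_i w 0 i * \sum_j z 0 j * 'D_(evec j) ('D_(evec i) S) y).
  apply: near_eq_is_derive D; have := open_nbhs_nbhs (conj open_neq0 y0).
  apply: filterS => v v0; rewrite (derive_gradient w open_neq0 (@S_smooth 1) v0).
  by apply: eq_bigr => i _; rewrite mxE mulrC.
rewrite E /dot mulr_sumr; apply: eq_bigr => i _.
rewrite mxE [LHS]mulrC [RHS]mulrCA; congr (_ * _); rewrite mulr_sumr.
by apply: eq_bigr => j _; rewrite mxE mulrCA.
Qed.

Lemma fundamental_sym y : y != 0 -> (fundamental y)^T = fundamental y.
Proof.
move=> y0; apply/matrixP => i j; rewrite mxE [LHS]mxE [RHS]mxE.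
have e := @derivative_symmetric R n _ S y (evec j) (evec i) open_neq0 (@S_smooth 2) y0.
exact: (f_equal ( *%R 2^-1) e).
Qed.

Lemma fundamental_unit y : y != 0 -> fundamental y \in unitmx.
Proof.
move=> y0; rewrite -row_free_unit -kermx_eq0; apply/negPn/negP => /rowV0Pn[v].
move=> /sub_kermxP v0 vn0; have := f_convex y0 vn0.
by rewrite v0 dot0l ltxx.
Qed.

Lemma dot_legendre y w : y != 0 -> dot (y *m fundamental y) w = 2^-1 * 'D_w S y.
Proof. by move=> y0; rewrite fundamental_mul // DS_euler. Qed.

Lemma dot_legendre_self y : y != 0 -> dot (y *m fundamental y) y = S y.
Proof. by move=> y0; rewrite dot_legendre // S_euler // mulKf. Qed.

Lemma minkowski_gt0 y : y != 0 -> 0 < f y.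
Proof.
move=> y0; have := f_convex y0 y0; rewrite dot_legendre_self // => S0.
by rewrite lt_def f_ge0 andbT -sqrf_eq0 gt_eqF.
Qed.

(** Strict convexity of [S / 2] along the segment from [y0] to [y], with the first-order term at
    [y0] given by the Legendre covector. Convexity comes from the Hessian, so the segment must avoid
    the origin. *)
Lemma fenchel y0 y : y0 != 0 -> y != y0 ->
  dot (y0 *m fundamental y0) y - 2^-1 * S y < 2^-1 * S y0.
Proof.
move=> y00 yy0; have S0 : 0 < S y0 by rewrite exprn_gt0 ?minkowski_gt0.
(* The segment meets the origin exactly when [y] lies on the ray opposite to [y0]; there the pairing
   is nonpositive and the inequality follows from [0 < S y0]. *)
have [[c c0 ->]|nray] := pselect (exists2 c : R, 0 <= c & y = - c *: y0).
  have := sqr_ge0 (f (- c *: y0)); rewrite -/(S _).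
  rewrite dotZr dot_legendre_self // => Sc; nra.
pose w := y - y0.
have w0 : w != 0 by rewrite subr_eq0.
have seg (t : R) : 0 <= t <= 1 -> y0 + t *: w != 0.
  move=> /andP[t0 t1]; apply/negP => /eqP e.
  have tn0 : t != 0.
    by apply/negP => /eqP t00; move: e; rewrite t00 scale0r addr0 => /eqP; exact/negP.
  apply: nray; exists ((1 - t) / t); first by rewrite divr_ge0 // subr_ge0.
  apply: (scalerI tn0); rewrite scalerA mulrN mulrCA divff // mulr1 scaleNr.
  by apply/eqP; rewrite -subr_eq0 opprK -e /w scalerBr scalerBl scale1r addrCA.
(* The first mean value theorem turns [S y - S y0] into a slope at [c]; the second, on [[0, c]],
   shows that this slope exceeds the slope at 0. *)
have [||c + cE] := @MVT R (fun t => S (y0 + t *: w)) (fun t => 'D_w S (y0 + t *: w)) 0 1 ltr01.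
- move=> t; rewrite in_itv /= => /andP[/ltW t0 /ltW t1].
  by apply/is_derive_line/S_derivable/seg; rewrite t0.
- apply: derivable_within_continuous => t; rewrite in_itv /= => t01.
  by have [] := is_derive_line (S_derivable (seg t t01)).
rewrite in_itv /= => /andP[c0 c1].
have [||d + dE] := @MVT R (fun t => 'D_w S (y0 + t *: w))
    (fun t => 'D_w ('D_w S) (y0 + t *: w)) 0 c c0.
- move=> t; rewrite in_itv /= => /andP[/ltW t0 tc].
  apply: (@is_derive_line _ _ _ ('D_w S)); apply: DS_derivable; apply: seg.
  by rewrite t0 ltW // (lt_trans tc).
- apply: derivable_within_continuous => t; rewrite in_itv /= => /andP[t0 tc].
  have t01 : 0 <= t <= 1 by rewrite t0 (le_trans tc) // ltW.
  by have [] := @is_derive_line _ _ _ ('D_w S) y0 w t (DS_derivable (seg t t01)).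
rewrite in_itv /= => /andP[d0 dc].
have dw : y0 + d *: w != 0 by apply: seg; rewrite ltW //= ltW // (lt_trans dc).
have cvx := f_convex dw w0.
have fm := fundamental_mul w w dw.
rewrite fm in cvx.
move: cE dE.
rewrite !scale0r !addr0.
rewrite scale1r !subr0 mulr1.
have -> : y0 + w = y by rewrite addrC subrK.
move=> cE dE.
have dD : 'D_w S y0 < 'D_w S (y0 + c *: w).
  by rewrite -subr_gt0 dE; nra.
have : dot (y0 *m fundamental y0) w = 2^-1 * 'D_w S y0 by rewrite dot_legendre.
rewrite dotBr dot_legendre_self //; lra.
Qed.

Lemma sphere_compact : compact [set y : 'rV[R]_n | `|y| = 1].
Proof.
apply: bounded_closed_compact.
  by exists 1; split=> // e e1 y /= ->; exact: ltW.
rewrite (_ : mkset _ = (@Num.norm _ _) @^-1` [set 1]) //.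
apply: closed_comp => [y _|]; first exact: norm_continuous.
exact: closed_eq.
Qed.

(** [xi / f] attains a maximum [r] on the compact unit sphere of the sup norm, at [y1] say. Then
    [r * f - xi] is nonnegative off the origin and vanishes at [y1], so its differential there is
    zero and [xi] is [r] times the differential of [f]. *)
Lemma legendre_exists xi : xi != 0 -> exists2 y, y != 0 & xi = y *m fundamental y.
Proof.
move=> xi0.
have unit_neq0 y : `|y| = 1 -> y != 0.
  by move=> y1; rewrite -normr_gt0 y1.
have normalize y : y != 0 -> `| `|y|^-1 *: y| = 1.
  by move=> y0; rewrite normrZ ger0_norm ?invr_ge0 // mulVf // normr_eq0.
have Sne : [set y : 'rV[R]_n | `|y| = 1] !=set0.
  by exists (`|xi|^-1 *: xi) => /=; exact: normalize.
have rc : {within [set y : 'rV[R]_n | `|y| = 1], continuous (fun y => dot xi y / f y)}.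
  apply: continuous_in_subspaceT => y /[!inE] /= /unit_neq0 y0.
  have c1 : dot xi z @[z --> y] --> dot xi y.
    exact: (cvg_dot (FG := nbhs_filter y) (cvg_cst xi) cvg_id).
  have c2 : f z @[z --> y] --> f y by exact: Ck_on_continuous (@f_smooth 0) y0.
  have fy0 : f y != 0 by rewrite gt_eqF // minkowski_gt0.
  exact: (cvgM c1 (cvgV fy0 c2)).
have [y1 y1S y1max] := compact_EVT_max Sne sphere_compact rc.
have y10 : y1 != 0 by apply: unit_neq0; move: y1S; rewrite inE.
have fy1 := minkowski_gt0 y10.
pose r := dot xi y1 / f y1.
have rmax y : y != 0 -> dot xi y <= r * f y.
  move=> y0; have /y1max : `|y|^-1 *: y \in [set y : 'rV[R]_n | `|y| = 1].
    by rewrite inE /=; exact: normalize.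
  have ny : 0 < `|y| by rewrite normr_gt0.
  rewrite f_hom ?invr_gt0 // dotZr -mulf_div divff ?mul1r ?invr_neq0 ?gt_eqF //.
  by rewrite ler_pdivrMr ?minkowski_gt0.
(* Tested on the vector with the same components as [xi], on which [xi] is a sum of squares. *)
have r0 : 0 < r.
  have xixi : 0 < dot xi xi.
    have [i xii] : exists i, xi 0 i != 0.
      by have /rV0Pn := xi0.
    rewrite /dot (bigD1 i) //= ltr_wpDr ?sumr_ge0 //.
      by move=> j _; rewrite -expr2 sqr_ge0.
    by rewrite -expr2 exprn_even_gt0.
  have := lt_le_trans xixi (rmax xi xi0).
  by rewrite pmulr_lgt0 // minkowski_gt0.
have crit w : dot xi w = r * 'D_w f y1.
  (* For [|t| < e] the displacement [t *: w] is shorter than [y1], which has norm 1, so the line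
     stays off the origin. *)
  pose e := (`|w| + 1)^-1.
  have e0 : 0 < e by rewrite invr_gt0 ltr_wpDl.
  have ne (t : R) : `|t| < e -> y1 + t *: w != 0.
    move=> te; rewrite addr_eq0; apply/negP => /eqP y1e.
    have : `|y1| = 1 by move: y1S; rewrite inE.
    rewrite y1e normrN normrZ => tw.
    have : `|t| * (`|w| + 1) < 1 by rewrite -ltr_pdivlMr ?ltr_wpDl // mul1r.
    by have := normr_ge0 t; lra.
  pose k (t : R) := r * f (y1 + t *: w) - dot xi (y1 + t *: w).
  have dk (t : R) : `|t| < e -> is_derive t 1 k (r * 'D_w f (y1 + t *: w) - dot xi w).
    move=> te; apply: is_deriveB.
      apply/is_deriveZ/is_derive_line.
      by have /Ck_onS[_ + _] := @f_smooth 1; apply; exact: ne.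
    rewrite (_ : (fun t => _) = (fun t => dot xi y1 + t * dot xi w)); last first.
      by apply/funext => s; rewrite dotDr dotZr.
    exact: is_derive_affine.
  have : is_derive (0 : R) 1 k 0.
    apply: (@derive1_at_min R k (- e) e 0).
    - lra.
    - by move=> t; rewrite in_itv /= -ltr_norml => /dk[].
    - by rewrite in_itv /= e0 oppr_lt0 e0.
    - move=> t; rewrite in_itv /= -ltr_norml => te.
      rewrite /k scale0r addr0 {1}/r mulfVK ?gt_eqF // subrr subr_ge0.
      exact/rmax/ne.
  have := dk 0; rewrite normr0 scale0r addr0 => /(_ e0)[_ E1] [_ E2].
  by move: E2; rewrite E1; lra.
have s0 : 0 < r / f y1 by rewrite divr_gt0.
(* Half the differential of [S] at [l *: y1] is [l * f y1] times that of [f] at [y1]; this factor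
   equals [r] for the scale chosen here. *)
exists (r / f y1 *: y1); first by rewrite scaler_eq0 negb_or gt_eqF.
have sy0 : r / f y1 *: y1 != 0 by rewrite scaler_eq0 negb_or gt_eqF.
apply: dot_inj => w; rewrite dot_legendre // DS_hom // crit.
have -> : 'D_w S y1 = 2 * (f y1 * 'D_w f y1).
  have df : derivable f y1 w by have /Ck_onS[_ + _] := @f_smooth 1; apply.
  rewrite (_ : S = f * f); last by apply/funext => y; rewrite /S expr2.
  by rewrite deriveM // mulr_natl mulr2n.
have f0 : f y1 != 0 by rewrite gt_eqF.
by field.
Qed.

Lemma legendre_transformP xi : xi != 0 -> legendre_transform xi != 0 /\
  xi = legendre_transform xi *m fundamental (legendre_transform xi).
Proof.
move=> xi0; rewrite /legendre_transform (negPf xi0); case: xgetP => [y _ //|].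
by have [y y0 e] := legendre_exists xi0 => /(_ y)[].
Qed.

Lemma legendre_transform0 : legendre_transform 0 = 0.
Proof. by rewrite /legendre_transform eqxx. Qed.

(** The supremum is attained at the Legendre vector scaled to norm 1. This is the identity
    [F(grad u) = F*(Du)]. *)
Lemma dual_normE xi : dual_norm xi = f (legendre_transform xi).
Proof.
have [->|xi0] := eqVneq xi 0.
  rewrite legendre_transform0 minkowski0 /dual_norm.
  have [[y fy]|ne] := pselect ([set y | f y = 1] !=set0).
    apply: sup_max; first by exists y; rewrite ?dot0l.
    by move=> t [z _ <-]; rewrite dot0l.
  (* In dimension 0 no vector has norm 1, and the supremum of the empty set is 0 by convention. *)
  rewrite (_ : image _ _ = set0) ?sup0 //; apply/seteqP; split => // t [y fy _].
  by apply: ne; exists y.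
have [y0] := legendre_transformP xi0; set y := legendre_transform xi => e.
have fy := minkowski_gt0 y0.
have fs : f ((f y)^-1 *: y) = 1 by rewrite f_hom ?invr_gt0 // mulVf ?gt_eqF.
apply: sup_max.
  exists ((f y)^-1 *: y) => //; rewrite dotZr {1}e dot_legendre_self // /S.
  by rewrite expr2 mulKf ?gt_eqF.
move=> _ [z /= fz <-].
have e' : dot xi y = f y ^+ 2 by rewrite {1}e dot_legendre_self.
have [zy|zy] := eqVneq (f y *: z) y.
  have := dotZr (f y) xi z; rewrite zy e' expr2 => /(mulfI (lt0r_neq0 fy)) <-.
  exact: lexx.
(* The competitor [f y *: z] has the same norm as [y], so the quadratic inequality reduces to the
   linear bound [dot xi z < f y]. *)
have := fenchel y0 zy; rewrite -e dotZr S_hom // /S fz; nra.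
Qed.

Lemma legendre_dot xi :
  dot xi (legendre_transform xi) = f (legendre_transform xi) ^+ 2.
Proof.
have [->|xi0] := eqVneq xi 0.
  by rewrite legendre_transform0 dot0l minkowski0 expr0n.
have [y0 e] := legendre_transformP xi0.
by rewrite {1}e dot_legendre_self.
Qed.

(** The Legendre vector is the only maximiser, also for [xi = 0], where this is positivity of [f]
    off the origin. The characterisation involves no derivative and no coordinates, and so yields
    continuity, convexity and independence of the chart. *)
Lemma legendre_max xi y : y != legendre_transform xi ->
  dot xi y - 2^-1 * f y ^+ 2 < 2^-1 * dual_norm xi ^+ 2.
Proof.
rewrite dual_normE; have [->|xi0 yy0] := eqVneq xi 0.
  rewrite legendre_transform0 => /minkowski_gt0 fy.
  by rewrite dot0l minkowski0; nra.
have [y0 e] := legendre_transformP xi0.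
by rewrite {1}e; exact: fenchel.
Qed.

Lemma legendre_max_eq xi :
  dot xi (legendre_transform xi) - 2^-1 * f (legendre_transform xi) ^+ 2 =
  2^-1 * dual_norm xi ^+ 2.
Proof. by rewrite dual_normE legendre_dot; lra. Qed.

Lemma legendre_max_le xi y :
  dot xi y - 2^-1 * f y ^+ 2 <= 2^-1 * dual_norm xi ^+ 2.
Proof.
have [->|yy0] := eqVneq y (legendre_transform xi); first by rewrite legendre_max_eq.
by rewrite ltW // legendre_max.
Qed.

End Minkowski.

(** * Smooth families of Minkowski norms *)

Section FinslerFamily.
Context {R : realType} {n : nat}.
Variables (O : set 'rV[R]_n) (f : 'rV[R]_n -> 'rV[R]_n -> R).
Implicit Types (x y w xi : 'rV[R]_n).
Hypothesis oO : open O.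
Hypothesis f_ge0 : forall x y, O x -> 0 <= f x y.
Hypothesis f_hom : forall x y (l : R), O x -> 0 < l -> f x (l *: y) = l * f x y.
Hypothesis f_smooth :
  smooth_on [set z : 'rV[R]_n * 'rV[R]_n | O z.1 /\ z.2 != 0] (fun z => f z.1 z.2).
Hypothesis f_convex : forall x y, O x -> y != 0 ->
  forall w, w != 0 -> 0 < dot (w *m fundamental (f x) y) w.

(** The tangent bundle without its zero section, with [(x, y)] concatenated into one row, since
    slope functions and the chain rule are stated for functions of a row. *)
Definition slit : set 'rV[R]_(n + n) := [set z | O (lsubmx z) /\ rsubmx z != 0].

Definition square (z : 'rV[R]_(n + n)) : R := f (lsubmx z) (rsubmx z) ^+ 2.

Lemma open_slit : open slit.
Proof.
apply: openI.
  by apply: (@open_comp _ _ (@lsubmx R 1 n n)) => // z _; exact: lsubmx_continuous.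
apply: (@open_comp _ _ (@rsubmx R 1 n n) [set y | y != 0]); last exact: open_neq0.
by move=> z _; exact: rsubmx_continuous.
Qed.

Let splitmx (z : 'rV[R]_(n + n)) := (lsubmx z, rsubmx z).

Let splitmx_linear : linear splitmx.
Proof.
by move=> a u v; congr (_, _); apply/rowP => i; rewrite !mxE.
Qed.

HB.instance Definition _ := GRing.isLinear.Build R 'rV[R]_(n + n)
  ('rV[R]_n * 'rV[R]_n)%type _ splitmx splitmx_linear.

Let f2_smooth k : Ck_on k slit (fun z => f (lsubmx z) (rsubmx z)).
Proof.
have cs : continuous splitmx.
  by move=> z; exact: (cvg_pair (@lsubmx_continuous R n n z) (@rsubmx_continuous R n n z)).
have := Ck_on_comp_affine 0 cs (@f_smooth k).
rewrite (_ : mkset _ = slit); last first.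
  by apply/seteqP; split => z; rewrite /slit /= !addr0.
by rewrite (_ : (fun _ => _) = fun z => f (lsubmx z) (rsubmx z)) //; apply/funext => z /=; rewrite !addr0.
Qed.

Lemma square_smooth k : Ck_on k slit square.
Proof.
rewrite (_ : square = (fun z => f (lsubmx z) (rsubmx z)) \* (fun z => f (lsubmx z) (rsubmx z))).
  exact: (Ck_onM open_slit (@f2_smooth k) (@f2_smooth k)).
by apply/funext => z; rewrite /square expr2.
Qed.

Lemma slit_row x y : O x -> y != 0 -> slit (row_mx x y).
Proof. by rewrite /slit /= row_mxKl row_mxKr. Qed.

Let inr_mx (y : 'rV[R]_n) : 'rV[R]_(n + n) := row_mx 0 y.

Let inr_mx_linear : linear inr_mx.
Proof.
by move=> a u v; rewrite /inr_mx scale_row_mx add_row_mx scaler0 addr0.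
Qed.

HB.instance Definition _ := GRing.isLinear.Build R 'rV[R]_n 'rV[R]_(n + n) _ inr_mx inr_mx_linear.

Lemma slice_smooth x k : O x -> Ck_on k [set y | y != 0] (f x).
Proof.
move=> Ox; have ci : continuous inr_mx.
  by move=> z; apply: (cvg_row_mx (FG := nbhs_filter z)); [exact: cvg_cst|exact: cvg_id].
have := Ck_on_comp_affine (row_mx x 0) ci (@f2_smooth k).
have e y : inr_mx y + row_mx x 0 = row_mx x y by rewrite /inr_mx add_row_mx addr0 add0r.
rewrite (_ : mkset _ = [set y | y != 0]); last first.
  apply/seteqP; split => z; rewrite /slit /= e row_mxKl row_mxKr //.
  by case.
rewrite (_ : (fun _ => _) = f x) //.
by apply/funext => z; rewrite e row_mxKl row_mxKr.
Qed.

(** [row_mx 0 w] is the vertical direction [w] of the tangent bundle and [row_mx w 0] the horizontal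
    one in the given coordinates. *)
Lemma derive_slice x y w : 'D_w (fun y => f x y ^+ 2) y = 'D_(row_mx 0 w) square (row_mx x y).
Proof.
have q : (fun t => t^-1 *: (((fun y => f x y ^+ 2) \o shift y) (t *: w) - f x y ^+ 2)) =
    (fun t => t^-1 *: ((square \o shift (row_mx x y)) (t *: row_mx 0 w) - square (row_mx x y))).
  apply/funext => t; rewrite /square /= scale_row_mx add_row_mx scaler0 add0r.
  by rewrite !row_mxKl !row_mxKr.
by rewrite /derive q.
Qed.

Lemma derive2_slice x y w v : 'D_v (fun z => 'D_w (fun y => f x y ^+ 2) z) y =
  'D_(row_mx 0 v) ('D_(row_mx 0 w) square) (row_mx x y).
Proof.
have q : (fun t => t^-1 *: (((fun z => 'D_w (fun y => f x y ^+ 2) z) \o shift y) (t *: v)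
      - 'D_w (fun y => f x y ^+ 2) y)) =
    (fun t => t^-1 *: (('D_(row_mx 0 w) square \o shift (row_mx x y)) (t *: row_mx 0 v)
      - 'D_(row_mx 0 w) square (row_mx x y))).
  apply/funext => t /=; rewrite !derive_slice scale_row_mx add_row_mx scaler0 add0r.
  by [].
by rewrite /derive q.
Qed.

Lemma fundamentalE x y i j : fundamental (f x) y i j =
  2^-1 * 'D_(row_mx 0 (evec i)) ('D_(row_mx 0 (evec j)) square) (row_mx x y).
Proof. by rewrite mxE derive2_slice. Qed.

Section limits.
Context {T : Type} {G : set_system T} {FG : Filter G}.
Implicit Types (xt yt xit : T -> 'rV[R]_n).

Lemma cvg_on_slit (h : 'rV[R]_(n + n) -> R) xt yt x y : Ck_on 0 slit h ->
  O x -> y != 0 -> xt @ G --> x -> yt @ G --> y ->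
  h (row_mx (xt t) (yt t)) @[t --> G] --> h (row_mx x y).
Proof.
move=> Ch Ox y0 cx cy; have ch := Ck_on_continuous Ch (slit_row Ox y0).
exact: (cvg_comp _ _ (cvg_row_mx cx cy) ch).
Qed.

Lemma cvg_finsler xt yt x y : O x -> y != 0 -> xt @ G --> x -> yt @ G --> y ->
  f (xt t) (yt t) @[t --> G] --> f x y.
Proof.
move=> Ox y0 cx cy; have := cvg_on_slit (@f2_smooth 0) Ox y0 cx cy.
rewrite row_mxKl row_mxKr; under eq_cvg do rewrite row_mxKl row_mxKr.
by [].
Qed.

End limits.

Lemma slice_minkowski x : O x -> minkowski_norm (f x).
Proof.
move=> Ox; split=> [y|y l|k|y]; [exact: f_ge0|exact: f_hom| |exact: f_convex].
exact: slice_smooth.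
Qed.

Section limits.
Context {T : Type} {G : set_system T} {FG : Filter G}.
Implicit Types (xt yt xit : T -> 'rV[R]_n).

(** On the compact unit sphere [f x] lies strictly between two positive constants. The near-covering
    form of compactness keeps these strict bounds for [f (xt t)], uniformly on the sphere, and
    homogeneity extends them to all vectors. *)
Lemma near_norm_equiv xt x : O x -> xt @ G --> x -> exists c C : R,
  [/\ 0 < c, 0 < C & \forall t \near G, forall y,
    c * `|y| <= f (xt t) y /\ f (xt t) y <= C * `|y|].
Proof.
move=> Ox cx.
have unit_neq0 y : `|y| = 1 -> y != 0 by move=> y1; rewrite -normr_gt0 y1.
have [c [C [c0 C0 sph]]] : exists c C : R, [/\ 0 < c, 0 < C &
    forall y, `|y| = 1 -> c < f x y < C].
  (* In dimension 0 the sphere is empty and any constants do. *)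
  have [Sne|Sempty] := pselect ([set y : 'rV[R]_n | `|y| = 1] !=set0); last first.
    by exists 1, 1; split=> // y y1; case: Sempty; exists y.
  have fc : {within [set y : 'rV[R]_n | `|y| = 1], continuous (f x)}.
    apply: continuous_in_subspaceT => y /[!inE] /= /unit_neq0 y0.
    exact: Ck_on_continuous (@slice_smooth x 0 Ox) y0.
  have [y1 /[!inE] /= y11 mx] := compact_EVT_max Sne (@sphere_compact R n) fc.
  have [y2 /[!inE] /= y22 mn] := compact_EVT_min Sne (@sphere_compact R n) fc.
  have f1 := minkowski_gt0 (slice_minkowski Ox) (unit_neq0 _ y11).
  have f2 := minkowski_gt0 (slice_minkowski Ox) (unit_neq0 _ y22).
  exists (f x y2 / 2), (f x y1 + 1); split; [lra|lra|move=> y yS].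
  have := mx y; have := mn y; rewrite !inE => /(_ yS) ? /(_ yS) ?.
  by apply/andP; split; lra.
exists c, C; split=> //.
have cov : \forall t \near G, [set y : 'rV[R]_n | `|y| = 1] `<=`
    (fun y => c < f (xt t) y < C).
  apply: (proj1 (compact_near_coveringP _) (@sphere_compact R n)) => y /= y1.
  have y0 := unit_neq0 y y1; have /andP[cf fC] := sph y y1.
  have cfst : (fun p : 'rV[R]_n * T => xt p.2) @ filter_prod (nbhs y) G --> x.
    exact: (cvg_comp _ _ cvg_snd cx).
  have FP : Filter (filter_prod (nbhs y) G) by exact: filter_prod_filter.
  have cxy : f (xt p.2) p.1 @[p --> filter_prod (nbhs y) G] --> f x y.
    exact: (cvg_finsler Ox y0 cfst cvg_fst).
  have H1 := cvgr_gt _ cxy _ cf; have H2 := cvgr_lt _ cxy _ fC.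
  have H : filter_prod (nbhs y) G (fun p => c < f (xt p.2) p.1 < C).
    exact: (@filterS2 _ _ FP _ _ _ (fun p a b => introT andP (conj a b)) (H1 FP) (H2 FP)).
  exact: H.
have Oxt : \forall t \near G, O (xt t) by exact: (cx _ (open_nbhs_nbhs (conj oO Ox))).
apply: filterS2 cov Oxt => t cov Oxt y.
have [->|y0] := eqVneq y 0.
  by rewrite normr0 !mulr0 (minkowski0 (slice_minkowski Oxt)).
have ny : 0 < `|y| by rewrite normr_gt0.
have /cov /andP[/ltW cf /ltW fC] : `| `|y|^-1 *: y| = 1.
  by rewrite normrZ ger0_norm ?invr_ge0 // mulVf // gt_eqF.
have -> : f (xt t) y = `|y| * f (xt t) (`|y|^-1 *: y).
  by rewrite -f_hom // scalerA divff ?scale1r // gt_eqF.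
by rewrite mulrC ler_pM2l // (mulrC C) ler_pM2l.
Qed.

(** Off the zero section this is smoothness. At [y = 0] the bound by [C] times the norm, uniform in
    the base point, forces the limit 0. *)
Lemma cvg_square xt yt x y : O x -> xt @ G --> x -> yt @ G --> y ->
  f (xt t) (yt t) ^+ 2 @[t --> G] --> f x y ^+ 2.
Proof.
move=> Ox cx cy.
suff c : f (xt t) (yt t) @[t --> G] --> f x y.
  under eq_cvg do rewrite expr2.
  by rewrite expr2; exact: (cvgM c c).
have [y0|y0] := eqVneq y 0; last exact: cvg_finsler.
rewrite y0 in cy *; rewrite (minkowski0 (slice_minkowski Ox)).
have [c [C [c0 C0 eqv]]] := near_norm_equiv Ox cx.
apply/cvgrPdist_lt => e e0.
have eC : 0 < e / C by rewrite divr_gt0.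
have H : \forall t \near G, `|0 - yt t| < e / C by exact: ((cvgrPdist_lt _ _).1 cy _ eC).
apply: filterS2 eqv H => t eqv; rewrite sub0r normrN => ytC.
have [lo hi] := eqv (yt t); rewrite sub0r normrN ger0_norm.
  by apply: le_lt_trans hi _; rewrite mulrC -ltr_pdivlMr.
by apply: le_trans lo; rewrite mulr_ge0 // ltW.
Qed.

End limits.

(** * Continuity of the Legendre transform in the base point and the covector *)

Section legendre_limits.
Context {T : Type} {G : set_system T} {FG : Filter G}.
Implicit Types (xt yt xit : T -> 'rV[R]_n).

(** Stability of a strict maximum: the maximisers stay in a fixed ball, and on the compact part of
    that ball at distance at least [e] from [y0] the functional [Phi] is eventually below its value
    at [y0]. The case [xi = 0] is included. *)
Lemma cvg_legendre xt xit x xi : O x -> xt @ G --> x -> xit @ G --> xi ->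
  legendre_transform (f (xt t)) (xit t) @[t --> G] --> legendre_transform (f x) xi.
Proof.
move=> Ox cx cxi; set y0 := legendre_transform (f x) xi.
pose y t := legendre_transform (f (xt t)) (xit t).
pose Phi x xi y := dot xi y - 2^-1 * f x y ^+ 2.
have [c [C [c0 C0 eqv]]] := near_norm_equiv Ox cx.
have Oxt : \forall t \near G, O (xt t) by exact: (cx _ (open_nbhs_nbhs (conj oO Ox))).
(* From [c^2 |y|^2 <= f(y)^2 = xi(y) <= n |xi| |y|] for the Legendre vector [y], where eventually
   [|xit t| <= |xi| + 1]. *)
pose B := n%:R * (`|xi| + 1) / c ^+ 2.
have bounded : \forall t \near G, `|y t| <= B.
  have xi1 : \forall t \near G, `|xi - xit t| < 1 by exact: ((cvgrPdist_lt _ _).1 cxi _ ltr01).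
  apply: filterS3 eqv Oxt xi1 => t eqv Oxt xi1.
  have [lo _] := eqv (y t).
  have d := legendre_dot (slice_minkowski Oxt) (xit t); rewrite -/(y t) in d.
  have dn := dot_le_norm (xit t) (y t).
  have nxi : `|xit t| <= `|xi| + 1.
    rewrite -lerBlDl; apply: ltW; apply: le_lt_trans xi1.
    by rewrite distrC; exact: lerB_dist.
  have [yt0|yt0] := eqVneq `|y t| 0; first by rewrite yt0 /B !mulr_ge0 ?invr_ge0 ?sqr_ge0 // addr_ge0.
  have yt1 : 0 < `|y t| by rewrite lt_def yt0 normr_ge0.
  rewrite /B ler_pdivlMr ?exprn_gt0 // -(ler_pM2l yt1).
  have nr : 0 <= n%:R :> R by [].
  have sq : (c * `|y t|) ^+ 2 <= f (xt t) (y t) ^+ 2.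
    by apply: lerXn2r => //; rewrite nnegrE ?f_ge0 // mulr_ge0 // ltW.
  have up : n%:R * (`|xit t| * `|y t|) <= n%:R * ((`|xi| + 1) * `|y t|).
    by apply: ler_wpM2l => //; apply: ler_wpM2r.
  have := ler_norm (dot (xit t) (y t)).
  move: sq; rewrite exprMn => sq; lra.
apply/cvgrPdist_lt => e e0.
pose K := [set z : 'rV[R]_n | `|z| <= B /\ e <= `|z - y0|].
have cK : compact K.
  apply: bounded_closed_compact.
    exists B; split; first exact: num_real.
    by move=> r Br z [zB _]; apply: le_trans zB (ltW Br).
  apply: closedI.
    apply: (@closed_comp _ _ (fun z : 'rV[R]_n => `|z|) [set r | r <= B]).
      by move=> z _; exact: norm_continuous.
    exact: closed_le.
  apply: (@closed_comp _ _ (fun z : 'rV[R]_n => `|z - y0|) [set r | e <= r]).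
    move=> z _; apply: continuous_comp; last exact: norm_continuous.
    exact: (cvgB cvg_id (cvg_cst y0)).
  exact: closed_ge.
(* The strict inequality holds at each [z] of [K] in the limit, hence near [z] and eventually in
   [t]; compactness of [K] makes it uniform. *)
have cov : \forall t \near G, K `<=` (fun z => Phi (xt t) (xit t) z < Phi (xt t) (xit t) y0).
  apply: (proj1 (compact_near_coveringP _) cK) => z [_ zy0].
  have FP : Filter (filter_prod (nbhs z) G) by exact: filter_prod_filter.
  have cx2 : (fun p : 'rV[R]_n * T => xt p.2) @ filter_prod (nbhs z) G --> x.
    exact: (cvg_comp _ _ cvg_snd cx).
  have cxi2 : (fun p : 'rV[R]_n * T => xit p.2) @ filter_prod (nbhs z) G --> xi.
    exact: (cvg_comp _ _ cvg_snd cxi).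
  have c1 : Phi (xt p.2) (xit p.2) p.1 @[p --> filter_prod (nbhs z) G] --> Phi x xi z.
    apply: cvgB; first exact: (cvg_dot (FG := FP) cxi2 cvg_fst).
    exact: (cvgM (cvg_cst _) (cvg_square Ox cx2 cvg_fst)).
  have c2 : Phi (xt p.2) (xit p.2) y0 @[p --> filter_prod (nbhs z) G] --> Phi x xi y0.
    apply: cvgB; first exact: (cvg_dot (FG := FP) cxi2 (cvg_cst y0)).
    exact: (cvgM (cvg_cst _) (cvg_square Ox cx2 (cvg_cst y0))).
  have lt12 : 0 < Phi x xi y0 - Phi x xi z.
    rewrite subr_gt0 [ltRHS](legendre_max_eq (slice_minkowski Ox)).
    apply: (legendre_max (slice_minkowski Ox)).
    by apply/negP => /eqP zE; move: zy0; rewrite zE subrr normr0 leNgt e0.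
  have H' : filter_prod (nbhs z) G (fun p => Phi (xt p.2) (xit p.2) p.1 < Phi (xt p.2) (xit p.2) y0).
    have H : \forall p \near filter_prod (nbhs z) G,
        0 < Phi (xt p.2) (xit p.2) y0 - Phi (xt p.2) (xit p.2) p.1.
      exact: (cvgr_gt _ (cvgB c2 c1) _ lt12).
    by apply: (@filterS _ _ FP _ _ _ H) => p; rewrite subr_gt0.
  exact: H'.
apply: filterS3 bounded cov Oxt => t ytB cov Oxt.
rewrite distrC ltNge; apply/negP => ey.
have /cov : K (y t) by [].
rewrite ltNge [leRHS](legendre_max_eq (slice_minkowski Oxt)).
by rewrite (legendre_max_le (slice_minkowski Oxt)).
Qed.

Lemma cvg_dual_norm2 xt xit x xi : O x -> xt @ G --> x -> xit @ G --> xi ->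
  dual_norm (f (xt t)) (xit t) ^+ 2 @[t --> G] --> dual_norm (f x) xi ^+ 2.
Proof.
move=> Ox cx cxi; have Oxt : \forall t \near G, O (xt t) by exact: (cx _ (open_nbhs_nbhs (conj oO Ox))).
have c : f (xt t) (legendre_transform (f (xt t)) (xit t)) ^+ 2 @[t --> G] -->
    f x (legendre_transform (f x) xi) ^+ 2.
  by apply: (cvg_square Ox cx); exact: cvg_legendre.
rewrite (dual_normE (slice_minkowski Ox)).
have e : \forall t \near G, f (xt t) (legendre_transform (f (xt t)) (xit t)) ^+ 2 =
    dual_norm (f (xt t)) (xit t) ^+ 2.
  by apply: filterS Oxt => t Oxt; rewrite (dual_normE (slice_minkowski Oxt)).
by move: c; apply: cvg_trans; exact: near_eq_cvg e.
Qed.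

End legendre_limits.

(** The solution [dy] of the linearised equation [xi_j = D_(y^j) F^2 / 2]: the variation [dxi] is a
    horizontal term in [dx] plus [dy *m fundamental (f x) y]. *)
Definition legendre_jacobian x y dx dxi : 'rV[R]_n :=
  (dxi - \row_j (2^-1 * 'D_(row_mx dx 0) ('D_(row_mx 0 (evec j)) square) (row_mx x y)))
  *m invmx (fundamental (f x) y).

(** Slope functions of the vertical derivatives of [square] give an exact linear system for the
    increment of [y]. Its matrix [B t] tends to the fundamental tensor, because [y] is continuous by
    [cvg_legendre], and can therefore be inverted near the limit. *)
Lemma is_derive_legendre (U : normedModType R) (c xi : U -> 'rV[R]_n) p h dc dxi :
  O (c p) -> xi p != 0 -> is_derive p h c dc -> is_derive p h xi dxi ->
  is_derive p h (fun q => legendre_transform (f (c q)) (xi q))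
    (legendre_jacobian (c p) (legendre_transform (f (c p)) (xi p)) dc dxi).
Proof.
move=> Op xip [dcp dcE] [dxip dxiE].
set y0 := legendre_transform _ _; pose y q := legendre_transform (f (c q)) (xi q).
have [y00 xiE] := legendre_transformP (slice_minkowski Op) xip.
have z0 := slit_row Op y00; set z := row_mx (c p) _ in z0.
have C1 j : Ck_on 1 slit ('D_(row_mx 0 (evec j)) square).
  by have /Ck_onS[_ _] := @square_smooth 2; exact.
have [phi phiP] := choice (fun j => C1_caratheodory open_slit (C1 j) z0).
have cc : c (t *: h + p) @[t --> 0^'] --> c p.
  by apply: cvg_trans (derivable_cvg dcp); apply: cvg_app; exact: cvg_within.
have cxi : xi (t *: h + p) @[t --> 0^'] --> xi p.
  by apply: cvg_trans (derivable_cvg dxip); apply: cvg_app; exact: cvg_within.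
have cy : y (t *: h + p) @[t --> 0^'] --> y0 by exact: cvg_legendre.
pose zt (t : R) := row_mx (c (t *: h + p)) (y (t *: h + p)).
have cz : zt t @[t --> 0^'] --> z by exact: cvg_row_mx.
have cphi j : phi j (zt t) @[t --> 0^'] --> phi j z.
  by have [cphi _ _] := phiP j; exact: (cvg_comp _ _ cz cphi).
pose A j (t : R) := 2^-1 *: lsubmx (phi j (zt t)).
pose B (t : R) : 'M[R]_n := \matrix_(i, j) (2^-1 * rsubmx (phi j (zt t)) 0 i).
have phiz j : phi j z = gradient ('D_(row_mx 0 (evec j)) square) z.
  by have [] := phiP j.
have gradz j (w : 'rV[R]_(n + n)) : 'D_w ('D_(row_mx 0 (evec j)) square) z = dot (phi j z) w.
  by rewrite phiz; exact: derive_gradient open_slit (C1 j) z0.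
have cB i j : B t i j @[t --> 0^'] --> fundamental (f (c p)) y0 i j.
  rewrite fundamentalE gradz -[phi j z]hsubmxK dot_row_mx dot0r add0r dot_evec.
  under eq_cvg do rewrite mxE.
  apply: cvgM; first exact: cvg_cst.
  apply: cvg_coord; exact: (cvg_comp _ _ (cphi j) (@rsubmx_continuous _ _ _ _)).
have uB := fundamental_unit (slice_minkowski Op) y00.
have nB : \forall t \near 0^', B t \in unitmx by exact: near_unitmx cB uB.
have cdc : t^-1 *: (c (t *: h + p) - c p) @[t --> 0^'] --> dc.
  by rewrite -dcE; exact: dcp.
have cdxi : t^-1 *: (xi (t *: h + p) - xi p) @[t --> 0^'] --> dxi.
  by rewrite -dxiE; exact: dxip.
(* The difference quotient of [y], solved from that linear system whenever [B t] is invertible. *)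
pose K (t : R) := (t^-1 *: (xi (t *: h + p) - xi p) -
  \row_j dot (A j t) (t^-1 *: (c (t *: h + p) - c p))) *m invmx (B t).
have cK : K t @[t --> 0^'] --> legendre_jacobian (c p) y0 dc dxi.
  apply: cvg_row => i; rewrite mxE; under eq_cvg do rewrite mxE.
  apply: cvg_sumr => j; apply: cvgM; last exact: cvg_invmx.
  apply: cvg_coord; apply: cvgB => //; apply: cvg_row => k.
  rewrite mxE; under eq_cvg do rewrite mxE.
  rewrite gradz -[phi k z]hsubmxK dot_row_mx dot0r addr0 -dotZl.
  apply: cvg_dot => //; apply: cvgZr.
  exact: (cvg_comp _ _ (cphi k) (@lsubmx_continuous _ _ _ _)).
have e : \forall t \near 0^', K t = t^-1 *: (y (t *: h + p) - y p).
  have nO : \forall t \near 0^', O (c (t *: h + p)).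
    exact: (cc _ (open_nbhs_nbhs (conj oO Op))).
  have nxi : \forall t \near 0^', xi (t *: h + p) != 0.
    exact: (cxi _ (open_nbhs_nbhs (conj (@open_neq0 R n) xip))).
  have nphi : \forall t \near 0^', forall j, 'D_(row_mx 0 (evec j)) square (zt t) -
      'D_(row_mx 0 (evec j)) square z = dot (phi j (zt t)) (zt t - z).
    by apply: filter_forall => j; have [_ _ P] := phiP j; exact: (cz _ P).
  have leg q : O (c q) -> xi q != 0 -> forall j,
      xi q 0 j = 2^-1 * 'D_(row_mx 0 (evec j)) square (row_mx (c q) (y q)).
    move=> Oq xq j; have [yq0 xiqE] := legendre_transformP (slice_minkowski Oq) xq.
    rewrite -dot_evec xiqE (dot_legendre (slice_minkowski Oq) _ yq0) -/(y q).
    by rewrite derive_slice.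
  near=> t.
  have Ot : O (c (t *: h + p)) by near: t.
  have xit : xi (t *: h + p) != 0 by near: t.
  have uBt : B t \in unitmx by near: t.
  have slope : forall j, 'D_(row_mx 0 (evec j)) square (zt t) -
      'D_(row_mx 0 (evec j)) square z = dot (phi j (zt t)) (zt t - z) by near: t.
  rewrite /K; set D := xi (t *: h + p) - xi p; set dx := c (t *: h + p) - c p.
  have -> : (\row_j dot (A j t) (t^-1 *: dx)) = t^-1 *: \row_j dot (A j t) dx.
    by apply/rowP => j; rewrite !mxE dotZr.
  rewrite -scalerBr -scalemxAl; congr (_ *: _).
  rewrite -[RHS]mulmx1 -(mulmxV uBt) mulmxA; congr (_ *m _).
  apply/rowP => j; rewrite !mxE (leg _ Ot xit) (leg _ Op xip) -mulrBr slope.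
  rewrite /zt -/(y p) opp_row_mx add_row_mx -[phi j _]hsubmxK dot_row_mx.
  rewrite /A dotZl mulrDr addrAC subrr add0r /dot mulr_sumr.
  by apply: eq_bigr => i _; rewrite !mxE mulrA mulrC.
have q : t^-1 *: (y (t *: h + p) - y p) @[t --> 0^'] -->
    legendre_jacobian (c p) y0 dc dxi.
  by apply: cvg_trans cK; exact: near_eq_cvg e.
split; first by apply/cvg_ex; exists (legendre_jacobian (c p) y0 dc dxi).
exact: cvg_lim q.
Unshelve. all: by end_near. Qed.

(* The upper bound comes from testing the supremum at [t0] with the maximiser at [t]. *)
Lemma is_derive_half_dual_line x xi eta (t0 : R) : O x ->
  is_derive t0 1 (fun t => 2^-1 * dual_norm (f x) (xi + t *: eta) ^+ 2)
    (dot eta (legendre_transform (f x) (xi + t0 *: eta))).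
Proof.
move=> Ox; pose H t := 2^-1 * dual_norm (f x) (xi + t *: eta) ^+ 2.
pose y t := legendre_transform (f x) (xi + t *: eta).
have low s t : H s + (t - s) * dot eta (y s) <= H t.
  have := legendre_max_le (slice_minkowski Ox) (xi + t *: eta) (y s).
  apply: le_trans; rewrite /H -(legendre_max_eq (slice_minkowski Ox)) -/(y s).
  by rewrite !dotDl !dotZl; lra.
have cy : y (h *: 1 + t0) @[h --> (0 : R)^'] --> y t0.
  have c1 : xi + (h *: 1 + t0) *: eta @[h --> (0 : R)^'] --> xi + t0 *: eta.
    have c0 : h *: 1 + t0 @[h --> (0 : R)^'] --> t0.
      have c00 : h *: 1 + t0 @[h --> (0 : R)] --> 0 *: 1 + t0.
        by apply: cvgD; [apply: cvgZr_tmp; exact: cvg_id|exact: cvg_cst].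
      rewrite scale0r add0r in c00.
      by apply: cvg_trans c00; apply: cvg_app; exact: cvg_within.
    by apply: cvgD; [exact: cvg_cst|exact: cvgZr_tmp].
  exact: (cvg_legendre Ox (cvg_cst x) c1).
have cd : dot eta (y (h *: 1 + t0)) @[h --> (0 : R)^'] --> dot eta (y t0).
  exact: (cvg_dot (cvg_cst eta) cy).
have q : h^-1 *: (H (h *: 1 + t0) - H t0) @[h --> 0^'] --> dot eta (y t0).
  apply/cvgrPdist_le => e e0.
  have cde : \forall h \near (0 : R)^', `|dot eta (y t0) - dot eta (y (h *: 1 + t0))| <= e.
    exact: ((cvgrPdist_le _ _).1 cd _ e0).
  have h0 : \forall h \near (0 : R)^', h != 0 by exact: nbhs_dnbhs_neq.
  apply: filterS2 cde h0 => h; rewrite [h *: 1]mulr1 => cde h0.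
  have L1 := low t0 (h + t0); have L2 := low (h + t0) t0.
  set a := dot eta (y t0) in cde L1 *; set b := dot eta (y (h + t0)) in cde L2.
  set Q := h^-1 *: _.
  have QE : H (h + t0) = H t0 + h * Q.
    by rewrite /Q [_ *: _]/(h^-1 * _) mulrA divff // mul1r [RHS]addrC subrK.
  move: L1 L2; rewrite QE addrK opprD addrCA subrr addr0 => L1 L2.
  move: cde; rewrite !ler_norml => /andP[c1 c2].
  have [hp|hn|h00] := ltrgtP h 0.
  - have : Q <= a by nra. have : b <= Q by nra. by lra.
  - have : a <= Q by nra. have : Q <= b by nra. by lra.
  - by rewrite h00 eqxx in h0.
split; first by apply/cvg_ex; exists (dot eta (y t0)).
exact: cvg_lim q.
Qed.

Lemma cvg_legendre_jacobian {T : Type} {G : set_system T} {FG : Filter G}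
    (xt yt dxit : T -> 'rV[R]_n) x y dx dxi :
  O x -> y != 0 -> xt @ G --> x -> yt @ G --> y -> dxit @ G --> dxi ->
  legendre_jacobian (xt t) (yt t) dx (dxit t) @[t --> G] --> legendre_jacobian x y dx dxi.
Proof.
move=> Ox y0 cx cy cdxi.
have C0 j (w : 'rV[R]_(n + n)) : Ck_on 0 slit ('D_w ('D_(row_mx 0 (evec j)) square)).
  have /Ck_onS[_ _ /(_ (row_mx 0 (evec j)))] := @square_smooth 2.
  by move=> /Ck_onS[_ _]; exact.
rewrite /legendre_jacobian; apply: cvg_mulmx; last first.
  move=> i j; apply: cvg_invmx; last exact: (fundamental_unit (slice_minkowski Ox) y0).
  move=> k l.
  have -> : (fun t => fundamental (f (xt t)) (yt t) k l) = (fun t => 2^-1 *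
      'D_(row_mx 0 (evec k)) ('D_(row_mx 0 (evec l)) square) (row_mx (xt t) (yt t))).
    by apply/funext => t; exact: fundamentalE.
  have -> := fundamentalE x y k l.
  by apply: cvgM; [exact: cvg_cst|exact: (cvg_on_slit (C0 _ _))].
apply: cvgB => //; apply: cvg_rowE => k.
by apply: cvgM; [exact: cvg_cst|exact: (cvg_on_slit (C0 _ _))].
Qed.

(** * C^1 regularity of the flux of a nonvanishing covector field *)

Section gradient_field.
Variables (O' : set 'rV[R]_n) (xi : 'rV[R]_n -> 'rV[R]_n).
Hypotheses (oO' : open O') (O'O : O' `<=` O) (xi_C1 : Ck_on 1 O' xi).
Hypothesis xi_neq0 : forall q, O' q -> xi q != 0.

Let y q := legendre_transform (f q) (xi q).

Let xi_derivable q h : O' q -> derivable xi q h.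
Proof. by have /Ck_onS[_ + _] := xi_C1; exact. Qed.

Let xi_continuous q : O' q -> {for q, continuous xi}.
Proof. by have /Ck_onS[+ _ _] := xi_C1; exact. Qed.

Let Dxi_continuous q h : O' q -> {for q, continuous ('D_h xi)}.
Proof. by move=> Oq; have /Ck_onS[_ _ /(_ h)/Ck_on0] := xi_C1; exact. Qed.

Let y_neq0 q : O' q -> y q != 0.
Proof.
by move=> Oq; have [] := legendre_transformP (slice_minkowski (O'O Oq)) (xi_neq0 Oq).
Qed.

Let y_cvg q : O' q -> y z @[z --> q] --> y q.
Proof.
by move=> Oq; apply: (cvg_legendre (FG := nbhs_filter q) (O'O Oq) cvg_id); exact: xi_continuous.
Qed.

Lemma is_derive_gradient_field q h : O' q ->
  is_derive q h y (legendre_jacobian q (y q) h ('D_h xi q)).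
Proof.
move=> Oq; apply: (@is_derive_legendre 'rV[R]_n id xi q h).
- exact: O'O.
- exact: xi_neq0.
- exact/derivableP/xi_derivable.
Qed.

Lemma gradient_field_C1 : Ck_on 1 O' y.
Proof.
apply/Ck_onS; split=> [q Oq|q h Oq|h]; first exact: y_cvg.
  by have [] := is_derive_gradient_field h Oq.
apply/Ck_on0.
have C : Ck_on 0 O' (fun q => legendre_jacobian q (y q) h ('D_h xi q)).
  apply/Ck_on0 => q Oq.
  apply: (cvg_legendre_jacobian (FG := nbhs_filter q)); [exact: O'O|exact: y_neq0|exact: cvg_id|exact: y_cvg|exact: Dxi_continuous].
apply/Ck_on0; apply: (eq_Ck_on oO' _ C) => q Oq.
by have [_ ->] := is_derive_gradient_field h Oq.
Qed.

(** Envelope formula: in [dot (xi q) (y q) - F^2 / 2] the variation of the maximiser [y] cancels,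
    and only [xi] and the base point are differentiated. *)
Definition half_dual_derivative q h : R :=
  dot ('D_h xi q) (y q) - 2^-1 * 'D_(row_mx h 0) square (row_mx q (y q)).

Lemma is_derive_half_dual q h : O' q ->
  is_derive q h (fun q => 2^-1 * dual_norm (f q) (xi q) ^+ 2) (half_dual_derivative q h).
Proof.
move=> Oq; have Ox := O'O Oq.
have dy := is_derive_gradient_field h Oq.
set dyq := legendre_jacobian _ _ _ _ in dy.
have dxi := derivableP (@xi_derivable q h Oq).
have C1 := @square_smooth 1.
have ddot : is_derive q h (fun q => dot (xi q) (y q))
    (\sum_i (xi q 0 i * dyq 0 i + y q 0 i * 'D_h xi q 0 i)).
  apply: is_derive_sumr => i.
  exact: (is_deriveM (is_derive_coord i dxi) (is_derive_coord i dy)).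
have drow : is_derive q h (fun q => row_mx q (y q)) (row_mx h dyq).
  exact: (is_derive_row_mx (is_derive_id q h) dy).
pose z := row_mx q (y q); have z0 : slit z by apply: slit_row => //; exact: y_neq0.
have dsq : is_derive q h (square \o (fun q => row_mx q (y q))) (dot (gradient square z) (row_mx h dyq)).
  exact: (is_derive_comp (c := fun q => row_mx q (y q)) open_slit C1 z0 drow).
have gz (w : 'rV[R]_(n + n)) : 'D_w square z = dot (gradient square z) w.
  exact: (derive_gradient w open_slit C1 z0).
have split_grad : dot (gradient square z) (row_mx h dyq) =
    'D_(row_mx h 0) square z + 'D_(row_mx 0 dyq) square z.
  by rewrite !gz -dotDr add_row_mx addr0 add0r.
(* The cancellation: half the vertical differential of [F^2] at [y] is [xi]. *)
have vert : 2^-1 * 'D_(row_mx 0 dyq) square z = dot (xi q) dyq.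
  have [_ {1}->] := legendre_transformP (slice_minkowski Ox) (xi_neq0 Oq).
  have := dot_legendre (slice_minkowski Ox) dyq (y_neq0 Oq).
  by rewrite derive_slice => ->.
have dH : is_derive q h ((fun q => dot (xi q) (y q)) - 2^-1 *: (square \o (fun q => row_mx q (y q))))
   (half_dual_derivative q h).
  have dH' := is_deriveB ddot (is_deriveZ 2^-1 dsq).
  apply: is_derive_eq dH' _; rewrite split_grad /half_dual_derivative -/z.
  rewrite [_ *: _]mulrDr vert big_split /= -/(dot (xi q) dyq) (dotC ('D_h xi q)).
  rewrite -/(dot (y q) ('D_h xi q)).
  have alg (a b c : R) : a + b - (c + a) = b - c by ring.
  exact: alg.
apply: near_eq_is_derive dH.
have : \forall z \near q, O' z by exact: open_nbhs_nbhs.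
apply: filterS => q' Oq'.
rewrite -(legendre_max_eq (slice_minkowski (O'O Oq'))).
suff -> : f q' (y q') ^+ 2 = square (row_mx q' (y q')) by [].
by rewrite /square row_mxKl row_mxKr.
Qed.

Let V q := expR (2^-1 * dual_norm (f q) (xi q) ^+ 2).

Lemma is_derive_exp_half_dual q h : O' q -> is_derive q h V (V q * half_dual_derivative q h).
Proof.
move=> Oq.
exact: (is_derive_outer (is_derive_expR _) (is_derive_half_dual h Oq)).
Qed.

Lemma exp_half_dual_C1 : Ck_on 1 O' V.
Proof.
have cV q : O' q -> V z @[z --> q] --> V q.
  move=> Oq; have c : 2^-1 * dual_norm (f z) (xi z) ^+ 2 @[z --> q] -->
      2^-1 * dual_norm (f q) (xi q) ^+ 2.
    have d := cvg_dual_norm2 (FG := nbhs_filter q) (O'O Oq) cvg_id (xi_continuous Oq).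
    exact: (cvgM (cvg_cst (2^-1 : R)) d).
  exact: (cvg_comp _ _ c (@continuous_expR R _)).
apply/Ck_onS; split=> [q Oq|q h Oq|h]; first exact: cV.
  by have [] := is_derive_exp_half_dual h Oq.
have C : Ck_on 0 O' (fun q => V q * half_dual_derivative q h).
  apply/Ck_on0 => q Oq.
  have c1 := cV q Oq.
  have c2 : half_dual_derivative z h @[z --> q] --> half_dual_derivative q h.
    have d1 := cvg_dot (FG := nbhs_filter q) (@Dxi_continuous q h Oq) (y_cvg Oq).
    have C0 : Ck_on 0 slit ('D_(row_mx h 0) square).
      by have /Ck_onS[_ _] := @square_smooth 1; exact.
    have d2 := cvg_on_slit (FG := nbhs_filter q) C0 (O'O Oq) (y_neq0 Oq) cvg_id (y_cvg Oq).
    exact: (cvgB d1 (cvgM (cvg_cst (2^-1 : R)) d2)).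
  exact: (cvgM c1 c2).
apply: (eq_Ck_on oO' _ C) => q Oq.
by have [_ ->] := is_derive_exp_half_dual h Oq.
Qed.

Lemma flux_field_C1 : Ck_on 1 O' (fun q => V q *: y q).
Proof.
apply: (Ck_on_row oO') => i.
rewrite (_ : (fun q => _) = V \* (fun q => y q 0 i)); last first.
  by apply/funext => q; rewrite mxE.
exact: (Ck_onM oO' exp_half_dual_C1 (Ck_on_coord i oO' gradient_field_C1)).
Qed.

Lemma derive_flux_field q h i : O' q -> 'D_h (fun q => (V q *: y q) 0 i) q =
  V q * (half_dual_derivative q h * y q 0 i +
         legendre_jacobian q (y q) h ('D_h xi q) 0 i).
Proof.
move=> Oq.
have d : is_derive q h (V * (fun q => y q 0 i)) (V q *: legendre_jacobian q (y q) h ('D_h xi q) 0 i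
   + y q 0 i *: (V q * half_dual_derivative q h)).
  exact: (is_deriveM (is_derive_exp_half_dual h Oq) (is_derive_coord i (is_derive_gradient_field h Oq))).
rewrite (_ : (fun q => _) = V * (fun q => y q 0 i)); last first.
  by apply/funext => z; rewrite mxE.
have [_ ->] := d.
have alg (a b c e : R) : a * b + c * (a * e) = a * (e * c + b) by ring.
exact: alg.
Qed.

End gradient_field.

End FinslerFamily.

(** * Iterated integrals and Lebesgue measure *)

Section IteratedIntegral.
Context {R : realType}.
Local Notation mur := (@lebesgue_measure R).
Local Notation brV n := (borel 'rV[R]_n).

Lemma open_borel_measurable {T : ptopologicalType} (U : set T) :
  open U -> measurable (U : set (borel T)).
Proof. by move=> oU; exact: sub_sigma_algebra. Qed.

Lemma closed_borel_measurable {T : ptopologicalType} (U : set T) :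
  closed U -> measurable (U : set (borel T)).
Proof.
move=> cU; rewrite -[U]setCK; apply: measurableC.
by apply: open_borel_measurable; exact: closed_openC.
Qed.

Lemma preimage_open_on {T U : topologicalType} (D : set T) (V : set U) (f : T -> U) :
  open D -> (forall x, D x -> {for x, continuous f}) -> open V -> open (D `&` f @^-1` V).
Proof.
move=> oD cf oV; rewrite openE => x [Dx Vfx]; apply: filterI.
  exact: open_nbhs_nbhs.
by apply: (cf x Dx); exact: open_nbhs_nbhs.
Qed.

Lemma continuous_on_borel {T U : ptopologicalType} (D : set T) (f : T -> U) :
  open D -> (forall x, D x -> {for x, continuous f}) ->
  measurable_fun (D : set (borel T)) (f : borel T -> borel U).
Proof.
move=> oD cf; apply: (measurability _ (erefl : @measurable _ (borel U) = <<s (@open U) >>)).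
move=> _ [V oV <-]; apply: open_borel_measurable.
exact: preimage_open_on.
Qed.

Lemma continuous_on_measurable {T : ptopologicalType} (D : set T) (f : T -> R) :
  open D -> (forall x, D x -> {for x, continuous f}) ->
  measurable_fun (D : set (borel T)) (f : borel T -> R).
Proof.
move=> oD cf; apply: (measurability _ (RGenOInfty.measurableE R)).
move=> _ [_ [x ->] <-]; apply: open_borel_measurable.
by apply: preimage_open_on => //; exact: interval_open.
Qed.

Lemma rat_row_dense n (z : 'rV[R]_n) (e : R) : 0 < e ->
  exists v : 'rV[rat]_n, `|z - map_mx ratr v| < e.
Proof.
move=> e0; have e20 : 0 < e / 2 by rewrite divr_gt0.
have /choice[q qP] : forall i, exists q : rat, `|z 0 i - ratr q| <= e / 2.
  move=> i; have /rat_in_itvoo[q] : z 0 i - e / 2 < z 0 i + e / 2 by lra.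
  rewrite in_itv /= => /andP[q1 q2]; exists q.
  by rewrite ler_norml; apply/andP; split; lra.
exists (\row_i q i); apply: le_lt_trans (_ : e / 2 < e); last by lra.
by apply: norm_le_coord => [|i]; [exact: ltW|rewrite !mxE].
Qed.

(** An open set is the union of the boxes with rational centre and radius [1 / (k + 1)] that it
    contains, and these are countably many. Hence Borel sets of the product belong to the product
    sigma-algebra. *)
Lemma open_prod_measurable n (W : set (R * 'rV[R]_n)) :
  open W -> measurable (W : set (measurableTypeR R * brV n)).
Proof.
move=> oW.
pose box (x : rat * 'rV[rat]_n * nat) : set (measurableTypeR R * brV n) :=
  [set t : R | `|ratr x.1.1 - t| < x.2.+1%:R^-1] `*`
  [set z : 'rV[R]_n | `|map_mx ratr x.1.2 - z| < x.2.+1%:R^-1].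
have mbox x : measurable (box x).
  apply: measurableX.
    apply: open_measurable.
    exact: (@ball_open R R (ratr x.1.1) (x.2.+1%:R^-1)).
  apply: open_borel_measurable.
  have := @ball_open R 'rV[R]_n (map_mx ratr x.1.2) (x.2.+1%:R^-1).
  by rewrite -ball_normE.
pose F x := if pselect (box x `<=` W) then box x else set0.
have -> : W = \bigcup_x F x.
  apply/seteqP; split; last first.
    by move=> w [x _]; rewrite /F; case: pselect => // sub; exact: sub.
  move=> [t z] Wtz.
  have [e e0 eW] := open_dist_lt oW Wtz.
  (* A box of radius below [e / 2] that contains the point lies in the ball of radius [e] about
     it. *)
  pose k := Num.truncn (e / 2)^-1.
  have ke : k.+1%:R^-1 < e / 2 by rewrite invf_plt ?posrE ?divr_gt0 // truncnS_gt.
  have k0 : 0 < k.+1%:R^-1 :> R by rewrite invr_gt0.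
  have [v vz] := rat_row_dense z k0.
  have [d dE] : exists d : R, d = k.+1%:R^-1 by exists (k.+1%:R^-1).
  rewrite -dE in ke k0 vz.
  have /rat_in_itvoo[q] : t - d < t + d by lra.
  rewrite in_itv /= => /andP[q1 q2].
  exists (q, v, k) => //; rewrite /F; case: pselect => [sub|[]].
    split => /=; rewrite -dE; last by rewrite distrC.
    by rewrite ltr_norml; apply/andP; split; lra.
  move=> [t' z'] [/=]; rewrite -dE => t'q z'v; apply: eW.
  rewrite prod_normE /= gt_max; apply/andP; split.
    have := ler_distD (ratr q) t' t.
    have : `|ratr q - t| < d by rewrite ltr_norml; apply/andP; split; lra.
    have : `|t' - ratr q| < d by rewrite distrC.
    lra.
  have := ler_distD (map_mx ratr v) z' z.
  have : `|z' - map_mx ratr v| < d by rewrite distrC.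
  have : `|map_mx ratr v - z| < d by rewrite distrC.
  lra.
apply: countable_bigcupT_measurable => [|x]; first exact: countableP.
by rewrite /F; case: pselect => [sub|nsub]; [exact: mbox|exact: measurable0].
Qed.

(** The concatenation used by [iintegral], so that one product with Lebesgue measure matches one
    outer integral. *)
Definition row_cons n (p : R * 'rV[R]_n) : 'rV[R]_n.+1 := row_mx (p.1%:M : 'M[R]_1) p.2.

Lemma row_cons_continuous n : continuous (@row_cons n).
Proof.
move=> p; have c1 : (q.1%:M : 'M[R]_1) @[q --> p] --> (p.1%:M : 'M[R]_1).
  apply: (cvg_row (FG := nbhs_filter p)) => i.
  have e (q : R * 'rV[R]_n) : (q.1%:M : 'M[R]_1) 0 i = q.1 by rewrite mxE ord1 eqxx mulr1n.
  rewrite e (_ : (fun q : R * 'rV[R]_n => _) = fst); first exact: cvg_fst.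
  by apply/funext => q; rewrite e.
exact: (cvg_row_mx (FG := nbhs_filter p) c1 cvg_snd).
Qed.

Lemma row_cons_measurable n :
  measurable_fun setT (@row_cons n : measurableTypeR R * brV n -> brV n.+1).
Proof.
apply: (measurability _ (erefl : @measurable _ (brV n.+1) = <<s (@open 'rV[R]_n.+1) >>)).
move=> _ [U oU <-]; rewrite setTI; apply: open_prod_measurable.
apply: open_comp oU => p _; exact: row_cons_continuous.
Qed.

(** For the sup norm a ball is the product of an interval and a ball of one dimension less, which
    gives the volume of balls by induction. *)
Lemma norm_row_cons n (p c : R * 'rV[R]_n) (r : R) : 0 <= r ->
  (`|row_cons p - row_cons c| <= r) = (`|p.1 - c.1| <= r) && (`|p.2 - c.2| <= r).
Proof.
move=> r0.
have e : (row_mx p.1%:M p.2 : 'rV[R]_(1 + n)) - row_mx c.1%:M c.2 =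
    row_mx ((p.1 - c.1)%:M : 'M[R]_1) (p.2 - c.2).
  rewrite opp_row_mx add_row_mx; congr row_mx.
  by apply/rowP => i; rewrite !mxE ord1 !mulr1n.
have -> : row_cons p - row_cons c = row_mx ((p.1 - c.1)%:M : 'M[R]_1) (p.2 - c.2) := e.
set u : 'rV[R]_(1 + n) := row_mx _ _.
have ul : u 0 (lshift n ord0) = p.1 - c.1 by rewrite row_mxEl mxE mulr1n.
have ur i : u 0 (rshift 1 i) = (p.2 - c.2) 0 i by rewrite row_mxEr.
apply/idP/andP => [h|[h1 h2]].
  split; first by rewrite -ul (le_trans (coord_le_norm _ _)).
  by apply: norm_le_coord => // i; rewrite -ur (le_trans (coord_le_norm _ _)).
apply: (@norm_le_coord R (1 + n) u) => // i; rewrite -(splitK i); case: (fintype.split i) => j /=.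
  by rewrite ord1 ul.
by rewrite ur (le_trans (coord_le_norm _ _)).
Qed.

Lemma row_cons_surj n (c : 'rV[R]_n.+1) : exists p, c = row_cons p.
Proof.
pose c' : 'rV[R]_(1 + n) := c.
exists (lsubmx c' 0 0, rsubmx c'); rewrite /row_cons /= -mx11_scalar.
exact: (esym (hsubmxK c')).
Qed.

(** The fundamental theorem of calculus on [[-b, b]], with [b] large enough that [k] vanishes at
    both ends. *)
Lemma integral_derive_compact (k : R -> R) (r : R) :
  (forall t, derivable k t 1) -> continuous ('D_1 k) ->
  (forall t, r <= `|t| -> k t = 0) -> (\int[mur]_t ('D_1 k t)%:E)%E = 0%E.
Proof.
move=> dk cDk k0; pose b := `|r| + 1.
have b0 : 0 < b by rewrite ltr_wpDl.
have rb : r < b by rewrite (le_lt_trans (ler_norm r)) // ltrDl.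
have kb t : r < `|t| -> 'D_1 k t = 0.
  move=> rt; have : \forall s \near t, cst 0 s = k s.
    have e0 : 0 < `|t| - r by rewrite subr_gt0.
    apply: filterS (near_dist_lt t e0) => s st; rewrite /cst k0 //.
    by have := lerB_dist t s; rewrite distrC; lra.
  by move=> /near_eq_derive <-; exact: derive_cst.
have -> : (\int[mur]_t ('D_1 k t)%:E)%E = (\int[mur]_(t in `[(- b)%R, b]) ('D_1 k t)%:E)%E.
  rewrite [RHS]integral_mkcond; apply: eq_integral => t _.
  rewrite patchE; case: ifPn => // /negP tb; rewrite kb //.
  apply: lt_trans rb _; rewrite ltNge; apply/negP => tb'; apply: tb.
  by rewrite inE /= in_itv /= -ler_norml.
have ck t : {for t, continuous k}.
  exact/differentiable_continuous/derivable1_diffP.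
rewrite (@continuous_FTC2 _ ('D_1 k) k).
- rewrite !k0 ?subee //; first by rewrite normrN ger0_norm ltW.
  by rewrite ger0_norm ltW.
- lra.
- exact: continuous_subspaceT.
- split=> [t _||]; first exact: dk.
    by apply: cvg_at_right_filter; exact: ck.
  by apply: cvg_at_left_filter; exact: ck.
- by move=> t _; rewrite derive1E.
Qed.

(** * Compactly supported functions and locally finite Borel measures *)

Section LocallyFinite.
Context {M : ptopologicalType}.
Hypothesis hM : hausdorff_space M.
Implicit Types (K O : set M) (h : M -> R).

(** Extension by zero: in a Hausdorff space [K] is closed, so [O] and the complement of [K] form an
    open cover on each part of which [h] is continuous. *)
Lemma continuous_off_compact O K h : open O -> K `<=` O -> compact K ->
  (forall p, O p -> {for p, continuous h}) -> (forall p, ~ K p -> h p = 0) -> continuous h.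
Proof.
move=> oO KO cK ch h0 p; have [Op|Op] := pselect (O p); first exact: ch.
have Kp : (~` K) p by move=> /KO.
have oK : open (~` K) by apply: closed_openC; exact: compact_closed.
have z : \forall q \near p, h q = 0.
  by have := open_nbhs_nbhs (conj oK Kp); apply: filterS => q; exact: h0.
rewrite /continuous_at (h0 p Kp).
exact: (@cvg_near_cst _ _ 0 h (nbhs p) _ z).
Qed.

Variable mu : {measure set (borel M) -> \bar R}.
Hypothesis mu_compact : forall K, compact K -> (mu K < +oo)%E.

Lemma compact_borel K : compact K -> measurable (K : set (borel M)).
Proof. by move=> cK; apply: closed_borel_measurable; exact: compact_closed. Qed.

Lemma integrable_compact K h : compact K -> continuous h ->
  mu.-integrable (K : set (borel M)) (EFin \o (h : borel M -> R)).
Proof.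
move=> cK ch.
apply: measurable_bounded_integrable; [exact: compact_borel|exact: mu_compact| |].
  apply: (@measurable_funTS _ _ _ _ (K : set (borel M))).
  by apply: continuous_on_measurable => // [|x _]; [exact: openT|exact: ch].
have := compact_bounded (continuous_compact (continuous_subspaceT ch) cK).
move=> [N [Nreal hN]]; exists N; split=> // s Ns z /= Bz.
by apply: (hN s Ns); exists z.
Qed.

Lemma integrable_compact_support K h : compact K -> continuous h ->
  (forall p, ~ K p -> h p = 0) ->
  mu.-integrable setT (EFin \o (h : borel M -> R)).
Proof.
move=> cK ch h0.
have -> : EFin \o (h : borel M -> R) = (EFin \o (h : borel M -> R)) \_ (K : set (borel M)).
  apply/funext => z; rewrite patchE; case: ifPn => // /negP zB /=.
  by rewrite h0 // => Kz; apply: zB; rewrite inE.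
by apply/(integrable_mkcond _ (compact_borel cK)); exact: integrable_compact.
Qed.

End LocallyFinite.

Lemma continuous_dist n (x : 'rV[R]_n) : continuous (fun z : 'rV[R]_n => `|z - x|).
Proof. by move=> z; exact: (cvg_norm (cvgB cvg_id (cvg_cst x))). Qed.

Lemma open_distb n (x : 'rV[R]_n) (r : R) : open [set z : 'rV[R]_n | `|z - x| < r].
Proof.
apply: (@open_comp _ _ (fun z : 'rV[R]_n => `|z - x|) [set t : R | t < r]) => [z _|].
  exact: continuous_dist.
exact: open_lt.
Qed.

Lemma closed_ball_compact n (x : 'rV[R]_n) (r : R) : compact [set z : 'rV[R]_n | `|z - x| <= r].
Proof.
apply: bounded_closed_compact.
  exists (r + `|x|); split; first exact: num_real.
  move=> t rt z /= zr; apply: le_trans (ltW rt).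
  by rewrite -[z](subrK x) (le_trans (ler_normD _ _)) // lerD2r.
by apply: (@closed_comp _ _ _ [set t : R | t <= r]) => [z _|]; [exact: continuous_dist|exact: closed_le].
Qed.

Lemma compact_support_integrable n (nu : {measure set (brV n) -> \bar R})
    (h : 'rV[R]_n -> R) (r : R) :
  (forall s : R, (nu [set z : 'rV[R]_n | (`|z| <= s)%R] < +oo)%E) ->
  continuous h -> (forall z, r < `|z| -> h z = 0) ->
  nu.-integrable setT (EFin \o (h : brV n -> R)).
Proof.
move=> nuf ch h0; have hV : hausdorff_space 'rV[R]_n by exact: norm_hausdorff.
apply: (integrable_compact_support hV _ (@closed_ball_compact n 0 r) ch).
  move=> K cK; have [N [_ hN]] := compact_bounded cK.
  apply: le_lt_trans (nuf (N + 1)); apply: le_measure; rewrite ?inE.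
  - exact: compact_borel.
  - apply: closed_borel_measurable.
    apply: (@closed_comp _ _ (fun z : 'rV[R]_n => `|z|) [set s | s <= N + 1]) => [z _|].
      exact: norm_continuous.
    exact: closed_le.
  - by move=> z /(hN (N + 1)); apply; rewrite ltrDl.
by move=> z; rewrite /= subr0 => /negP; rewrite -ltNge; exact: h0.
Qed.

Lemma row_cons_shift n (t a : R) (z b : 'rV[R]_n) (h : R) :
  row_cons (h * a + t, h *: b + z) = h *: row_cons (a, b) + row_cons (t, z).
Proof.
have e : h *: (row_mx a%:M b : 'rV[R]_(1 + n)) + row_mx t%:M z =
    row_mx ((h * a + t)%:M : 'M[R]_1) (h *: b + z).
  rewrite scale_row_mx add_row_mx; congr row_mx.
  by apply/rowP => i; rewrite !mxE ord1 !mulr1n.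
exact: (esym e).
Qed.

Lemma row_cons_ge n (p : R * 'rV[R]_n) :
  `|p.1| <= `|row_cons p| /\ `|p.2| <= `|row_cons p|.
Proof.
have r0 : row_cons (0 : R, 0 : 'rV[R]_n) = 0.
  apply/rowP => k; rewrite /row_cons mxE /= !mxE; case: splitP => i _.
    by rewrite mxE mul0rn.
  by rewrite mxE.
have := norm_row_cons p (0, 0) (normr_ge0 (row_cons p)).
by rewrite r0 !subr0 lexx => /esym/andP[].
Qed.

Lemma evec_ord0 n : evec ord0 = row_cons (1 : R, 0 : 'rV[R]_n).
Proof.
apply/rowP => k; rewrite /row_cons mxE /= !mxE; case: splitP => j kj.
  by rewrite ord1 mxE -val_eqE /= kj ord1.
by rewrite mxE -val_eqE /= kj.
Qed.

Lemma evec_lift n (j : 'I_n) : evec (lift ord0 j) = row_cons (0 : R, evec j : 'rV[R]_n).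
Proof.
apply/rowP => k; rewrite /row_cons mxE /= !mxE; case: splitP => i ki.
  by rewrite mxE -val_eqE /= ki ord1 mul0rn.
by rewrite mxE -!val_eqE /= ki.
Qed.

(** Along a map that moves affinely in the direction [u] the difference quotients coincide; this
    identifies derivatives of slices with partial derivatives. *)
Lemma derive_reparam (U V : normedModType R) (g : V -> R) (c : U -> V) x u v :
  (forall h : R, c (h *: u + x) = h *: v + c x) ->
  (derivable (g \o c) x u = derivable g (c x) v) /\ 'D_u (g \o c) x = 'D_v g (c x).
Proof.
move=> cE; have q : (fun h : R => h^-1 *: (((g \o c) \o shift x) (h *: u) - (g \o c) x)) =
    (fun h : R => h^-1 *: ((g \o shift (c x)) (h *: v) - g (c x))).
  by apply/funext => h /=; rewrite cE.
by split; rewrite /derivable /derive q.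
Qed.

(** * Construction of Lebesgue measure on row vectors *)

Section cons_measure.
Context {n : nat}.
Variable m : {sigma_finite_measure set (brV n) -> \bar R}.

Definition lebesgue_cons : set (brV n.+1) -> \bar R :=
  pushforward (mur \x m)%E (@row_cons n : measurableTypeR R * brV n -> brV n.+1).

Let lebesgue_cons0 : lebesgue_cons set0 = 0%E.
Proof. by rewrite /lebesgue_cons /pushforward preimage_set0 measure0. Qed.

Let lebesgue_cons_ge0 B : (0 <= lebesgue_cons B)%E.
Proof. by rewrite /lebesgue_cons /pushforward; exact: measure_ge0. Qed.

Let lebesgue_cons_sigma_additive : semi_sigma_additive lebesgue_cons.
Proof.
have mrow B : measurable B -> measurable ((@row_cons n : measurableTypeR R * brV n -> brV n.+1) @^-1` B).
  by move=> mB; rewrite -[X in measurable X]setTI; exact: row_cons_measurable.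
move=> F mF tF mUF; rewrite /lebesgue_cons /pushforward preimage_bigcup.
apply: measure_semi_sigma_additive.
- by move=> k; exact: mrow.
- apply/trivIsetP => /= i j _ _ ij; rewrite -preimage_setI.
  by move/trivIsetP : tF => /(_ _ _ _ _ ij) ->//; rewrite preimage_set0.
- by rewrite -preimage_bigcup; exact: mrow.
Qed.

HB.instance Definition _ := isMeasure.Build _ _ _
  lebesgue_cons lebesgue_cons0 lebesgue_cons_ge0 lebesgue_cons_sigma_additive.

End cons_measure.

(** Induction on [n], pushing forward the product with one-dimensional Lebesgue measure;
    sigma-finiteness is carried along because products and Tonelli require it. The three clauses are
    the properties assumed of [m] in the sections on the manifold. *)
Lemma lebesgue_rV_ex n : exists m : {sigma_finite_measure set (brV n) -> \bar R},
  [/\ forall (c : 'rV[R]_n) r, 0 <= r ->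
        m [set z : 'rV[R]_n | `|z - c| <= r] = ((2 * r) ^+ n)%:E,
      forall f : 'rV[R]_n -> \bar R, measurable_fun setT (f : brV n -> \bar R) ->
        (forall z, 0 <= f z)%E -> iintegral f = (\int[m]_z f z)%E &
      forall (g : 'rV[R]_n -> R) i (r : R),
        (forall z, derivable g z (evec i)) -> continuous ('D_(evec i) g) ->
        (forall z, r <= `|z| -> g z = 0) ->
        (\int[m]_z ('D_(evec i) g z)%:E)%E = 0%E].
Proof.
elim: n => [|n [m [mbox mint mD]]].
  (* In dimension 0 the space is one point of mass 1, and [(2 * r) ^+ 0] is 1. *)
  exists (@dirac _ (brV 0) (0 : 'rV[R]_0) R); split.
  - move=> c r r0; rewrite expr0 (_ : mkset _ = setT); first exact: diracT.
    apply/seteqP; split => // z _ /=.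
    by rewrite (_ : z - c = 0) ?normr0 //; apply/rowP => -[].
  - by move=> f mf f0; rewrite integral_dirac // diracT mul1e.
  - by move=> g [].
have pre (c : R * 'rV[R]_n) r : 0 <= r ->
    (@row_cons n) @^-1` [set z : 'rV[R]_n.+1 | `|z - row_cons c| <= r] =
    [set t | `|t - c.1| <= r] `*` [set z | `|z - c.2| <= r].
  move=> r0; apply/seteqP; split => p /=; rewrite norm_row_cons //.
    by move/andP.
  by move=> [p1 p2]; apply/andP.
have closed_dist (V : normedModType R) (c : V) (r : R) : closed [set z : V | `|z - c| <= r].
  apply: (@closed_comp _ _ (fun z : V => `|z - c|) [set s | s <= r]).
    move=> z _; have c1 : z' - c @[z' --> z] --> z - c by exact: (cvgB cvg_id (cvg_cst c)).
    exact: (cvg_comp _ _ c1 (@norm_continuous _ V (z - c))).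
  exact: closed_le.
have box (c : 'rV[R]_n.+1) (r : R) : 0 <= r ->
    lebesgue_cons m [set z : 'rV[R]_n.+1 | `|z - c| <= r] = ((2 * r) ^+ n.+1)%:E.
  move=> r0; have [p ->] := row_cons_surj c.
  rewrite /lebesgue_cons /pushforward pre // product_measure1E; last 2 first.
  - by apply: closed_measurable; exact: (@closed_dist R p.1 r).
  - by apply: closed_borel_measurable; exact: (@closed_dist 'rV[R]_n p.2 r).
  rewrite mbox // exprS EFinM; congr (_ * _)%E.
  have -> : [set t | `|t - p.1| <= r] = `[p.1 - r, p.1 + r]%classic.
    by apply/seteqP; split => t /=; rewrite in_itv /= ler_distl.
  apply: (etrans (lebesgue_measure_itv `[p.1 - r, p.1 + r])).
  rewrite /= lte_fin; case: ifPn => [_|].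
    by rewrite -EFinB; congr EFin; ring.
  by rewrite -leNgt => h; congr EFin; lra.
have sf : sigma_finite setT (lebesgue_cons m).
  exists (fun k => [set z : 'rV[R]_n.+1 | `|z - 0| <= k%:R]).
    apply/esym/seteqP; split => // z _; exists (Num.truncn `|z|).+1 => //=.
    by rewrite subr0 ltW // truncnS_gt.
  move=> k; split.
    by apply: closed_borel_measurable; exact: (@closed_dist 'rV[R]_n.+1 0 k%:R).
  by rewrite box // ltry.
pose M : {sigma_finite_measure set (brV n.+1) -> \bar R} :=
  HB.pack (lebesgue_cons m) (Measure_isSigmaFinite.Build _ _ _ _ sf).
have mrow := @row_cons_measurable n.
pose P : {measure set (measurableTypeR R * brV n)%type -> \bar R} := (mur \x m)%E.
exists M; split.
- exact: box.
- move=> f mf f0.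
  have mfr : measurable_fun setT ((f : brV n.+1 -> \bar R) \o (@row_cons n : measurableTypeR R * brV n -> brV n.+1)).
    exact: measurableT_comp.
  have e1 : (\int[M]_z f z = \int[(mur \x m)%E]_p f (row_cons p))%E.
    have := @ge0_integral_pushforward _ _ _ _ R _ mrow P setT f measurableT mf
      (fun y _ => f0 y).
    by rewrite preimage_setT => ->.
  have e2 := @fubini_tonelli1 _ _ _ _ R mur m _ mfr (fun p => f0 (row_cons p)).
  apply: etrans (esym (etrans e1 e2)).
  apply: eq_integral => t _; apply: mint => [|z]; last exact: f0.
  have mp : measurable_fun setT (pair t : brV n -> measurableTypeR R * brV n) by exact: pair1_measurable.
  exact: (measurableT_comp mf (measurableT_comp mrow mp)).
- move=> g i r dg cg g0; pose Dg := 'D_(evec i) g; rewrite -/Dg.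
  have Dg0 z : r < `|z| -> Dg z = 0.
    move=> rz; have : \forall w \near z, cst 0 w = g w.
      have e0 : 0 < `|z| - r by rewrite subr_gt0.
      apply: filterS (near_dist_lt z e0) => w wz; rewrite /cst g0 //.
      by have := lerB_dist z w; rewrite distrC; lra.
    by move=> /near_eq_derive e; apply: etrans (esym (e (evec i))) _; exact: derive_cst.
  have hint : M.-integrable setT (EFin \o (Dg : brV n.+1 -> R)).
    apply: (@compact_support_integrable _ M Dg r) => // s.
    have [s0|s0] := leP 0 s.
      rewrite (_ : mkset _ = [set z : 'rV[R]_n.+1 | `|z - 0| <= s]); last first.
        by apply/seteqP; split => z /=; rewrite subr0.
      apply: (@le_lt_trans _ _ ((2 * s) ^+ n.+1)%:E); last exact: ltry.
      by rewrite le_eqVlt; apply/orP; left; apply/eqP; exact: box.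
    rewrite (_ : mkset _ = set0) ?measure0 //; apply/seteqP; split => // z /= zs.
    by have := normr_ge0 z; lra.
  have mDg := measurable_int _ hint.
  have e1 : (\int[M]_z (Dg z)%:E = \int[P]_p (Dg (row_cons p))%:E)%E /\
      P.-integrable setT (EFin \o Dg \o (@row_cons n : measurableTypeR R * brV n -> brV n.+1)).
    have pint : P.-integrable setT (EFin \o Dg \o (@row_cons n : measurableTypeR R * brV n -> brV n.+1)).
      apply/integrableP; split; first exact: (measurableT_comp mDg mrow).
      have := (integrableP _ _ _ hint).2; apply: le_lt_trans.
      have mabs : measurable_fun setT (fun z : brV n.+1 => `|(Dg z)%:E|%E).
        exact: measurableT_comp.
      have := @ge0_integral_pushforward _ _ _ _ R _ mrow P setT _ measurableT mabs
        (fun y _ => abse_ge0 _).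
      by rewrite preimage_setT => <-.
    split=> //.
    have := @integral_pushforward _ _ _ _ R _ mrow P setT (EFin \o Dg) mDg.
    by rewrite preimage_setT => ->.
  have [-> pint] := e1.
  (* For a later coordinate Fubini puts the first variable outside and the induction hypothesis
     annihilates the inner integral; for the first coordinate the order is exchanged and the
     one-variable case applies. *)
  case: (unliftP ord0 i) => [j iE|iE].
    rewrite -(integral12_prod_meas1 pint); apply: integral0_eq => t _.
    have sh z h : row_cons (t, h *: evec j + z) = h *: evec (lift ord0 j) + row_cons (t, z).
      by rewrite evec_lift -row_cons_shift mulr0 add0r.
    pose gt := g \o (fun z => row_cons (t, z)).
    have sl z := @derive_reparam 'rV[R]_n _ g (fun z => row_cons (t, z)) z (evec j) _ (sh z).
    have DE : (fun z => Dg (row_cons (t, z))) = 'D_(evec j) gt.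
      by apply/funext => z; rewrite (sl z).2 /Dg iE.
    transitivity (\int[m]_z ('D_(evec j) gt z)%:E)%E.
      by apply: eq_integral => z _; rewrite -(congr1 (@^~ z) DE).
    apply: (mD gt j r) => [z||z rz].
    - by rewrite (sl z).1 -iE; exact: dg.
    - rewrite -DE => z; have c1 : ((t : R), z') @[z' --> z] --> ((t : R), z).
        exact: (@cvg_pair _ _ _ (nbhs z) (nbhs (t : R)) (nbhs z) _ _ _ (fun=> (t : R)) id (cvg_cst (t : R)) cvg_id).
      exact: (cvg_comp _ _ (cvg_comp _ _ c1 (@row_cons_continuous n (t, z))) (cg _)).
    - by apply: g0; apply: le_trans rz (row_cons_ge (t, z)).2.
  rewrite -(integral21_prod_meas1 pint); apply: integral0_eq => z _.
  have sh t h : row_cons (h *: (1 : R) + t, z) = h *: evec ord0 + row_cons (t, z).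
    by rewrite evec_ord0 -row_cons_shift scaler0 add0r.
  pose gz := g \o (fun t => row_cons (t, z)).
  have sl t := @derive_reparam R _ g (fun t => row_cons (t, z)) t 1 (evec ord0) (sh t).
  have DE : (fun t => Dg (row_cons (t, z))) = 'D_1 gz.
    by apply/funext => t; rewrite (sl t).2 /Dg iE.
  transitivity (\int[mur]_t ('D_1 gz t)%:E)%E.
    by apply: eq_integral => t _; rewrite -(congr1 (@^~ t) DE).
  apply: (@integral_derive_compact gz r) => [t||t rt].
  - by rewrite (sl t).1 -iE; exact: dg.
  - rewrite -DE => t; have c1 : (t', (z : 'rV[R]_n)) @[t' --> t] --> (t, (z : 'rV[R]_n)).
      exact: (@cvg_pair _ _ _ (nbhs t) (nbhs t) (nbhs (z : 'rV[R]_n)) _ _ _ id (fun=> (z : 'rV[R]_n)) cvg_id (cvg_cst (z : 'rV[R]_n))).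
    exact: (cvg_comp _ _ (cvg_comp _ _ c1 (@row_cons_continuous n (t, z))) (cg _)).
  - by apply: g0; apply: le_trans rt (row_cons_ge (t, z)).1.
Qed.

End IteratedIntegral.

Import HBNNSimple.

(** * Integration against a density *)

Section density.
Local Open Scope ereal_scope.
Context {d1 d2} {T1 : measurableType d1} {T2 : measurableType d2} {R : realType}.
Variables (mu : {measure set T1 -> \bar R}) (m : {measure set T2 -> \bar R}).
Variables (D1 : set T1) (D2 : set T2) (psi : T2 -> T1) (w : T2 -> R).
Hypotheses (mD1 : measurable D1) (mD2 : measurable D2).
Hypotheses (mpsi : measurable_fun D2 psi) (mw : measurable_fun D2 w).
Hypothesis psiD : forall x, D2 x -> D1 (psi x).
Hypothesis w_ge0 : forall x, D2 x -> (0 <= w x)%R.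
Hypothesis mu_density : forall B, measurable B -> B `<=` D1 ->
  mu B = \int[m]_(x in D2 `&` psi @^-1` B) (w x)%:E.

Let mcomp (g : T1 -> R) : measurable_fun setT g ->
  measurable_fun D2 (fun x => (g (psi x))%:E * (w x)%:E).
Proof.
move=> mg; apply: emeasurable_funM; apply/measurable_EFinP => //.
exact: (measurableT_comp mg mpsi).
Qed.

(** [mu_density] is the case of indicators. Finite sums give simple functions, and monotone
    convergence, applied on both sides to the same approximating sequence, gives the general
    case. *)
Lemma ge0_integral_density (f : T1 -> \bar R) :
  measurable_fun D1 f -> (forall x, D1 x -> 0 <= f x) ->
  \int[mu]_(x in D1) f x = \int[m]_(x in D2) (f (psi x) * (w x)%:E).
Proof.
move=> mf f0.
pose f_ := nnsfun_approx mD1 mf.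
have f_cvg x : D1 x -> (EFin \o f_^~ x) n @[n --> \oo] --> f x.
  by move=> Dx; apply: cvg_nnsfun_approx.
transitivity (limn (fun n => \int[mu]_(x in D1) (f_ n x)%:E)).
  rewrite -monotone_convergence//.
  - by apply: eq_integral => y /[!inE] yD; apply/esym/cvg_lim => //; exact: f_cvg.
  - by move=> n; exact/measurable_EFinP/measurable_funTS.
  - by move=> n y _; rewrite lee_fin.
  - by move=> y _ a b ab; rewrite lee_fin; exact/lefP/nd_nnsfun_approx.
transitivity (limn (fun n => \int[m]_(x in D2) ((f_ n (psi x))%:E * (w x)%:E))); last first.
  rewrite -monotone_convergence//.
  - apply: eq_integral => y /[!inE] yD; apply/cvg_lim => //.
    by apply: cvgeZr => //; apply: f_cvg; exact: psiD.
  - by move=> n; exact: mcomp.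
  - by move=> n y yD; rewrite mule_ge0 // lee_fin ?w_ge0.
  - move=> y yD a b ab; rewrite lee_wpmul2r ?lee_fin ?w_ge0 //.
    exact/lefP/nd_nnsfun_approx.
congr (limn _); apply/funext => n; set g := f_ n.
have mpre k : measurable (D2 `&` psi @^-1` (g @^-1` [set k])) by exact: mpsi.
transitivity (\sum_(k \in range g) (k%:E * mu (D1 `&` g @^-1` [set k]))).
  under eq_integral do rewrite fimfunE -fsumEFin//.
  rewrite ge0_integral_fsum//; last 2 first.
  - by move=> y; apply/measurable_EFinP/measurable_funM => //; exact: measurable_funTS.
  - by move=> y x _; rewrite nnfun_muleindic_ge0.
  apply: eq_fsbigr => r _; rewrite integralZl_indic_nnsfun// integral_indic//=.
  by rewrite setIC.
transitivity (\sum_(k \in range g)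
    \int[m]_(x in D2) ((k * \1_(g @^-1` [set k]) (psi x))%:E * (w x)%:E)).
  apply: eq_fsbigr => k /[!inE] -[y _ <-]; set B := g @^-1` _.
  have mB : measurable B by rewrite /B -[X in measurable X]setTI; exact: (@measurable_funP _ _ _ _ setT g).
  transitivity (\int[m]_(x in D2) ((g y)%:E * ((\1_B (psi x))%:E * (w x)%:E))).
    rewrite ge0_integralZl_EFin //.
    - rewrite mu_density; [|exact: measurableI|by move=> x []].
      rewrite (_ : D2 `&` _ = D2 `&` psi @^-1` B); last first.
        apply/seteqP; split => x /=; first by move=> [? []].
        by move=> [Dx Bx]; split=> //; split=> //; exact: psiD.
      rewrite integral_mkcondr; congr (_ * _); apply: eq_integral => x _.
      rewrite patchE indicE; case: ifPn => xB.
        by rewrite (_ : psi x \in B) ?mul1e //; move: xB; rewrite !inE.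
      by rewrite (_ : psi x \in B = false) ?mul0e //; apply: negbTE; move: xB; rewrite !notin_setE.
    - by move=> x Dx; rewrite mule_ge0 // lee_fin ?w_ge0 // indicE.
    - exact: (@mcomp (\1_B)).
  by apply: eq_integral => x _; rewrite EFinM muleA.
rewrite -ge0_integral_fsum//; last 2 first.
- move=> k; apply: (@mcomp (fun x => k * \1_(g @^-1` [set k]) x)%R).
  exact: measurable_funM.
- by move=> k x Dx; rewrite mule_ge0 ?nnfun_muleindic_ge0 // lee_fin w_ge0.
apply: eq_integral => x /[!inE] Dx.
rewrite [in RHS]fimfunE -fsumEFin// ge0_mule_fsuml //.
by move=> k; rewrite nnfun_muleindic_ge0.
Qed.

End density.

(** * Bump functions *)

Section Bump.
Context {R : realType}.

(** The usual flat function, with a polynomial factor in [1 / s] that makes the family stable under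
    differentiation; smoothness is then an induction over all [p] at once. *)
Definition flat (p : {poly R}) (s : R) : R :=
  if 0 < s then p.[s^-1] * expR (- s^-1) else 0.

(** The exponential series gives [x^(k+1) / (k+1)! <= exp x], taken at [x = 1 / s]; one power more
    than [k] leaves the factor [s]. *)
Lemma flat_monomial_bound k (s : R) : `|flat 'X^k s| <= k.+1`!%:R * `|s|.
Proof.
rewrite /flat; case: ifPn => [s0|_]; last by rewrite normr0 mulr_ge0.
have x0 : 0 < s^-1 by rewrite invr_gt0.
have n0 : 0 <= s^-1 ^+ k * expR (- s^-1).
  by rewrite mulr_ge0 ?expR_ge0 // exprn_ge0 // ltW.
rewrite hornerXn (gtr0_norm s0) (ger0_norm n0).
have f0 : 0 < k.+1`!%:R :> R by rewrite ltr0n fact_gt0.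
have := expR_ge1Dxn k (ltW x0).
rewrite expRN ler_pdivrMr ?expR_gt0 // => h.
have h2 : s^-1 ^+ k.+1 <= k.+1`!%:R * expR s^-1 by rewrite mulrC -ler_pdivrMr //; lra.
have -> : s^-1 ^+ k = s^-1 ^+ k.+1 * s by rewrite exprSr -mulrA mulVf ?mulr1 // gt_eqF.
by rewrite [leRHS]mulrAC ler_pM2r.
Qed.

Lemma flat_bound (p : {poly R}) : exists C : R, forall s, `|flat p s| <= C * `|s|.
Proof.
exists (\sum_(i < size p) `|p`_i| * i.+1`!%:R) => s.
have -> : flat p s = \sum_(i < size p) p`_i * flat 'X^i s.
  rewrite /flat; case: ifPn => _; last by rewrite big1 // => i _; rewrite mulr0.
  rewrite horner_coef mulr_suml; apply: eq_bigr => i _.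
  by rewrite hornerXn mulrA.
rewrite mulr_suml; apply: le_trans (ler_norm_sum _ _ _) _.
apply: ler_sum => i _; rewrite normrM -mulrA.
by apply: ler_wpM2l => //; exact: flat_monomial_bound.
Qed.

Lemma is_derive_flat (p : {poly R}) (s : R) :
  is_derive s 1 (flat p) (flat ('X^2 * (p - p^`())) s).
Proof.
have [s0|s0|->] := ltrgtP s 0.
- have -> : flat ('X^2 * (p - p^`())) s = 0 by rewrite /flat ltNge ltW.
  apply: near_eq_is_derive (is_derive_cst 0 s 1).
  have e0 : 0 < - s by rewrite oppr_gt0.
  apply: filterS (near_dist_lt s e0) => t; rewrite ltr_distl => /andP[_ ts].
  by rewrite /flat ltNge ltW //=; lra.
- have d1 : is_derive s 1 (fun t : R => t^-1) (- s ^- 2).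
    split; first by apply: derivableV; rewrite ?gt_eqF.
    by rewrite deriveV ?gt_eqF // derive_id [LHS]mulr1.
  have d0 : is_derive s 1 (fun t : R => - t^-1) (s ^- 2).
    by rewrite -[s ^- 2]opprK; exact: is_deriveN d1.
  have d2 : is_derive s 1 ((horner p \o (fun t => t^-1)) * (expR \o (fun t => - t^-1)))
      (flat ('X^2 * (p - p^`())) s).
    have dp := is_derive_outer (is_derive_poly p s^-1) d1.
    have de := @is_derive_outer R R expR (fun t : R => - t^-1) s 1 _ _ (is_derive_expR _) d0.
    apply: is_derive_eq (is_deriveM dp de) _.
    rewrite /flat s0 hornerM hornerXn hornerD hornerN /=.
    have alg (a b c e : R) : a * (e * c) + e * (b * - c) = c * (a - b) * e by ring.
    by rewrite -exprVn; exact: alg.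
  apply: near_eq_is_derive d2.
  apply: filterS (near_dist_lt s s0) => t; rewrite ltr_distl => /andP[ts _].
  by rewrite /flat; case: ifPn => //; rewrite -leNgt; lra.
- have -> : flat ('X^2 * (p - p^`())) 0 = 0 by rewrite /flat ltxx.
  (* At 0 the quotient is [flat ('X * p) h], again a member of the family, and so bounded by a
     multiple of [|h|]. *)
  have q : h^-1 *: (flat p (h *: 1 + 0) - flat p 0) @[h --> (0 : R)^'] --> (0 : R).
    have [C bC] := flat_bound ('X * p).
    apply/cvgrPdist_le => e e0.
    have e1 : 0 < e / (`|C| + 1) by rewrite divr_gt0 // ltr_wpDl.
    have near0 : \forall h \near (0 : R)^', `|h| < e / (`|C| + 1) by exact: dnbhs0_lt.
    apply: filterS near0 => h he.
    rewrite sub0r normrN [h *: 1]mulr1 addr0 {2}/flat ltxx subr0.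
    have -> : h^-1 *: flat p h = flat ('X * p) h.
      rewrite /flat; case: ifPn => _; last by rewrite [LHS]mulr0.
      by rewrite hornerM hornerX -mulrA.
    apply: le_trans (bC h) _; apply: le_trans (_ : (`|C| + 1) * `|h| <= _).
      by rewrite ler_wpM2r // (le_trans (ler_norm C)) // lerDl.
    by rewrite mulrC -ler_pdivlMr ?ltr_wpDl // ltW.
  split; first by apply/cvg_ex; exists 0.
  exact: cvg_lim q.
Qed.

Lemma flat_affine_smooth n k p (i : 'I_n) (c d : R) :
  Ck_on k setT (fun x : 'rV[R]_n => flat p (c * x 0 i + d)).
Proof.
have aff (x h : 'rV[R]_n) : is_derive x h (fun x : 'rV[R]_n => c * x 0 i + d) (c * h 0 i).
  have := is_deriveD (is_deriveZ c (is_derive_coord i (is_derive_id x h))) (is_derive_cst d x h).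
  by rewrite addr0.
have D q (x h : 'rV[R]_n) : is_derive x h (fun x : 'rV[R]_n => flat q (c * x 0 i + d))
    (c * h 0 i * flat ('X^2 * (q - q^`())) (c * x 0 i + d)).
  by rewrite mulrC; exact: (is_derive_outer (is_derive_flat q _) (aff x h)).
have cts q (x : 'rV[R]_n) : {for x, continuous (fun x : 'rV[R]_n => flat q (c * x 0 i + d))}.
  have c1 : c * x' 0 i + d @[x' --> x] --> c * x 0 i + d.
    apply: cvgD; last exact: cvg_cst.
    by apply: cvgM; [exact: cvg_cst|exact: coord_continuous].
  have [dq _] := is_derive_flat q (c * x 0 i + d).
  have cf : {for c * x 0 i + d, continuous (flat q)}.
    exact/differentiable_continuous/derivable1_diffP.
  exact: (cvg_comp _ _ c1 cf).
elim: k p => [|k IH] p; first by apply/Ck_on0.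
apply/Ck_onS; split=> [x _|x h _|h]; [exact: cts|by have [] := D p x h|].
have -> : 'D_h (fun x : 'rV[R]_n => flat p (c * x 0 i + d)) =
    (fun x => c * h 0 i * flat ('X^2 * (p - p^`())) (c * x 0 i + d)).
  by apply/funext => x; have [_ ->] := D p x h.
exact: (Ck_onZ (c * h 0 i) openT (IH _)).
Qed.

(** The two factors of index [i] are both positive exactly when [|x_i - c_i| < r], so the bump lives
    on a sup-norm ball. Their arguments have the shape expected by [flat_affine_smooth]. *)
Definition rV_bump n (c : 'rV[R]_n) (r : R) (x : 'rV[R]_n) : R :=
  \prod_i (flat 1 (1 * x 0 i + (r - c 0 i)) * flat 1 (-1 * x 0 i + (r + c 0 i))).

Lemma rV_bump_smooth n (c : 'rV[R]_n) r k : Ck_on k setT (rV_bump c r).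
Proof.
apply: Ck_on_prod => [|i]; first exact: openT.
apply: Ck_onM; [exact: openT|exact: flat_affine_smooth|exact: flat_affine_smooth].
Qed.

Lemma flat1_ge0 s : 0 <= flat 1 s.
Proof. by rewrite /flat; case: ifP => // _; rewrite hornerC mul1r expR_ge0. Qed.

Lemma flat1_gt0 s : (0 < flat 1 s) = (0 < s).
Proof.
by rewrite /flat; case: ifP => [s0|_]; rewrite ?ltxx // hornerC mul1r expR_gt0.
Qed.

Lemma rV_bump_ge0 n (c : 'rV[R]_n) r x : 0 <= rV_bump c r x.
Proof. by apply: prodr_ge0 => i _; rewrite mulr_ge0 // flat1_ge0. Qed.

Lemma rV_bump_gt0 n (c : 'rV[R]_n) r x : `|x - c| < r -> 0 < rV_bump c r x.
Proof.
move=> xr; apply: prodr_gt0 => i _; have := le_lt_trans (coord_le_norm (x - c) i) xr.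
rewrite !mxE ltr_norml => /andP[h1 h2].
by rewrite mulr_gt0 // flat1_gt0; lra.
Qed.

Lemma rV_bump_eq0 n (c : 'rV[R]_n) r x : 0 <= r -> r < `|x - c| -> rV_bump c r x = 0.
Proof.
move=> r0 rx; have [i ri] : exists i, r < `|(x - c) 0 i|.
  apply/not_existsP => h; move: rx; rewrite ltNge => /negP; apply.
  by apply: norm_le_coord => // i; rewrite leNgt; apply/negP; exact: h.
rewrite /rV_bump (bigD1 i) //=; move: ri; rewrite !mxE ltr_normr => ri.
have [h|h] : flat 1 (1 * x 0 i + (r - c 0 i)) = 0 \/ flat 1 (-1 * x 0 i + (r + c 0 i)) = 0.
- case/orP: ri => ri.
    by right; rewrite /flat ltNge (_ : _ <= 0) //; lra.
  by left; rewrite /flat ltNge (_ : _ <= 0) //; lra.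
- by rewrite h !mul0r.
- by rewrite h mulr0 mul0r.
Qed.

End Bump.

(** Induction principle for compact sets. If [P K] failed, the sets [X] with [P (K \ X)] would form
    a proper filter containing [K]; the good neighbourhood of a cluster point has its complement in
    the filter, a contradiction. *)
Lemma compact_local {T : topologicalType} (K : set T) (P : set T -> Prop) :
  compact K -> P set0 -> (forall X Y, P X -> P Y -> P (X `|` Y)) ->
  (forall X Y, X `<=` Y -> P Y -> P X) ->
  (forall p, K p -> exists U, [/\ open U, U p & P U]) -> P K.
Proof.
move=> cK P0 PU PS Ploc; apply: contrapT => nPK.
pose F := [set X : set T | P (K `\` X)].
have PF : ProperFilter F.
  split; first by rewrite /F /= setD0.
  split; first by rewrite /F /= setDT.
    by move=> X Y FX FY; rewrite /F /= setDIr; exact: PU.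
  by move=> X Y XY; apply: PS; exact: setDS.
have FK : F K by rewrite /F /= setDv.
have [p [Kp clp]] := cK F PF FK.
have [U [oU Up PUU]] := Ploc p Kp.
have FU : F (~` U) by apply: PS PUU => x [_ /contrapT].
have [x [nUx Ux]] := clp _ _ FU (open_nbhs_nbhs (conj oU Up)).
exact: nUx.
Qed.

(** * Charts *)

Section Charts.
Context {R : realType} {n : nat} {M : ptopologicalType}.
Variable A : smooth_atlas R n M.
Implicit Types (a b : chart A) (x y xi : 'rV[R]_n) (u v : M -> R) (W : set M) (p : M).

Lemma cod_phi a p : dom a p -> cod a (phi a p).
Proof. by move=> ap; exists p. Qed.

Lemma psi_dom a x : cod a x -> dom a (psi a x).
Proof. by move=> [p ap <-]; rewrite phiK. Qed.

Lemma psiK a x : cod a x -> phi a (psi a x) = x.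
Proof. by move=> [p ap <-]; rewrite phiK. Qed.

Lemma chart_imageE a W : phi a @` (dom a `&` W) = cod a `&` psi a @^-1` W.
Proof.
apply/seteqP; split => x; first by move=> [p [ap Wp] <-]; split; [exact: cod_phi|rewrite /= phiK].
by move=> [ax Wx]; exists (psi a x); [split=> //; exact: psi_dom|exact: psiK].
Qed.

Lemma open_chart_image a W : open W -> open (phi a @` (dom a `&` W)).
Proof.
move=> oW; rewrite chart_imageE; apply: preimage_open_on => //; first exact: open_cod.
by move=> x; exact: psi_continuous.
Qed.

Lemma chart_image_cod a W : phi a @` (dom a `&` W) `<=` cod a.
Proof. by rewrite chart_imageE => x []. Qed.

Lemma Ck_funW j k W u : (j <= k)%N -> Ck_fun A k W u -> Ck_fun A j W u.
Proof. by move=> jk Cu a; exact: Ck_onW (Cu a). Qed.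

Lemma Ck_fun_sub k W W' u : W' `<=` W -> Ck_fun A k W u -> Ck_fun A k W' u.
Proof.
move=> WW' Cu a; apply: (Ck_on_sub _ (Cu a)); rewrite !chart_imageE.
by move=> x [ax Wx]; split=> //; exact: WW'.
Qed.

Definition transition a b := phi b \o psi a.

Lemma transition_Ck k a b : Ck_on k (phi a @` (dom a `&` dom b)) (transition a b).
Proof. exact: (@transition_smooth _ _ _ A a b k). Qed.

Lemma duE a u x : du a u x = gradient (u \o psi a) x.
Proof. by []. Qed.

Lemma derive_chart W a u p y : open W -> Ck_fun A 1 W u -> W p -> dom a p ->
  'D_y (u \o psi a) (phi a p) = dot (du a u (phi a p)) y.
Proof.
move=> oW Cu Wp ap; rewrite duE.
have Op : (phi a @` (dom a `&` W)) (phi a p) by exists p.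
exact: (derive_gradient y (open_chart_image (a:=a) oW) (Cu a) Op).
Qed.

Section overlap.
Variables (a b : chart A) (p : M).
Hypotheses (ap : dom a p) (bp : dom b p).

Lemma overlap_open : open (phi a @` (dom a `&` dom b)).
Proof. by apply: open_chart_image; exact: open_dom. Qed.

Lemma overlap_in : (phi a @` (dom a `&` dom b)) (phi a p).
Proof. by exists p. Qed.

Lemma transition_derivable y : derivable (transition a b) (phi a p) y.
Proof.
have /Ck_onS[_ + _] := @transition_Ck 1 a b; apply; exact: overlap_in.
Qed.

Lemma transitionE : transition a b (phi a p) = phi b p.
Proof. by rewrite /transition /= phiK. Qed.

Lemma derive_transition W u y : open W -> Ck_fun A 1 W u -> W p ->
  'D_y (u \o psi a) (phi a p) =
  'D_('D_y (transition a b) (phi a p)) (u \o psi b) (phi b p).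
Proof.
move=> oW Cu Wp; rewrite (derive_chart _ oW Cu Wp bp).
have Op : (phi b @` (dom b `&` W)) (transition a b (phi a p)).
  by rewrite transitionE; exists p.
have dt := derivableP (@transition_derivable y).
have dc := is_derive_comp (open_chart_image (a:=b) oW) (Cu b) Op dt.
have [_ ->] : is_derive (phi a p) y (u \o psi a)
    (dot (gradient (u \o psi b) (transition a b (phi a p))) ('D_y (transition a b) (phi a p))).
  apply: near_eq_is_derive dc.
  have := open_nbhs_nbhs (conj overlap_open overlap_in).
  apply: filterS => _ [q [aq bq] <-].
  by rewrite /= /transition /= !phiK.
by rewrite transitionE.
Qed.

End overlap.

(** The chain rule applied, coordinate by coordinate, to the composite of the two transition maps,
    which is the identity near [phi a p]. *)
Lemma transition_cancel a b p y : dom a p -> dom b p ->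
  'D_('D_y (transition a b) (phi a p)) (transition b a) (phi b p) = y.
Proof.
move=> ap bp; have dt := derivableP (@transition_derivable _ _ _ ap bp y).
have dt' := derivableP (@transition_derivable _ _ _ bp ap ('D_y (transition a b) (phi a p))).
apply/rowP => j; rewrite derive_mx ?mxE; last exact: transition_derivable.
have Cj : Ck_on 1 (phi b @` (dom b `&` dom a)) (fun x => transition b a x 0 j).
  exact: (Ck_on_coord j (@overlap_open b a) (@transition_Ck 1 b a)).
have Op : (phi b @` (dom b `&` dom a)) (transition a b (phi a p)).
  by rewrite transitionE //; exact: overlap_in.
have dc := is_derive_comp (@overlap_open b a) Cj Op dt.
have : is_derive (phi a p) y (fun x : 'rV[R]_n => x 0 j) (dot (gradient (fun x => transition b a x 0 j)
    (transition a b (phi a p))) ('D_y (transition a b) (phi a p))).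
  apply: near_eq_is_derive dc.
  have := open_nbhs_nbhs (conj (@overlap_open a b) (overlap_in ap bp)).
  by apply: filterS => _ [q [aq bq] <-]; rewrite /= /transition /= !phiK.
rewrite -(derive_gradient _ (@overlap_open b a) Cj Op) transitionE // => -[_ <-].
have [_ ->] // := is_derive_coord j (is_derive_id (phi a p) y).
Qed.

Section FinslerCharts.
Variable F : finsler_metric A.

Lemma Fin_minkowski a x : cod a x -> minkowski_norm (Fin F a x).
Proof.
apply: (@slice_minkowski R n (cod a)).
- by move=> z y; exact: Fin_ge0.
- by move=> z y l; exact: Fin_homogeneous.
- exact: Fin_smooth.
- by move=> z y zc y0 w w0; exact: (@Fin_convex _ _ _ _ F a z y zc y0 w w0).
Qed.

Section compat.
Variables (a b : chart A) (p : M) (W : set M) (u : M -> R).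
Hypotheses (ap : dom a p) (bp : dom b p) (oW : open W) (Cu : Ck_fun A 1 W u) (Wp : W p).

Let J y := 'D_y (transition a b) (phi a p).

Lemma dot_du_compat y : dot (du a u (phi a p)) y = dot (du b u (phi b p)) (J y).
Proof.
rewrite -(derive_chart y oW Cu Wp ap) (derive_transition ap bp y oW Cu Wp).
exact: (derive_chart _ oW Cu Wp bp).
Qed.

Let Fin_J y : Fin F a (phi a p) y = Fin F b (phi b p) (J y).
Proof. by rewrite (Fin_compat F y (overlap_in ap bp)) phiK. Qed.

Let J_surj z : exists y, J y = z.
Proof. by exists ('D_z (transition b a) (phi b p)); exact: transition_cancel. Qed.

(** The differential [J] of the transition map carries one indicatrix onto the other and preserves
    the pairing with [Du], so both suprema are over the same set of numbers. *)
Lemma Fstar_compat : Fstar F a (phi a p) (du a u (phi a p)) = Fstar F b (phi b p) (du b u (phi b p)).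
Proof.
rewrite /Fstar; congr sup; apply/seteqP; split => t [y /= Fy <-].
  by exists (J y); rewrite /= -?Fin_J // dot_du_compat.
have [z zy] := J_surj y; exists z; rewrite /= ?Fin_J ?zy //.
by rewrite dot_du_compat zy.
Qed.

Lemma calV_compat : calV F a u (phi a p) = calV F b u (phi b p).
Proof. by rewrite /calV Fstar_compat. Qed.

(** Uniqueness of the maximiser: [J] of the gradient in chart [a] reaches in chart [b] the maximal
    value, which is the same in both charts, so it is the gradient there. *)
Lemma grad_compat : grad F b u (phi b p) = J (grad F a u (phi a p)).
Proof.
apply/esym/eqP; apply/negPn/negP => ne.
have := legendre_max (Fin_minkowski (cod_phi bp)) ne.
rewrite -dot_du_compat -Fin_J -[dual_norm _ _]/(Fstar F b (phi b p) _) -Fstar_compat.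
rewrite [ltLHS](legendre_max_eq (Fin_minkowski (cod_phi ap))).
by rewrite ltxx.
Qed.

Lemma pairing_compat v : Ck_fun A 1 W v ->
  dot (du a v (phi a p)) (grad F a u (phi a p)) = dot (du b v (phi b p)) (grad F b u (phi b p)).
Proof.
move=> Cv; rewrite grad_compat -(derive_chart _ oW Cv Wp ap).
by rewrite (derive_transition ap bp _ oW Cv Wp) (derive_chart _ oW Cv Wp bp).
Qed.

Lemma du_neq0_compat : du a u (phi a p) != 0 -> du b u (phi b p) != 0.
Proof.
apply: contra_neq => e; apply: dot_inj => y.
by rewrite dot_du_compat e !dot0l.
Qed.

End compat.
End FinslerCharts.
End Charts.

(** * Integration on the manifold *)

Section Integration.
Context {R : realType} {n : nat} {M : ptopologicalType}.
Variable A : smooth_atlas R n M.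
Hypothesis hM : hausdorff_space M.
Variables (mu : {measure set (borel M) -> \bar R}) (s : smooth_density A mu).
Variable m : {sigma_finite_measure set (borel 'rV[R]_n) -> \bar R}.
Hypothesis m_ball : forall (c : 'rV[R]_n) r, 0 <= r ->
  m [set z : 'rV[R]_n | `|z - c| <= r] = ((2 * r) ^+ n)%:E.
Hypothesis m_int : forall f : 'rV[R]_n -> \bar R,
  measurable_fun setT (f : borel 'rV[R]_n -> \bar R) ->
  (forall z, 0 <= f z)%E -> iintegral f = (\int[m]_z f z)%E.
Hypothesis m_derive : forall (g : 'rV[R]_n -> R) i (r : R),
  (forall z, derivable g z (evec i)) -> continuous ('D_(evec i) g) ->
  (forall z, r <= `|z| -> g z = 0) -> (\int[m]_z ('D_(evec i) g z)%:E)%E = 0%E.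
Implicit Types (a b : chart A) (x : 'rV[R]_n) (u v : M -> R) (W K : set M) (p : M).

Lemma sigma_continuous a x : cod a x -> {for x, continuous (sigma s a)}.
Proof. by move=> ax; apply: (Ck_on_continuous (@sigma_smooth _ _ _ _ _ s a 0)). Qed.

Lemma psi_measurable a :
  measurable_fun (cod a : set (borel 'rV[R]_n)) (psi a : borel 'rV[R]_n -> borel M).
Proof.
by apply: continuous_on_borel => [|x ax]; [exact: open_cod|exact: psi_continuous].
Qed.

Lemma sigma_measurable a :
  measurable_fun (cod a : set (borel 'rV[R]_n)) (sigma s a : borel 'rV[R]_n -> R).
Proof.
by apply: continuous_on_measurable => [|x]; [exact: open_cod|exact: sigma_continuous].
Qed.

Lemma cod_measurable a : measurable (cod a : set (borel 'rV[R]_n)).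
Proof. by apply: open_borel_measurable; exact: open_cod. Qed.

Lemma dom_measurable a : measurable (dom a : set (borel M)).
Proof. by apply: open_borel_measurable; exact: open_dom. Qed.

(** The image under [phi a] is rewritten as a preimage under [psi a], which is visibly measurable;
    only then can the iterated integral be replaced by one against [m]. *)
Lemma mu_chart a (B : set (borel M)) : measurable B -> B `<=` dom a ->
  mu B = (\int[m]_(x in cod a `&` psi a @^-1` B) (sigma s a x)%:E)%E.
Proof.
move=> mB Ba.
have mI : measurable (cod a `&` psi a @^-1` B : set (borel 'rV[R]_n)).
  exact: (psi_measurable (cod_measurable a) mB).
have imE : phi a @` B = cod a `&` psi a @^-1` B.
  by rewrite -chart_imageE; congr image; apply/esym/setIidr.
pose g := (sigma s a : borel 'rV[R]_n -> R) \_ (cod a `&` psi a @^-1` B).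
have gE : (fun x => (\1_(phi a @` B) x * sigma s a x)%:E) = EFin \o g.
  apply/funext => x; rewrite imE /g /= patchE indicE.
  by case: ifPn => _; rewrite ?mul1r ?mul0r.
rewrite (mu_sigma s mB Ba) gE m_int.
- by rewrite [RHS]integral_mkcond; apply: eq_integral => x _; rewrite /g restrict_EFin.
- apply/measurable_EFinP; apply/(measurable_restrictT _ mI).
  by apply: (measurable_funS (cod_measurable a) _ (sigma_measurable (a:=a))) => x [].
- move=> x; rewrite lee_fin /g patchE; case: ifPn => // /set_mem [cx _].
  exact/ltW/sigma_gt0.
Qed.

Lemma ge0_integral_chart a (f : M -> \bar R) :
  measurable_fun (dom a : set (borel M)) (f : borel M -> \bar R) ->
  (forall p, dom a p -> (0 <= f p)%E) ->
  (\int[mu]_(p in (dom a : set (borel M))) f p = \int[m]_(x in cod a) (f (psi a x) * (sigma s a x)%:E))%E.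
Proof.
apply: ge0_integral_density.
- exact: dom_measurable.
- exact: cod_measurable.
- exact: psi_measurable.
- exact: sigma_measurable.
- by move=> x; exact: psi_dom.
- by move=> x cx; exact/ltW/sigma_gt0.
- by move=> B; exact: mu_chart.
Qed.

Lemma integral_chart a (h : M -> R) :
  measurable_fun (dom a : set (borel M)) (h : borel M -> R) ->
  (\int[mu]_(p in (dom a : set (borel M))) (h p)%:E = \int[m]_(x in cod a) (h (psi a x) * sigma s a x)%:E)%E.
Proof.
move=> mh; have mEh : measurable_fun (dom a : set (borel M)) (EFin \o (h : borel M -> R)) by exact/measurable_EFinP.
rewrite integralE [RHS]integralE; congr (_ - _)%E.
- rewrite ge0_integral_chart //; last exact: measurable_funepos.
  apply: eq_integral => x /set_mem cx; rewrite !funeposE.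
  by rewrite -!EFin_max -EFinM maxr_pMl ?mul0r //; exact/ltW/sigma_gt0.
- rewrite ge0_integral_chart //; last exact: measurable_funeneg.
  apply: eq_integral => x /set_mem cx; rewrite !funenegE.
  by rewrite -!EFinN -!EFin_max -EFinM maxr_pMl ?mul0r ?mulNr //; exact/ltW/sigma_gt0.
Qed.

(* mu of a small coordinate ball is comparable with its volume. *)
Lemma small_neighborhood U p : open U -> U p ->
  exists V, [/\ open V, V p, V `<=` U & (0 < mu V < +oo)%E].
Proof.
move=> oU Up; pose a := chart_at A p; have ap : dom a p := dom_chart_at A p.
pose x0 := phi a p; have cx0 : cod a x0 by exact: cod_phi.
pose c := sigma s a x0; have c0 : 0 < c by exact: sigma_gt0.
have oO := open_chart_image (a:=a) oU.
have Ox0 : (phi a @` (dom a `&` U)) x0 by exists p.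
have near_s : \forall x \near x0, 2^-1 * c < sigma s a x < 2 * c.
  have cs := sigma_continuous cx0.
  have lo : \forall x \near x0, 2^-1 * c < sigma s a x by apply: (cvgr_gt c cs); lra.
  have hi : \forall x \near x0, sigma s a x < 2 * c by apply: (cvgr_lt c cs); lra.
  by apply: filterS2 lo hi => x -> ->.
have [e e0 eB] : exists2 e, 0 < e & forall x, `|x - x0| < e ->
    (phi a @` (dom a `&` U)) x /\ 2^-1 * c < sigma s a x < 2 * c.
  by apply/near_dist_ltP; apply: filterI => //; exact: open_nbhs_nbhs.
pose V := dom a `&` phi a @^-1` [set x | `|x - x0| < e].
have oV : open V.
  apply: preimage_open_on; [exact: open_dom|by move=> q; exact: phi_continuous|exact: open_distb].
have Vp : V p by split=> //=; rewrite subrr normr0.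
have mV : measurable (V : set (borel M)) by exact: open_borel_measurable.
have mO r : measurable ([set x : 'rV[R]_n | `|x - x0| <= r] : set (borel 'rV[R]_n)).
  by apply: closed_borel_measurable; apply: compact_closed => //; exact: closed_ball_compact.
pose Be := [set x : 'rV[R]_n | `|x - x0| < e].
pose Bc r := [set x : 'rV[R]_n | `|x - x0| <= r].
have E : cod a `&` psi a @^-1` V = Be.
  apply/seteqP; split => x /=; first by move=> [cx [_ /=]]; rewrite psiK.
  move=> xe; have [xU _] := eB x xe; have cx := chart_image_cod xU.
  by split=> //; split; [exact: psi_dom|rewrite /= psiK].
have mE : measurable (Be : set (borel 'rV[R]_n)).
  by apply: open_borel_measurable; exact: open_distb.
have ms : measurable_fun (Be : set (borel 'rV[R]_n))
    (EFin \o (sigma s a : borel 'rV[R]_n -> R)).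
  apply/measurable_EFinP; apply: (measurable_funS (cod_measurable a) _ (sigma_measurable (a:=a))) => x xe.
  by have [/chart_image_cod] := eB x xe.
exists V; split=> //.
  by move=> q [aq] /= /eB[+ _]; move=> [q' [aq' Uq']] /(congr1 (psi a)); rewrite !phiK // => <-.
rewrite (@mu_chart a V mV) ?E; last by move=> q [].
apply/andP; split.
  apply: (@lt_le_trans _ _ (\int[m]_(x in Be) (2^-1 * c)%:E)%E); last first.
    by apply: ge0_le_integral => //= [x _|x /eB[_ /andP[/ltW]]//]; rewrite lee_fin; lra.
  rewrite integral_cst // mule_gt0 ?lte_fin ?mulr_gt0 //.
  apply: (@lt_le_trans _ _ (m (Bc (2^-1 * e)%R))).
    by rewrite /Bc m_ball; [rewrite lte_fin exprn_gt0 //; lra|lra].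
  by apply: le_measure; rewrite ?inE; [exact: mO|exact: mE|move=> x /= h; apply: le_lt_trans h _; lra].
apply: (@le_lt_trans _ _ (\int[m]_(x in Be) (2 * c)%:E)%E).
  by apply: ge0_le_integral => //= [x xe|x /eB[_ /andP[_ /ltW]]//]; rewrite lee_fin; apply/ltW/sigma_gt0; have [/chart_image_cod] := eB x xe.
rewrite integral_cst //; apply: (@le_lt_trans _ _ ((2 * c)%:E * m (Bc e))%E).
  by apply: lee_wpmul2l; rewrite ?lee_fin; [lra|apply: le_measure; rewrite ?inE; [exact: mE|exact: mO|move=> x /= /ltW]].
by rewrite /Bc m_ball ?ltW // -EFinM ltry.
Qed.

(** Every point has a neighbourhood of finite measure. The local property asks for a measurable
    superset because it has to pass to arbitrary subsets. *)
Lemma mu_compact K : compact K -> (mu K < +oo)%E.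
Proof.
move=> cK; pose P X := exists B : set (borel M), [/\ measurable B, X `<=` B & (mu B < +oo)%E].
have [B [mB KB Boo]] : P K.
  apply: (compact_local cK).
  - by exists set0; split; [exact: measurable0|by []|rewrite measure0 ltry].
  - move=> X Y [B [mB XB Boo]] [C [mC YC Coo]]; exists (B `|` C); split.
    + exact: measurableU.
    + exact: setUSS.
    + by apply: le_lt_trans (measureU2 _ mB mC) _; rewrite lte_add_pinfty.
  - by move=> X Y XY [B [mB YB Boo]]; exists B; split=> //; exact: subset_trans XY YB.
  - move=> p _; have [V [oV Vp _ /andP[_ Voo]]] := small_neighborhood openT (I : setT p).
    by exists V; split=> //; exists V; split=> //; exact: open_borel_measurable.
by apply: le_lt_trans Boo; apply: le_measure; rewrite ?inE //; exact: compact_borel.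
Qed.

(** By continuity [h] exceeds [h p / 2] on some neighbourhood of [p], and that neighbourhood
    contains an open set of positive measure. *)
Lemma integral_gt0 (h : M -> R) p : continuous h -> (forall q, 0 <= h q) ->
  mu.-integrable setT (EFin \o (h : borel M -> R)) -> 0 < h p ->
  0 < \int[mu]_(q in [set: borel M]) h q.
Proof.
move=> ch h0 ih hp.
have oU : open [set q | 2^-1 * h p < h q].
  by apply: (@open_comp _ _ h [set t : R | 2^-1 * h p < t]) => [q _|]; [exact: ch|exact: open_gt].
have Up : [set q | 2^-1 * h p < h q] p by rewrite /=; lra.
have [V [oV Vp VU /andP[V0 Voo]]] := small_neighborhood oU Up.
have mV : measurable (V : set (borel M)) by exact: open_borel_measurable.
have mh : measurable_fun [set: borel M] (EFin \o (h : borel M -> R)).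
  by have /integrableP[] := ih.
rewrite fine_gt0 //; apply/andP; split; last first.
  have /integrableP[_] := ih; apply: le_lt_trans; apply: ge0_le_integral => //.
  - by move=> q _; rewrite lee_fin.
  - by apply: measurableT_comp.
  - by move=> q _; rewrite /= lee_fin ler_norm.
apply: (@lt_le_trans _ _ (\int[mu]_(q in (V : set (borel M))) (h q)%:E)%E); last first.
  by apply: ge0_subset_integral => // q _; rewrite lee_fin.
apply: (@lt_le_trans _ _ (\int[mu]_(q in (V : set (borel M))) (2^-1 * h p)%:E)%E).
  by rewrite integral_cst // mule_gt0 // lte_fin mulr_gt0.
apply: ge0_le_integral => //= [q _||q /VU /ltW //]; first by rewrite lee_fin mulr_ge0 // ltW.
exact: measurable_funTS.
Qed.

End Integration.

(** * Test functions on the manifold *)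

Section Bumps.
Context {R : realType} {n : nat} {M : ptopologicalType}.
Variable A : smooth_atlas R n M.
Hypothesis hM : hausdorff_space M.
Implicit Types (a b : chart A) (x : 'rV[R]_n) (u v : M -> R) (W K : set M) (p : M).

Lemma chart_imageU a W W' :
  phi a @` (dom a `&` (W `|` W')) = phi a @` (dom a `&` W) `|` phi a @` (dom a `&` W').
Proof. by rewrite setIUr image_setU. Qed.

Lemma Ck_funU k W W' v : Ck_fun A k W v -> Ck_fun A k W' v -> Ck_fun A k (W `|` W') v.
Proof.
move=> Cv Cv' a; rewrite chart_imageU.
exact: (Ck_onU (Cv a) (Cv' a)).
Qed.

Lemma eq_Ck_fun k W u v : open W -> (forall p, W p -> u p = v p) ->
  Ck_fun A k W u -> Ck_fun A k W v.
Proof.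
move=> oW uv Cu a; apply: (eq_Ck_on (open_chart_image (a:=a) oW) _ (Cu a)).
by move=> x; rewrite chart_imageE => -[_ Wx]; exact: uv.
Qed.

Lemma Ck_fun_cst k W (c : R) : Ck_fun A k W (fun=> c).
Proof. by move=> a; exact: Ck_on_cst. Qed.

Lemma Ck_fun_off_compact k O K v : open O -> K `<=` O -> compact K ->
  Ck_fun A k O v -> (forall p, ~ K p -> v p = 0) -> Ck_fun A k setT v.
Proof.
move=> oO KO cK Cv v0; have oK : open (~` K) by apply: closed_openC; exact: compact_closed.
have Cz : Ck_fun A k (~` K) v.
  by apply: (eq_Ck_fun oK _ (@Ck_fun_cst k (~` K) 0)) => p /v0.
have <- : O `|` ~` K = setT.
  by apply/seteqP; split=> // p _; have [/KO|] := pselect (K p); [left|right].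
exact: Ck_funU.
Qed.

Lemma chart_near a p : dom a p -> \forall q \near p, dom a q.
Proof. by move=> ap; apply: open_nbhs_nbhs; split=> //; exact: open_dom. Qed.

Lemma continuous_chart a p (h : M -> R) (g : 'rV[R]_n -> R) : dom a p ->
  (\forall q \near p, h q = g (phi a q)) -> {for phi a p, continuous g} -> {for p, continuous h}.
Proof.
move=> ap hg cg; have c : g (phi a q) @[q --> p] --> g (phi a p).
  exact: (cvg_comp _ _ (phi_continuous ap) cg).
have hp : h p = g (phi a p) by exact: nbhs_singleton hg.
rewrite /prop_for /continuous_at hp; apply: cvg_trans c.
by apply: near_eq_cvg; apply: filterS hg => q ->.
Qed.

Lemma Ck_fun_continuous k W v p : open W -> Ck_fun A k W v -> W p -> {for p, continuous v}.
Proof.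
move=> oW Cv Wp; have ap := dom_chart_at A p; set a := chart_at A p in ap.
apply: (continuous_chart (g := v \o psi a) ap).
  by apply: filterS (chart_near ap) => q aq; rewrite /= phiK.
by apply: (Ck_on_continuous (Ck_onW (leq0n k) (Cv a))); exists p.
Qed.

Lemma psi_image_compact a (B : set 'rV[R]_n) : B `<=` cod a -> compact B -> compact (psi a @` B).
Proof.
move=> Ba cB; apply: continuous_compact cB.
apply: continuous_in_subspaceT => x /set_mem Bx; apply: psi_continuous; exact: Ba.
Qed.

(** The closed coordinate ball of half the available radius is compact in the image of the chart, so
    its preimage [K] is compact, hence closed, and the bump extends smoothly by zero. *)
Lemma bump_ex U a p : open U -> U p -> dom a p -> exists v K,
  [/\ test_function A v, forall q, 0 <= v q, 0 < v p, compact K &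
      K `<=` U `&` dom a /\ forall q, ~ K q -> v q = 0].
Proof.
move=> oU Up ap; pose x0 := phi a p.
have Ux0 : (phi a @` (dom a `&` U)) x0 by exists p.
have [e e0 eB] := open_dist_lt (open_chart_image (a:=a) oU) Ux0.
pose r := 2^-1 * e; have r0 : 0 < r by rewrite /r; lra.
pose B := [set x | `|x - x0| <= r].
have BU : B `<=` phi a @` (dom a `&` U).
  by move=> x xr; apply: eB; apply: le_lt_trans xr _; rewrite /r; lra.
have Ba : B `<=` cod a by exact: subset_trans BU (@chart_image_cod _ _ _ _ _ _).
pose K := psi a @` B.
have cK : compact K by apply: psi_image_compact => //; exact: closed_ball_compact.
have KU : K `<=` U `&` dom a.
  move=> _ [x Bx <-]; split; last exact: psi_dom (Ba x Bx).
  by have := BU x Bx; rewrite chart_imageE => -[].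
pose v q := if q \in dom a then rV_bump x0 r (phi a q) else 0.
have vE q : dom a q -> v q = rV_bump x0 r (phi a q) by move=> aq; rewrite /v mem_set.
have v0 q : ~ K q -> v q = 0.
  move=> Kq; rewrite /v; case: ifPn => // /set_mem aq.
  apply: rV_bump_eq0 (ltW r0) _; rewrite ltNge; apply/negP => qr; apply: Kq.
  by exists (phi a q) => //; exact: phiK.
have Cv k : Ck_fun A k setT v.
  apply: (Ck_fun_off_compact (@open_dom _ _ _ A a) _ cK _ v0); first by move=> q /KU[].
  move=> b; have Cb := Ck_on_comp (@overlap_open _ _ _ A b a) openT (fun _ _ => I)
    (@rV_bump_smooth R n x0 r k) (@transition_Ck _ _ _ A k b a).
  apply: (eq_Ck_on (@overlap_open _ _ _ A b a) _ Cb) => _ [q [bq aq] <-].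
  by rewrite /= /transition /= phiK // vE.
exists v, K; split=> //.
- split; first exact: Cv.
  apply: (subclosed_compact _ cK); first exact: closed_closure.
  have -> : K = closure K by apply/closure_id; exact: compact_closed.
  by apply: closure_subset => q /= /eqP vq; apply: contrapT => /v0.
- by move=> q; rewrite /v; case: ifPn => // _; exact: rV_bump_ge0.
- by rewrite vE //; apply: rV_bump_gt0; rewrite subrr normr0.
Qed.

Lemma test_function_supp v p : ~ supp v p -> v p = 0.
Proof.
move=> vp; apply/eqP; apply: contrapT => /negP h; apply: vp.
exact: subset_closure.
Qed.

End Bumps.

(** * The divergence theorem and the fundamental lemma of the calculus of variations *)

Section Divergence.
Context {R : realType} {n : nat} {M : ptopologicalType}.
Variable A : smooth_atlas R n M.
Hypothesis hM : hausdorff_space M.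
Variables (mu : {measure set (borel M) -> \bar R}) (s : smooth_density A mu).
Variable m : {sigma_finite_measure set (borel 'rV[R]_n) -> \bar R}.
Hypothesis m_ball : forall (c : 'rV[R]_n) r, 0 <= r ->
  m [set z : 'rV[R]_n | `|z - c| <= r] = ((2 * r) ^+ n)%:E.
Hypothesis m_int : forall f : 'rV[R]_n -> \bar R,
  measurable_fun setT (f : borel 'rV[R]_n -> \bar R) ->
  (forall z, 0 <= f z)%E -> iintegral f = (\int[m]_z f z)%E.
Hypothesis m_derive : forall (g : 'rV[R]_n -> R) i (r : R),
  (forall z, derivable g z (evec i)) -> continuous ('D_(evec i) g) ->
  (forall z, r <= `|z| -> g z = 0) -> (\int[m]_z ('D_(evec i) g z)%:E)%E = 0%E.
Implicit Types (a b : chart A) (x : 'rV[R]_n) (u v : M -> R) (W K : set M) (p : M).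

Let mu_fin K : compact K -> (mu K < +oo)%E := @mu_compact R n M A hM mu s m m_ball m_int K.

Lemma du_continuous W a u x : open W -> Ck_fun A 1 W u -> (phi a @` (dom a `&` W)) x ->
  {for x, continuous (du a u)}.
Proof.
move=> oW Cu Ox; apply: (cvg_row (FG := nbhs_filter x)) => i.
have /Ck_onS[_ _ /(_ (evec i)) /Ck_on0 c] := Cu a.
rewrite mxE; under eq_cvg do rewrite mxE.
exact: c.
Qed.

Lemma du_off_compact a K v p : compact K -> (forall q, ~ K q -> v q = 0) -> ~ K p -> dom a p ->
  du a v (phi a p) = 0.
Proof.
move=> cK v0 Kp ap; apply/rowP => i; rewrite !mxE.
have oK : open (~` K) by apply: closed_openC; exact: compact_closed.
rewrite (@near_eq_derive _ _ _ _ (cst 0)) ?derive_cst //.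
have := open_nbhs_nbhs (conj (open_chart_image (a:=a) oK) (ex_intro2 _ _ p (conj ap Kp) erefl)).
by apply: filterS => x; rewrite chart_imageE => -[_ /= /v0].
Qed.

Section density_field.
Variables (a : chart A) (W : set M) (X : 'rV[R]_n -> 'rV[R]_n).
Hypotheses (oW : open W) (CX : Ck_on 1 (phi a @` (dom a `&` W)) X).

Let O := phi a @` (dom a `&` W).

Let oO : open O. Proof. exact: open_chart_image. Qed.

Lemma density_field_C1 i : Ck_on 1 O (fun z => sigma s a z * X z 0 i).
Proof.
apply: (Ck_onM oO); last exact: (Ck_on_coord i oO CX).
exact: (Ck_on_sub (@chart_image_cod _ _ _ _ _ _) (@sigma_smooth _ _ _ _ _ s a 1)).
Qed.

Lemma div_loc_continuous x : O x -> {for x, continuous (div_loc s a X)}.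
Proof.
move=> Ox; have cx : cod a x := chart_image_cod Ox.
have cs := sigma_continuous (s := s) cx.
have s0 : sigma s a x != 0 by rewrite gt_eqF // sigma_gt0.
have ci : (sigma s a z)^-1 @[z --> x] --> (sigma s a x)^-1 by exact: (cvgV s0 cs).
have cd : \sum_i 'D_(evec i) (fun z => sigma s a z * X z 0 i) z @[z --> x] -->
    \sum_i 'D_(evec i) (fun z => sigma s a z * X z 0 i) x.
  apply: (cvg_sumr (FG := nbhs_filter x)) => i.
  have /Ck_onS[_ _ /(_ (evec i)) /Ck_on0 c] := density_field_C1 i.
  exact: c.
exact: (cvgM ci cd).
Qed.

End density_field.

Section by_parts.
Variables (a : chart A) (W K : set M) (v : M -> R) (X : 'rV[R]_n -> 'rV[R]_n) (Y : M -> R).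
Hypotheses (oW : open W) (cK : compact K) (KW : K `<=` W `&` dom a).
Hypotheses (v0 : forall p, ~ K p -> v p = 0) (Cv : Ck_fun A 1 setT v).
Hypothesis CX : Ck_on 1 (phi a @` (dom a `&` W)) X.
Hypothesis YE : forall p, dom a p -> Y p = dot (du a v (phi a p)) (X (phi a p)).
Hypothesis Y0 : forall p, ~ K p -> Y p = 0.

Let O := phi a @` (dom a `&` W).
Let oO : open O. Proof. exact: open_chart_image. Qed.
Let G i x := sigma s a x * X x 0 i.
(** The components of [v sigma X] extended by zero to the whole coordinate space, on which the
    integrals of derivatives vanish. *)
Let g i x := if x \in O then v (psi a x) * G i x else 0.
Let K' := phi a @` K.

Let cK' : compact K'.
Proof.
apply: continuous_compact cK; apply: continuous_in_subspaceT => p /set_mem /KW[_ ap].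
exact: phi_continuous.
Qed.

Let g0 i x : ~ K' x -> g i x = 0.
Proof.
move=> Kx; rewrite /g; case: ifPn => // /set_mem Ox.
rewrite v0 ?mul0r // => Kp; apply: Kx; exists (psi a x) => //.
exact/psiK/chart_image_cod/Ox.
Qed.

Let oK' : open (~` K').
Proof. by apply: closed_openC; exact: compact_closed. Qed.

Let CvO : Ck_on 1 O (v \o psi a).
Proof. by apply: (Ck_on_sub _ (Cv a)) => _ [p [ap Wp] <-]; exists p. Qed.

Let g_C1 i : Ck_on 1 setT (g i).
Proof.
have C1 : Ck_on 1 O (g i).
  apply: (eq_Ck_on oO _ (Ck_onM oO CvO (density_field_C1 oW CX i))) => x Ox.
  by rewrite /g mem_set.
have C2 : Ck_on 1 (~` K') (g i).
  by apply: (eq_Ck_on oK' _ (@Ck_on_cst _ _ _ 1 (~` K') 0)) => x Kx; rewrite g0.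
have <- : O `|` ~` K' = setT.
  apply/seteqP; split=> // x _; have [|] := pselect (K' x); last by right.
  by move=> [p /KW[Wp ap] <-]; left; exists p.
exact: Ck_onU.
Qed.

Let derive_g i x : O x -> 'D_(evec i) (g i) x =
  'D_(evec i) (v \o psi a) x * G i x + v (psi a x) * 'D_(evec i) (G i) x.
Proof.
move=> Ox; rewrite (@near_eq_derive _ _ _ (g i) ((v \o psi a) * G i)); last first.
  have := open_nbhs_nbhs (conj oO Ox); apply: filterS => z Oz.
  by rewrite /g mem_set.
have /Ck_onS[_ dv _] := CvO; have /Ck_onS[_ dG _] := density_field_C1 oW CX i.
rewrite (deriveM (dv _ _ Ox) (dG _ _ Ox)).
exact: (etrans (addrC _ _) (f_equal2 +%R (mulrC _ _) erefl)).
Qed.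

Let derive_g0 i x : ~ K' x -> 'D_(evec i) (g i) x = 0.
Proof.
move=> Kx; rewrite (@near_eq_derive _ _ _ (g i) (cst 0)) ?derive_cst //.
by have := open_nbhs_nbhs (conj oK' Kx); apply: filterS => z /g0.
Qed.

Let m_fin (t : R) : (m [set z : 'rV[R]_n | (`|z| <= t)%R] < +oo)%E.
Proof.
pose B := [set z : 'rV[R]_n | `|z - 0| <= `|t|].
have mB : closed B by apply: compact_closed => //; exact: closed_ball_compact.
have mC : closed [set z : 'rV[R]_n | `|z| <= t].
  apply: (@closed_comp _ _ (fun z : 'rV[R]_n => `|z|) [set s | s <= t]).
    by move=> z _; exact: norm_continuous.
  exact: closed_le.
apply: (@le_lt_trans _ _ (m B)); last by rewrite /B m_ball // ltry.
apply: le_measure; rewrite ?inE; [exact: closed_borel_measurable mC|exact: closed_borel_measurable mB|].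
by move=> z /= zt; rewrite /B /= subr0; apply: le_trans zt (ler_norm _).
Qed.

Let integral_div_g : (\int[m]_x (\sum_i 'D_(evec i) (g i) x)%:E)%E = 0%E.
Proof.
have [N [Nreal hN]] := compact_bounded cK'.
have far x : ~ (`|x| <= N + 1) -> ~ K' x by move=> h Kx; apply: h; apply: (hN (N + 1) _ x Kx); rewrite ltrDl.
have ig i : m.-integrable setT (EFin \o ('D_(evec i) (g i) : borel 'rV[R]_n -> R)).
  apply: (compact_support_integrable (r := N + 1)) => // [x|x].
    by have /Ck_onS[_ _ /(_ (evec i)) /Ck_on0 c] := g_C1 i; exact: c.
  by move=> Nx; apply/derive_g0/far; apply/negP; rewrite -ltNge.
under eq_integral do rewrite -sumEFin.
rewrite integral_sum // big1 // => i _.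
(* [K'] lies in the closed ball of radius [N + 1], and vanishing is required up to and including the
   radius given. *)
apply: (m_derive (r := N + 2)) => [z||z Nz].
- by have /Ck_onS[_ d _] := g_C1 i; exact: d.
- by move=> x; have /Ck_onS[_ _ /(_ (evec i)) /Ck_on0 c] := g_C1 i; exact: c.
- by apply/g0/far; apply/negP; rewrite -ltNge; lra.
Qed.

Let vdiv p := v p * div_loc s a X (phi a p).

Let cvdiv : continuous vdiv.
Proof.
apply: (continuous_off_compact hM (O := W `&` dom a) _ KW cK).
- by apply: openI => //; exact: open_dom.
- move=> p [Wp ap]; have Op : O (phi a p) by exists p.
  apply: (continuous_chart ap (g := fun x => v (psi a x) * div_loc s a X x)).
    by apply: filterS (chart_near ap) => q aq; rewrite phiK.
  exact: (cvgM (Ck_on_continuous CvO Op) (div_loc_continuous oW CX Op)).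
- by move=> p Kp; rewrite /vdiv v0 // mul0r.
Qed.

Let cY : continuous Y.
Proof.
apply: (continuous_off_compact hM (O := W `&` dom a) _ KW cK) => //.
- by apply: openI => //; exact: open_dom.
- move=> p [Wp ap]; have Op : O (phi a p) by exists p.
  apply: (continuous_chart ap (g := fun x => dot (du a v x) (X x))).
    by apply: filterS (chart_near ap) => q aq; exact: YE.
  have OT : (phi a @` (dom a `&` setT)) (phi a p) by exists p.
  exact: (cvg_dot (FG := nbhs_filter (phi a p)) (du_continuous openT Cv OT) (Ck_on_continuous CX Op)).
Qed.

(** The partial derivatives of [g] add up to [sigma] times [v div X + Dv(X)], and their integral is
    zero. [Y] is kept abstract because it is later a density expressed in the varying charts
    [chart_at]. *)
Lemma integral_by_parts :
  [/\ mu.-integrable setT (EFin \o ((fun p => v p * div_loc s a X (phi a p)) : borel M -> R)),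
      mu.-integrable setT (EFin \o (Y : borel M -> R)) &
      \int[mu]_(p in [set: borel M]) (v p * div_loc s a X (phi a p)) =
      - \int[mu]_(p in [set: borel M]) Y p].
Proof.
have vd0 p : ~ K p -> vdiv p = 0 by move=> Kp; rewrite /vdiv v0 // mul0r.
have ivd := integrable_compact_support hM mu_fin cK cvdiv vd0.
have iY := integrable_compact_support hM mu_fin cK cY Y0.
split; [exact: ivd|exact: iY|].
apply/eqP; rewrite -subr_eq0 opprK -(RintegralD _ ivd iY) //; apply/eqP.
rewrite /Rintegral -[RHS]/(fine 0%E); congr fine.
have -> : (\int[mu]_p (vdiv p + Y p)%:E = \int[mu]_(p in (dom a : set (borel M))) (vdiv p + Y p)%:E)%E.
  rewrite [RHS]integral_mkcond; apply: eq_integral => p _; rewrite patchE.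
  case: ifPn => // /negP ap; have Kp : ~ K p by move=> /KW[_ ?]; apply: ap; rewrite inE.
  by rewrite vd0 // Y0 // addr0.
have cvY : continuous (fun p => vdiv p + Y p).
  by move=> p; have cp : {for p, continuous vdiv} := @cvdiv p; exact: (cvgD cp (@cY p)).
rewrite (integral_chart s m_int (h := fun p => vdiv p + Y p)); last first.
  apply: (@measurable_funTS _ _ _ _ (dom a : set (borel M))).
  apply: (@continuous_on_measurable R M setT) => [|p _]; [exact: openT|exact: cvY].
rewrite -integral_div_g [LHS]integral_mkcond; apply: eq_integral => x _; rewrite patchE.
have [Ox|Ox] := pselect (O x); last first.
  have K'x : ~ K' x by move=> [p /KW[Wp ap] e]; apply: Ox; exists p.
  rewrite big1; last by move=> i _; exact: derive_g0.
  case: ifPn => // /set_mem cx; have Kp : ~ K (psi a x).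
    by move=> /KW[Wp ap]; apply: Ox; exists (psi a x); [split|exact: psiK].
  by rewrite vd0 // Y0 // addr0 mul0r.
have cx := chart_image_cod Ox; rewrite mem_set //; congr EFin.
rewrite /vdiv YE; last exact: psi_dom.
have alg (c w S T : R) : 0 < c -> (w * (c^-1 * S) + T) * c = T * c + w * S.
  by move=> c0; field; rewrite gt_eqF.
rewrite psiK // /div_loc alg ?sigma_gt0 //.
rewrite /dot mulr_suml mulr_sumr -big_split; apply: eq_bigr => i _.
rewrite derive_g // mxE; congr (_ + _).
by rewrite /G -mulrA [X in _ * X]mulrC.
Qed.

End by_parts.

(** Where [d] is positive, a bump supported in the positivity set would make the integral positive;
    the same argument for [- d] gives the other sign. *)
Lemma variational_zero (O : set M) (d : M -> R) : open O -> (forall p, O p -> {for p, continuous d}) ->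
  (forall v K, test_function A v -> compact K -> K `<=` O -> (forall q, ~ K q -> v q = 0) ->
     \int[mu]_(p in [set: borel M]) (v p * d p) = 0) ->
  forall p, O p -> d p = 0.
Proof.
move=> oO; have key (e : M -> R) p : (forall p, O p -> {for p, continuous e}) ->
    (forall v K, test_function A v -> compact K -> K `<=` O -> (forall q, ~ K q -> v q = 0) ->
    \int[mu]_(p in [set: borel M]) (v p * e p) = 0) -> O p -> e p <= 0.
  move=> ce e0 Op; rewrite leNgt; apply/negP => ep.
  have oU : open (O `&` e @^-1` [set t | 0 < t]).
    by apply: preimage_open_on => //; exact: open_gt.
  have [v [K [tv v0 vp cK [KU vK]]]] := bump_ex hM oU (conj Op ep) (dom_chart_at A p).
  have KO : K `<=` O by move=> q /KU[[]].
  have h0 q : ~ K q -> v q * e q = 0 by move=> /vK ->; rewrite mul0r.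
  have ch : continuous (fun q => v q * e q).
    apply: (continuous_off_compact hM oO KO cK _ h0) => q Oq.
    have cv : {for q, continuous v} by apply: (Ck_fun_continuous openT (tv.1 0%N)).
    exact: (cvgM cv (ce q Oq)).
  have h_ge0 q : 0 <= v q * e q.
    have [/KU[[_ /ltW eq0] _]|/h0 ->//] := pselect (K q).
    by rewrite mulr_ge0.
  have := integral_gt0 s m_ball m_int ch h_ge0 (integrable_compact_support hM mu_fin cK ch h0) (mulr_gt0 vp ep).
  by rewrite (e0 v K) // ltxx.
move=> cd d0 p Op; apply/eqP; rewrite eq_le (key d) //=.
rewrite -oppr_le0; apply: (key (fun q => - d q)) => // [q Oq|v K tv cK KO vK].
  exact: (cvgN (cd q Oq)).
under eq_Rintegral do rewrite mulrN.
have ch : continuous (fun q => v q * d q).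
  apply: (continuous_off_compact hM oO KO cK) => [q Oq|q /vK ->]; last by rewrite mul0r.
  have cv : {for q, continuous v} by apply: (Ck_fun_continuous openT (tv.1 0%N)).
  exact: (cvgM cv (cd q Oq)).
have h0 q : ~ K q -> v q * d q = 0 by move=> /vK ->; rewrite mul0r.
have -> : \int[mu]_(p in [set: borel M]) (- (v p * d p)) = - \int[mu]_(p in [set: borel M]) (v p * d p).
  under eq_Rintegral do rewrite -mulN1r.
  rewrite RintegralZl ?mulN1r //.
  exact: (integrable_compact_support hM mu_fin cK ch h0).
by rewrite (d0 v K) // oppr0.
Qed.

End Divergence.

(** * The first variation *)

Section FirstVariation.
Context {R : realType} {n : nat} {M : ptopologicalType}.
Variable A : smooth_atlas R n M.
Hypothesis hM : hausdorff_space M.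
Variable F : finsler_metric A.
Implicit Types (a b : chart A) (x : 'rV[R]_n) (u v : M -> R) (W K : set M) (p : M).

Definition energy_density u p : R := calV F (chart_at A p) u (phi (chart_at A p) p).

Definition variation_density u v p : R :=
  let a := chart_at A p in let x := phi a p in
  calV F a u x * dot (du a v x) (grad F a u x).

Section local_continuity.
Variables (W : set M) (u : M -> R) (a : chart A) (x : 'rV[R]_n).
Hypotheses (oW : open W) (Cu : Ck_fun A 1 W u) (Ox : (phi a @` (dom a `&` W)) x).

Let cx : cod a x. Proof. exact: chart_image_cod Ox. Qed.

Lemma calV_continuous : {for x, continuous (calV F a u)}.
Proof.
have cdu : du a u z @[z --> x] --> du a u x by exact: (du_continuous oW Cu Ox).
have c : Fstar F a z (du a u z) ^+ 2 @[z --> x] --> Fstar F a x (du a u x) ^+ 2.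
  exact: (@cvg_dual_norm2 R n (cod a) (Fin F a) (@open_cod _ _ _ A a) (@Fin_ge0 _ _ _ _ F a) (@Fin_homogeneous _ _ _ _ F a)
    (@Fin_smooth _ _ _ _ F a) (@Fin_convex _ _ _ _ F a) _ _ (nbhs_filter x) id _ _ _ cx cvg_id cdu).
have c2 : 2^-1 * Fstar F a z (du a u z) ^+ 2 @[z --> x] --> 2^-1 * Fstar F a x (du a u x) ^+ 2.
  exact: (cvgM (cvg_cst (2^-1 : R)) c).
exact: (cvg_comp _ _ c2 (@continuous_expR R _)).
Qed.

End local_continuity.

Lemma variation_densityE W u v a p : open W -> Ck_fun A 1 W u -> Ck_fun A 1 W v ->
  W p -> dom a p ->
  variation_density u v p = dot (du a v (phi a p)) (flux F a u (phi a p)).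
Proof.
move=> oW Cu Cv Wp ap; rewrite /variation_density /= /flux dotZr.
rewrite (calV_compat F (dom_chart_at A p) ap oW Cu Wp).
by rewrite (pairing_compat F (dom_chart_at A p) ap oW Cu Wp Cv).
Qed.

Section densities.
Variables (u v : M -> R).
Hypotheses (Cu : Ck_fun A 1 setT u) (Cv : Ck_fun A 1 setT v).

Lemma energy_densityE a p : dom a p -> energy_density u p = calV F a u (phi a p).
Proof. by move=> ap; exact: (calV_compat F (dom_chart_at A p) ap openT Cu I). Qed.

Lemma energy_density_continuous : continuous (energy_density u).
Proof.
move=> p; have ap := dom_chart_at A p; set a := chart_at A p in ap.
apply: (continuous_chart ap (g := calV F a u)).
  by apply: filterS (chart_near ap) => q; exact: energy_densityE.
by apply: (calV_continuous openT Cu); exists p.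
Qed.

Lemma variation_density_off_compact K : compact K -> (forall q, ~ K q -> v q = 0) ->
  forall p, ~ K p -> variation_density u v p = 0.
Proof.
move=> cK v0 p Kp; rewrite /variation_density /=.
by rewrite (du_off_compact hM cK v0 Kp (dom_chart_at A p)) dot0l mulr0.
Qed.

End densities.

Section line.
Variables (u v : M -> R).
Hypotheses (Cu : Ck_fun A 1 setT u) (Cv : Ck_fun A 1 setT v).

Lemma du_line a p (t : R) : dom a p ->
  du a (fun q => u q + t * v q) (phi a p) = du a u (phi a p) + t *: du a v (phi a p).
Proof.
move=> ap; apply/rowP => i; rewrite !mxE.
have Op : (phi a @` (dom a `&` setT)) (phi a p) by exists p.
have /Ck_onS[_ dU _] := Cu a; have /Ck_onS[_ dV _] := Cv a.
have h := is_deriveD (derivableP (dU _ (evec i) Op)) (is_deriveZ t (derivableP (dV _ (evec i) Op))).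
by have [_ ->] := h.
Qed.

Lemma Ck_fun_line (t : R) : Ck_fun A 1 setT (fun q => u q + t * v q).
Proof.
move=> a; have oO := open_chart_image (a:=a) (@openT M).
exact: (Ck_onD oO (Cu a) (Ck_onZ t oO (Cv a))).
Qed.

Lemma energy_density_line p (t : R) : let a := chart_at A p in let x := phi a p in
  energy_density (fun q => u q + t * v q) p =
  expR (2^-1 * dual_norm (Fin F a x) (du a u x + t *: du a v x) ^+ 2).
Proof. by move=> a x; rewrite /energy_density /calV du_line //; exact: dom_chart_at. Qed.

Let rate p (t : R) := let a := chart_at A p in let x := phi a p in
  energy_density (fun q => u q + t * v q) p *
  dot (du a v x) (legendre_transform (Fin F a x) (du a u x + t *: du a v x)).

Let cod_at p : cod (chart_at A p) (phi (chart_at A p) p).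
Proof. exact/cod_phi/dom_chart_at. Qed.

Let rate0 p : rate p 0 = variation_density u v p.
Proof.
by rewrite /rate /= energy_density_line scale0r addr0.
Qed.

Let is_derive_energy_density p (t : R) :
  is_derive t 1 (fun t => energy_density (fun q => u q + t * v q) p) (rate p t).
Proof.
have d := @is_derive_half_dual_line R n (cod (chart_at A p)) (Fin F (chart_at A p))
  (@open_cod _ _ _ A _) (@Fin_ge0 _ _ _ _ F _) (@Fin_homogeneous _ _ _ _ F _) (@Fin_smooth _ _ _ _ F _) (@Fin_convex _ _ _ _ F _) _
  (du (chart_at A p) u (phi (chart_at A p) p)) (du (chart_at A p) v (phi (chart_at A p) p)) t (cod_at p).
have := is_derive_outer (is_derive_expR _) d.
rewrite /rate energy_density_line.
rewrite (_ : (fun t0 : R => energy_density _ p) = expR \o (fun t0 => 2^-1 * dual_norm (Fin F (chart_at A p) (phi (chart_at A p) p))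
  (du (chart_at A p) u (phi (chart_at A p) p) + t0 *: du (chart_at A p) v (phi (chart_at A p) p)) ^+ 2)) //.
by apply/funext => t0; rewrite energy_density_line.
Qed.

(** The graph lies above its tangent: the Legendre vector at [t] is tested against the covector at
    [t'], then [exp a >= 1 + a] is applied. *)
Let energy_density_tangent p (t t' : R) :
  energy_density (fun q => u q + t * v q) p + (t' - t) * rate p t <=
  energy_density (fun q => u q + t' * v q) p.
Proof.
rewrite /rate !energy_density_line.
set a := chart_at A p; set x := phi a p; set xi := du a u x; set eta := du a v x.
have mf := Fin_minkowski F (cod_at p).
set y := legendre_transform _ _; set H := 2^-1 * dual_norm _ (xi + t *: eta) ^+ 2.
have low : H + (t' - t) * dot eta y <= 2^-1 * dual_norm (Fin F a x) (xi + t' *: eta) ^+ 2.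
  have := legendre_max_le mf (xi + t' *: eta) y.
  have := legendre_max_eq mf (xi + t *: eta).
  rewrite -/y -/H !dotDl !dotZl; lra.
apply: (@le_trans _ _ (expR (H + (t' - t) * dot eta y))); last by rewrite ler_expR.
rewrite expRD; have := expR_ge1Dx ((t' - t) * dot eta y).
have := expR_gt0 H; set e := expR H; set z := expR _ => e0 h.
rewrite (_ : _ + _ = e * (1 + (t' - t) * dot eta y)); last by ring.
by rewrite ler_pM2l.
Qed.

(* The energy density is convex in t, so its values at -2 and 2 bound its slopes
   on ]-1, 1[; this dominates the difference quotients. *)
Let rate_bound p (t : R) : -1 < t < 1 ->
  `|rate p t| <= energy_density (fun q => u q + 2 * v q) p +
                 energy_density (fun q => u q + (- 2) * v q) p.
Proof.
move=> /andP[t1 t2].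
have := energy_density_tangent p t 2; have := energy_density_tangent p t (-2).
have h1 : 0 <= energy_density (fun q => u q + t * v q) p by exact: expR_ge0.
have h2 : 0 <= energy_density (fun q => u q + 2 * v q) p by exact: expR_ge0.
have h3 : 0 <= energy_density (fun q => u q + (- 2) * v q) p by exact: expR_ge0.
move: (rate p t) (energy_density _ p) (energy_density _ p) (energy_density _ p) h1 h2 h3 => r e e2 e3 *.
by rewrite ler_norml; apply/andP; split; nra.
Qed.

Section integrals.
Variable mu : {measure set (borel M) -> \bar R}.
Hypothesis mu_fin : forall K, compact K -> (mu K < +oo)%E.
Variable K : set M.
Hypotheses (cK : compact K) (v0 : forall q, ~ K q -> v q = 0).

Let mK : measurable (K : set (borel M)). Proof. exact: compact_borel. Qed.

Let e_integrable (t : R) : mu.-integrable (K : set (borel M))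
  (EFin \o (energy_density (fun q => u q + t * v q) : borel M -> R)).
Proof.
apply: (integrable_compact hM mu_fin cK).
exact: (energy_density_continuous (@Ck_fun_line t)).
Qed.

(** Differentiation under the integral for [t] in []-1, 1[], dominated by the densities at [2] and
    [-2], which are continuous and hence integrable on [K]. *)
Lemma is_derive_energy_compact :
  is_derive (0 : R) (1 : R) (fun t => \int[mu]_(p in (K : set (borel M)))
     energy_density (fun q => u q + t * v q) p)
    (\int[mu]_(p in [set: borel M]) variation_density u v p).
Proof.
pose f (t : R) (p : borel M) := energy_density (fun q => u q + t * v q) p.
have der (t : R) p : is_derive t 1 (f ^~ p) (rate p t) by exact: is_derive_energy_density.
have dE (t : R) p : partial1of2 f t p = rate p t.
  by rewrite partial1of2E; have [_ ->] := der t p.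
pose G (p : borel M) := f 2 p + f (-2) p.
have c : h^-1 *: ((\int[mu]_(p in (K : set (borel M))) f (h + 0) p) -
     (\int[mu]_(p in (K : set (borel M))) f 0 p)) @[h --> (0 : R)^'] -->
     \int[mu]_(p in (K : set (borel M))) partial1of2 f 0 p.
  apply: (@cvg_differentiation_under_integral R _ (borel M) mu f K mK 0 (-1) 1 _ _ _ G).
  - by rewrite /= in_itv /=; apply/andP; split; lra.
  - by move=> t _; exact: e_integrable.
  - by move=> t p _ _; have [] := der t p.
  - by move=> p; rewrite addr_ge0 // expR_ge0.
  - exact: (integrableD mK (@e_integrable 2) (@e_integrable (-2))).
  - by move=> t p; rewrite /= in_itv /= dE => t1 _; exact: rate_bound.
have -> : \int[mu]_(p in [set: borel M]) variation_density u v p =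
    \int[mu]_(p in (K : set (borel M))) partial1of2 f 0 p.
  rewrite [RHS]Rintegral_mkcond; apply: eq_Rintegral => p _; rewrite patchE.
  case: ifPn => [_|/negP Kp]; first by rewrite dE rate0.
  by rewrite (variation_density_off_compact _ cK v0) // => h; apply: Kp; rewrite inE.
have e : (fun h : R => h^-1 *: (((fun t => \int[mu]_(p in (K : set (borel M))) f t p) \o shift 0) (h *: 1) -
     (\int[mu]_(p in (K : set (borel M))) f 0 p))) =
  fun h => h^-1 *: ((\int[mu]_(p in (K : set (borel M))) f (h + 0) p) -
     (\int[mu]_(p in (K : set (borel M))) f 0 p)).
  by apply/funext => h /=; rewrite [h *: 1]mulr1.
apply: DeriveDef; first by apply/cvg_ex; eexists; rewrite e; exact: c.
by rewrite /derive e; exact: cvg_lim c.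
Qed.

Variables (D : set M).
Hypotheses (oD : open D) (KD : K `<=` D) (D_fin : (energy F mu D u < +oo)%E).

Let mD : measurable (D : set (borel M)). Proof. exact: open_borel_measurable. Qed.

Let mdens (w : M -> R) : Ck_fun A 1 setT w ->
  measurable_fun [set: borel M] (EFin \o (energy_density w : borel M -> R)).
Proof.
move=> Cw; apply/measurable_EFinP.
apply: (@continuous_on_measurable R M setT) => [|p _]; first exact: openT.
exact: energy_density_continuous.
Qed.

Let energyE (B : set M) w : energy F mu B w =
  (\int[mu]_(p in (B : set (borel M))) (energy_density w p)%:E)%E.
Proof. reflexivity. Qed.

(** Off [K] the differential of [v] vanishes, so there the density does not depend on [t]; only the
    compact part of the energy varies, whatever the size of [D]. *)
Let energy_split (t : R) : (energy F mu D (fun p => u p + t * v p)%R =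
  \int[mu]_(p in (D `\` K : set (borel M))) (energy_density u p)%:E +
  \int[mu]_(p in (K : set (borel M))) (energy_density (fun p => (u p + t * v p)%R) p)%:E)%E.
Proof.
have mDK : measurable (D `\` K : set (borel M)) by exact: measurableD.
rewrite -[in LHS](setDUK KD) energyE setUC ge0_integral_setU.
- apply: (f_equal2 adde); last reflexivity.
  apply: eq_integral => p /set_mem[_ Kp].
  have e : energy_density (fun q => u q + t * v q) p = energy_density u p.
    rewrite energy_density_line (du_off_compact hM cK v0 Kp (dom_chart_at A p)) scaler0 addr0.
    reflexivity.
  exact (f_equal EFin e).
- exact: mDK.
- exact: mK.
- by apply: measurable_funTS; apply: mdens; exact: Ck_fun_line.
- by move=> p _; rewrite lee_fin expR_ge0.
- by apply/disj_setPS => p [[]].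
Qed.

Let rest_fin : (\int[mu]_(p in (D `\` K : set (borel M))) (energy_density u p)%:E < +oo)%E.
Proof.
apply: le_lt_trans D_fin; apply: ge0_subset_integral => //.
- exact: measurableD.
- by apply: measurable_funTS; exact: mdens.
- by move=> p _; rewrite lee_fin expR_ge0.
Qed.

Lemma energy_line_fin (t : R) : (energy F mu D (fun p => u p + t * v p)%R < +oo)%E.
Proof.
rewrite energy_split; apply: lte_add_pinfty; first exact: rest_fin.
have := integrable_fin_num mK (e_integrable t).
rewrite fin_numElt => /andP[_ h]; exact: h.
Qed.

Lemma is_derive_energy_along : is_derive (0 : R) (1 : R) (energy_along F mu u v D)
  (\int[mu]_(p in [set: borel M]) variation_density u v p).
Proof.
have -> : energy_along F mu u v D = cst (fine (\int[mu]_(p in (D `\` K : set (borel M))) (energy_density u p)%:E)%E)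
   + (fun t => \int[mu]_(p in (K : set (borel M))) energy_density (fun q => u q + t * v q) p).
  apply/funext => t; rewrite /energy_along energy_split fineD; [reflexivity| |].
  - rewrite ge0_fin_numE; first exact: rest_fin.
    by apply: integral_ge0 => p _; rewrite lee_fin expR_ge0.
  - exact: (integrable_fin_num mK (e_integrable t)).
rewrite -[X in is_derive _ _ _ X]add0r.
exact: (is_deriveD (is_derive_cst _ _ _) is_derive_energy_compact).
Qed.

End integrals.
End line.
End FirstVariation.

(** * The divergence of the flux *)

Section FluxDivergence.
Context {R : realType} {n : nat} {M : ptopologicalType}.
Variable A : smooth_atlas R n M.
Hypothesis hM : hausdorff_space M.
Variable F : finsler_metric A.
Variables (mu : {measure set (borel M) -> \bar R}) (s : smooth_density A mu).
Variable m : {sigma_finite_measure set (borel 'rV[R]_n) -> \bar R}.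
Hypothesis m_ball : forall (c : 'rV[R]_n) r, 0 <= r ->
  m [set z : 'rV[R]_n | `|z - c| <= r] = ((2 * r) ^+ n)%:E.
Hypothesis m_int : forall f : 'rV[R]_n -> \bar R,
  measurable_fun setT (f : borel 'rV[R]_n -> \bar R) ->
  (forall z, 0 <= f z)%E -> iintegral f = (\int[m]_z f z)%E.
Hypothesis m_derive : forall (g : 'rV[R]_n -> R) i (r : R),
  (forall z, derivable g z (evec i)) -> continuous ('D_(evec i) g) ->
  (forall z, r <= `|z| -> g z = 0) -> (\int[m]_z ('D_(evec i) g z)%:E)%E = 0%E.
Implicit Types (a b : chart A) (x : 'rV[R]_n) (u v : M -> R) (K : set M) (p : M).

Let mu_fin K : compact K -> (mu K < +oo)%E := @mu_compact R n M A hM mu s m m_ball m_int K.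

Section domain.
Variables (W : set M) (u : M -> R).
Hypotheses (oW : open W) (Cu : Ck_fun A 1 W u) (Cflux : flux_C1 F W u).

(** Integrability is part of the identity, since such identities are added and subtracted and the
    real integral is additive on integrable functions. *)
Definition green_identity (d : M -> R) v :=
  [/\ mu.-integrable setT (EFin \o ((fun p => v p * d p) : borel M -> R)),
      mu.-integrable setT (EFin \o (variation_density F u v : borel M -> R)) &
      \int[mu]_(p in [set: borel M]) (v p * d p) =
      - \int[mu]_(p in [set: borel M]) variation_density F u v p].

Lemma flux_by_parts a K v : compact K -> K `<=` W `&` dom a ->
  (forall p, ~ K p -> v p = 0) -> Ck_fun A 1 setT v ->
  green_identity (fun p => div_loc s a (flux F a u) (phi a p)) v.
Proof.
move=> cK KW v0 Cv.
apply: (integral_by_parts hM s m_ball m_int m_derive oW cK KW v0 Cv (Cflux a)) => [p ap|].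
  have [Kp|Kp] := pselect (K p).
    have [Wp _] := KW p Kp.
    exact: (variation_densityE F oW Cu (Ck_fun_sub (@subsetT _ W) Cv) Wp ap).
  rewrite (variation_density_off_compact hM F u cK v0 Kp).
  by rewrite (du_off_compact hM cK v0 Kp ap) dot0l.
exact: variation_density_off_compact.
Qed.

Let cdiv a p : W p -> dom a p -> {for p, continuous (fun q => div_loc s a (flux F a u) (phi a q))}.
Proof.
move=> Wp ap; have Op : (phi a @` (dom a `&` W)) (phi a p) by exists p.
apply: (continuous_chart ap (g := div_loc s a (flux F a u))); first exact: filterE.
exact: (@div_loc_continuous R n M A mu s a W (flux F a u) oW (Cflux a) _ Op).
Qed.

(* Both sides represent the same weak divergence, so they agree. *)
Lemma div_flux_chart a b p : W p -> dom a p -> dom b p ->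
  div_loc s a (flux F a u) (phi a p) = div_loc s b (flux F b u) (phi b p).
Proof.
move=> Wp ap bp; apply/eqP; rewrite -subr_eq0; apply/eqP.
pose d q := div_loc s a (flux F a u) (phi a q) - div_loc s b (flux F b u) (phi b q).
pose O := W `&` (dom a `&` dom b).
have oO : open O by apply: openI => //; apply: openI; exact: open_dom.
apply: (variational_zero hM s m_ball m_int (O := O) (d := d) oO) => //.
  move=> q [Wq [aq bq]]; exact: (cvgB (cdiv Wq aq) (cdiv Wq bq)).
move=> v K [tv _] cK KO v0.
have Ka : K `<=` W `&` dom a by move=> q /KO[Wq []].
have Kb : K `<=` W `&` dom b by move=> q /KO[Wq []].
have [ia _ ea] := flux_by_parts cK Ka v0 (tv 1%N).
have [ib _ eb] := flux_by_parts cK Kb v0 (tv 1%N).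
have e := etrans (RintegralB measurableT ia ib) (f_equal2 (fun x y : R => x - y) ea eb).
apply: etrans (etrans e (subrr _)).
by apply: eq_Rintegral => q _; rewrite /d mulrBr.
Qed.

(** [chart_at] may jump from point to point; independence of the chart lets a single chart describe
    [tDelta] on its whole domain, whence its continuity. *)
Lemma tDelta_chart a p : W p -> dom a p ->
  tDelta F s u p = div_loc s a (flux F a u) (phi a p).
Proof. by move=> Wp ap; exact: (div_flux_chart Wp (dom_chart_at A p) ap). Qed.

Lemma tDelta_continuous p : W p -> {for p, continuous (tDelta F s u)}.
Proof.
move=> Wp; have ap := dom_chart_at A p; set a := chart_at A p in ap.
apply: (continuous_chart ap (g := div_loc s a (flux F a u))).
  have := open_nbhs_nbhs (conj oW Wp); have := chart_near ap.
  by apply: filterS2 => q aq Wq; exact: tDelta_chart.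
by apply: (@div_loc_continuous R n M A mu s a W (flux F a u) oW (Cflux a)); exists p.
Qed.

(** Inverting the Legendre relation gives [grad u = Du *m g^-1], and symmetry of the inverse turns
    this into [g^{ij} u_j]. *)
Lemma tDeltaE a p : W p -> dom a p -> tDelta F s u p = tDelta_coord F s a u (phi a p).
Proof.
move=> Wp ap; rewrite (tDelta_chart Wp ap) /div_loc /tDelta_coord; congr (_ * _).
apply: eq_bigr => i _; apply: near_eq_derive.
have Op : (phi a @` (dom a `&` W)) (phi a p) by exists p.
have := open_nbhs_nbhs (conj (open_chart_image (a:=a) oW) Op).
apply: filterS => z /chart_image_cod cz; rewrite /flux /calV mxE -mulrA; congr (_ * (_ * _)).
(* Where [Du = 0] the matrix is evaluated at [y = 0], off the slit bundle, but the factor [u_j]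
   annihilates it. *)
have [xi0|xi0] := eqVneq (du a u z) 0.
  rewrite xi0 /grad xi0 /legendre eqxx mxE big1 // => j _.
  by rewrite mxE mulr0.
have mf := Fin_minkowski F cz.
have [y0 xiE] := legendre_transformP mf xi0.
have e : grad F a u z = du a u z *m invmx (gmat (Fin F a) z (grad F a u z)).
  rewrite [X in X *m _]xiE -mulmxA mulmxV ?mulmx1 //.
  exact: (fundamental_unit mf y0).
rewrite {1}e mxE; apply: eq_bigr => j _; rewrite mulrC; congr (_ * _).
have sy := f_equal invmx (fundamental_sym mf y0); rewrite -trmx_inv in sy.
have := f_equal (fun B : 'M[R]_n => B i j) sy; rewrite mxE => sij; exact: sij.
Qed.

Lemma green_identityD v w : Ck_fun A 1 setT v -> Ck_fun A 1 setT w ->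
  green_identity (tDelta F s u) v -> green_identity (tDelta F s u) w ->
  green_identity (tDelta F s u) (v \+ w).
Proof.
move=> Cv Cw [iv1 iv2 ev] [iw1 iw2 ew].
have vd p : variation_density F u (v \+ w) p = variation_density F u v p + variation_density F u w p.
  have := du_line Cv Cw 1 (dom_chart_at A p).
  under [X in du _ X]eq_fun do rewrite mul1r.
  by rewrite /variation_density /= => ->; rewrite scale1r dotDl mulrDr.
have td p : (v \+ w) p * tDelta F s u p = v p * tDelta F s u p + w p * tDelta F s u p by exact: mulrDl.
rewrite /green_identity (funext td) (funext vd); split.
- exact: (integrableD measurableT iv1 iw1).
- exact: (integrableD measurableT iv2 iw2).
- apply: etrans (RintegralD measurableT iv1 iw1) _.
  apply: etrans (f_equal2 +%R ev ew) _.
  apply: etrans (esym (opprD _ _)) _.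
  exact: (f_equal -%R (esym (RintegralD measurableT iv2 iw2))).
Qed.

(* Instead of a partition of unity: the identity holds for every w * S as soon
   as S is a finite sum of bumps, and v = (v / S) * S for such an S positive
   on the support of v. *)
Lemma green_identity_tDelta K v : compact K -> K `<=` W -> (forall p, ~ K p -> v p = 0) ->
  Ck_fun A 1 setT v -> green_identity (tDelta F s u) v.
Proof.
move=> cK KW v0 Cv.
pose P (X : set M) := exists S : M -> R, [/\ Ck_fun A 1 setT S, forall p, 0 <= S p,
  forall p, X p -> 0 < S p &
  forall w, Ck_fun A 1 setT w -> green_identity (tDelta F s u) (w \* S)].
have CM (w S : M -> R) O : open O -> Ck_fun A 1 O w -> Ck_fun A 1 O S -> Ck_fun A 1 O (w \* S).
  by move=> oO Cw CS a; exact: (Ck_onM (open_chart_image (a:=a) oO) (Cw a) (CS a)).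
have local a C w : compact C -> C `<=` W `&` dom a -> (forall p, ~ C p -> w p = 0) ->
    Ck_fun A 1 setT w -> green_identity (tDelta F s u) w.
  move=> cC CW w0 Cw; have h := flux_by_parts cC CW w0 Cw.
  have E p : w p * tDelta F s u p = w p * div_loc s a (flux F a u) (phi a p).
    have [/CW[Wp ap]|/w0 ->] := pselect (C p); last exact: (etrans (mul0r _) (esym (mul0r _))).
    exact: (f_equal ( *%R (w p)) (tDelta_chart Wp ap)).
  rewrite /green_identity (funext E); exact: h.
have [S [CS S0 SK SI]] : P K.
  apply: (compact_local cK).
  - exists (fun=> 0); split; [exact: Ck_fun_cst|by move=> p; exact: lexx|by move=> p []|move=> w Cw].
    apply: (local (chart_at A point) set0).
    + exact: compact0.
    + exact: sub0set.
    + exact: (fun p _ => mulr0 (w p)).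
    + exact: (CM w (fun=> 0) setT openT Cw (@Ck_fun_cst _ _ _ A 1 setT 0)).
  - move=> X Y [S [CS S0 SX SI]] [T [CT T0 TY TI]]; exists (S \+ T); split.
    + by move=> a; exact: (Ck_onD (open_chart_image (a:=a) openT) (CS a) (CT a)).
    + by move=> p; exact: (addr_ge0 (S0 p) (T0 p)).
    + move=> p [/SX Sp|/TY Tp]; [exact: (ltr_pwDl Sp (T0 p))|exact: (ltr_wpDl (S0 p) Tp)].
    + move=> w Cw; have -> : w \* (S \+ T) = (w \* S) \+ (w \* T).
        by apply/funext => p; exact: mulrDr.
      exact: (green_identityD (CM w S setT openT Cw CS) (CM w T setT openT Cw CT) (SI w Cw) (TI w Cw)).
  - move=> X Y XY [S [CS S0 SY SI]]; exists S; split; [exact: CS|exact: S0| |exact: SI].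
    by move=> p /XY; exact: SY.
  - move=> p /KW Wp; have ap := dom_chart_at A p.
    have [b [C [[tb _] b0 bp cC [CW bC]]]] := bump_ex hM oW Wp ap.
    exists [set q | 0 < b q]; split; [|exact: bp|].
      apply: (@open_comp _ _ b [set t : R | 0 < t]) => [q _|]; last exact: open_gt.
      exact: (Ck_fun_continuous openT (tb 0%N) I).
    exists b; split; [exact: (tb 1%N)|exact: b0|by []|move=> w Cw].
    apply: (local (chart_at A p) C); [exact: cC|exact: CW| |].
      by move=> q /bC bq; apply: etrans (mulr0 (w q)); exact: (f_equal ( *%R (w q)) bq).
    exact: (CM w b setT openT Cw (tb 1%N)).
pose w p := v p / S p.
have vE : v = w \* S.
  apply/funext => p; rewrite /= /w; have [Kp|Kp] := pselect (K p).
    by rewrite divfK // gt_eqF // SK.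
  by rewrite v0 // !mul0r.
rewrite vE; apply: SI.
have oS : open [set p | 0 < S p].
  apply: (@open_comp _ _ S [set t : R | 0 < t]) => [q _|]; last exact: open_gt.
  exact: (Ck_fun_continuous openT CS I).
apply: (Ck_fun_off_compact hM oS _ cK) => [p /SK//||p Kp]; last by rewrite /w v0 // mul0r.
have CST : Ck_fun A 1 [set p | 0 < S p] S by exact: Ck_fun_sub (@subsetT _ _) CS.
have CVT : Ck_fun A 1 [set p | 0 < S p] v by exact: Ck_fun_sub (@subsetT _ _) Cv.
have CI : Ck_fun A 1 [set p | 0 < S p] (fun p => (S p)^-1).
  move=> a; apply: (Ck_on_inv (open_chart_image (a:=a) oS)); last exact: CST.
  by move=> x; rewrite chart_imageE => -[_ /= Sx]; rewrite gt_eqF.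
exact: (CM _ _ _ oS CVT CI).
Qed.

End domain.
End FluxDivergence.

(** * The symbol *)

Section Ellipticity.
Context {R : realType} {n : nat} {M : ptopologicalType}.
Variable A : smooth_atlas R n M.
Hypothesis hM : hausdorff_space M.
Variable F : finsler_metric A.
Implicit Types (a b : chart A) (x : 'rV[R]_n) (u v : M -> R) (W K : set M) (p : M).

Lemma du_C1 W a u : open W -> Ck_fun A 2 W u -> Ck_on 1 (phi a @` (dom a `&` W)) (du a u).
Proof.
move=> oW Cu; apply: (Ck_on_row (open_chart_image (a:=a) oW)) => i.
rewrite (_ : (fun q => _) = 'D_(evec i) (u \o psi a)); last by apply/funext => q; rewrite mxE.
have /Ck_onS[_ _ H] := Cu a; exact: H.
Qed.

Section nonvanishing.
Variables (W : set M) (u : M -> R).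
Hypotheses (oW : open W) (Cu : Ck_fun A 2 W u) (u0 : forall p, W p -> Du_neq0 A u p).

Lemma du_neq0_chart a x : (phi a @` (dom a `&` W)) x -> du a u x != 0.
Proof.
move=> [p [ap Wp] <-].
exact: (du_neq0_compat (dom_chart_at A p) ap oW (Ck_funW (leqnSn 1) Cu) Wp (u0 Wp)).
Qed.

Lemma flux_C1_nonvanishing : flux_C1 F W u.
Proof.
move=> a; exact: (@flux_field_C1 R n (cod a) (Fin F a) (@open_cod _ _ _ A a) (@Fin_ge0 _ _ _ _ F a)
  (@Fin_homogeneous _ _ _ _ F a) (@Fin_smooth _ _ _ _ F a) (@Fin_convex _ _ _ _ F a)
  _ (du a u) (open_chart_image (a:=a) oW) (@chart_image_cod _ _ _ _ _ _) (@du_C1 W a u oW Cu)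
  (@du_neq0_chart a)).
Qed.

Lemma derive_flux a x i : (phi a @` (dom a `&` W)) x ->
  'D_(evec i) (fun z => flux F a u z 0 i) x =
  calV F a u x * (half_dual_derivative (Fin F a) (du a u) x (evec i) * grad F a u x 0 i +
    legendre_jacobian (Fin F a) x (grad F a u x) (evec i) ('D_(evec i) (du a u) x) 0 i).
Proof.
move=> Ox; exact: (@derive_flux_field R n (cod a) (Fin F a) (@open_cod _ _ _ A a) (@Fin_ge0 _ _ _ _ F a)
  (@Fin_homogeneous _ _ _ _ F a) (@Fin_smooth _ _ _ _ F a) (@Fin_convex _ _ _ _ F a)
  _ (du a u) (open_chart_image (a:=a) oW) (@chart_image_cod _ _ _ _ _ _) (@du_C1 W a u oW Cu)
  (@du_neq0_chart a) x (evec i) i Ox).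
Qed.

End nonvanishing.

(** [Du_neq0] looks at a different chart at each point; continuity of [du] in the chart at [p] is
    carried to the neighbouring charts by [du_neq0_compat]. *)
Lemma open_Du_neq0 W u : open W -> Ck_fun A 1 W u -> open (W `&` [set p | Du_neq0 A u p]).
Proof.
move=> oW Cu; rewrite openE => p [Wp up]; set a := chart_at A p.
have ap : dom a p := dom_chart_at A p.
have Op : (phi a @` (dom a `&` W)) (phi a p) by exists p.
have near_du : \forall x \near phi a p, du a u x != 0.
  have c : du a u z @[z --> phi a p] --> du a u (phi a p) by exact: (du_continuous oW Cu Op).
  exact: (c _ (open_nbhs_nbhs (conj (@open_neq0 R n) up))).
have cp : phi a q @[q --> p] --> phi a p by exact: phi_continuous.
have near_p : \forall q \near p, du a u (phi a q) != 0 by exact: (cp _ near_du).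
have nW := open_nbhs_nbhs (conj oW Wp); have na := chart_near ap.
apply: filterS3 near_p nW na => q uq Wq aq; split; first exact: Wq.
exact: (du_neq0_compat aq (dom_chart_at A q) oW Cu Wq uq).
Qed.

Section symbol.
Variables (a : chart A) (x xi : 'rV[R]_n).

Let y := legendre_transform (Fin F a x) xi.
Let G := fundamental (Fin F a x) y.
Let V := expR (2^-1 * dual_norm (Fin F a x) xi ^+ 2).

(** The derivative of [V y] with respect to the covector: [dV = V dot(dxi, y)] and
    [dy = dxi *m invmx G]. *)
Definition symbol : 'M[R]_n := V *: (y^T *m y + invmx G).

Lemma symbol_entry i j : symbol i j = V * (y 0 i * y 0 j + invmx G i j).
Proof. by rewrite /symbol !mxE big_ord1 !mxE. Qed.

Hypotheses (cx : cod a x) (xi0 : xi != 0).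

Let mf := Fin_minkowski F cx.
Let y0 : y != 0. Proof. by have [] := legendre_transformP mf xi0. Qed.

Let invG_sym : (invmx G)^T = invmx G.
Proof. by rewrite trmx_inv (fundamental_sym mf y0). Qed.

Lemma symbol_sym : symbol^T = symbol.
Proof.
by rewrite /symbol linearZ /= linearD /= trmx_mul trmxK invG_sym.
Qed.

(** The rank-one part contributes a square. For the inverse, [z = w *m invmx G] turns the form into
    that of [G] at [z], positive by convexity. *)
Lemma symbol_pos w : w != 0 -> 0 < dot (w *m symbol) w.
Proof.
move=> w0; have -> : w *m symbol = V *: (dot w y *: y + w *m invmx G).
  rewrite /symbol -scalemxAr mulmxDr mulmxA; congr (V *: (_ + _)).
  by apply/rowP => j; rewrite !mxE big_ord1 !mxE; congr (_ * _); apply: eq_bigr => k _; rewrite mxE.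
have uG : G \in unitmx := fundamental_unit mf y0.
rewrite dotZl dotDl dotZl pmulr_rgt0 ?expR_gt0 //; apply: ltr_wpDl.
  by rewrite (dotC y w) -expr2 sqr_ge0.
pose z := w *m invmx G; have wE : w = z *m G by rewrite /z -mulmxA mulVmx // mulmx1.
rewrite -/z [X in dot _ X]wE dotC; apply: (@Fin_convex _ _ _ _ F a x y cx y0).
by apply: contra_neq w0 => z0; rewrite wE z0 mul0mx.
Qed.

End symbol.

Variables (mu : {measure set (borel M) -> \bar R}) (s : smooth_density A mu).

(** The terms free of second derivatives of [u]: those from the dependence of [F^2] on the base
    point, and those from the derivatives of [sigma]. *)
Definition lower_order_term a x xi : R :=
  let y := legendre_transform (Fin F a x) xi in
  let V := expR (2^-1 * dual_norm (Fin F a x) xi ^+ 2) in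
  \sum_i (V * (- (2^-1 * 'D_(row_mx (evec i) 0) (square (Fin F a)) (row_mx x y) * y 0 i) -
    ((\row_j (2^-1 * 'D_(row_mx (evec i) 0) ('D_(row_mx 0 (evec j)) (square (Fin F a))) (row_mx x y)))
      *m invmx (fundamental (Fin F a x) y)) 0 i)
    + (sigma s a x)^-1 * ('D_(evec i) (sigma s a) x * (V * y 0 i))).

Lemma div_flux_quasilinear W a u p : open W -> Ck_fun A 2 W u -> (forall p, W p -> Du_neq0 A u p) ->
  W p -> dom a p ->
  div_loc s a (flux F a u) (phi a p) =
  \sum_i \sum_j symbol a (phi a p) (du a u (phi a p)) i j *
    'D_(evec i) (fun z => 'D_(evec j) (u \o psi a) z) (phi a p)
  + lower_order_term a (phi a p) (du a u (phi a p)).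
Proof.
move=> oW Cu u0 Wp ap; set x := phi a p; have Ox : (phi a @` (dom a `&` W)) x by exists p.
have cx : cod a x := chart_image_cod Ox.
have oO := open_chart_image (a:=a) oW.
have Cflux := flux_C1_nonvanishing oW Cu u0.
have xi0 := du_neq0_chart oW Cu u0 Ox.
rewrite /div_loc /lower_order_term mulr_sumr -big_split; apply: eq_bigr => i _.
set y := legendre_transform (Fin F a x) (du a u x); set V := expR _.
set invG := invmx (fundamental (Fin F a x) y).
have dprod : 'D_(evec i) (fun z => sigma s a z * flux F a u z 0 i) x =
    sigma s a x * 'D_(evec i) (fun z => flux F a u z 0 i) x +
    'D_(evec i) (sigma s a) x * (V * y 0 i).
  have /Ck_onS[_ ds _] := @sigma_smooth _ _ _ _ _ s a 1.
  have /Ck_onS[_ df _] := Ck_on_coord i oO (Cflux a).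
  apply: etrans (deriveM (ds _ _ cx) (df _ _ Ox)) _.
  have fE : flux F a u x 0 i = V * y 0 i by rewrite mxE.
  have e : flux F a u x 0 i * 'D_(evec i) (sigma s a) x = 'D_(evec i) (sigma s a) x * (V * y 0 i).
    exact (etrans (mulrC _ _) (f_equal ( *%R ('D_(evec i) (sigma s a) x)) fE)).
  exact (f_equal (fun t : R => sigma s a x * 'D_(evec i) (fun z => flux F a u z 0 i) x + t) e).
have dxi j : ('D_(evec i) (du a u) x) 0 j = 'D_(evec i) (fun z => 'D_(evec j) (u \o psi a) z) x.
  have /Ck_onS[_ dd _] := @du_C1 W a u oW Cu.
  have [_ <-] := is_derive_coord j (derivableP (dd x (evec i) Ox)).
  by congr ('D_(evec i) _ x); apply/funext => z; rewrite mxE.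
rewrite dprod (derive_flux oW Cu u0 i Ox) -/x.
set d := 'D_(evec i) (du a u) x in dxi *.
have -> : \sum_j symbol a x (du a u x) i j * 'D_(evec i) (fun z => 'D_(evec j) (u \o psi a) z) x =
    V * (dot d y * y 0 i + (d *m invG) 0 i).
  (* The row product sums over the first index of [invG], the symbol over the second. *)
  have sy j : invG i j = invG j i.
    have := f_equal (fun B : 'M[R]_n => B i j) (symbol_sym cx xi0).
    rewrite mxE !symbol_entry => /(mulfI (lt0r_neq0 (expR_gt0 _))).
    by rewrite (mulrC (y 0 j)) => /addrI ->.
  rewrite /dot mxE mulr_suml -big_split mulr_sumr; apply: eq_bigr => j _ /=.
  by rewrite symbol_entry -dxi -/y -/invG -/V sy; ring.
rewrite -[grad F a u x]/y -[calV F a u x]/V /half_dual_derivative -/d.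
have -> : legendre_jacobian (Fin F a) x y (evec i) d 0 i = (d *m invG) 0 i -
    ((\row_j (2^-1 * 'D_(row_mx (evec i) 0) ('D_(row_mx 0 (evec j)) (square (Fin F a))) (row_mx x y)))
      *m invG) 0 i.
  by rewrite /legendre_jacobian mulmxBl mxE [X in _ + X]mxE.
set r := ((\row_j _) *m invG) 0 i; set r' := 'D_(row_mx _ _) _ _.
move: (dot d y) ((d *m invG) 0 i) ('D_(evec i) (sigma s a) x) => t1 t2 t3.
have : 0 < sigma s a x by exact: sigma_gt0.
clear dprod.
move: (sigma s a x) V (y 0 i) r r' => c V' yi r r' c0.
by rewrite /=; field; rewrite gt_eqF.
Qed.

End Ellipticity.

(** * The Euler-Lagrange operator *)

Section EulerLagrange.
Context {R : realType} {n : nat} {M : ptopologicalType}.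
Variable A : smooth_atlas R n M.
Hypothesis hM : hausdorff_space M.
Variable F : finsler_metric A.
Variables (mu : {measure set (borel M) -> \bar R}) (s : smooth_density A mu).
Implicit Types (a b : chart A) (u v : M -> R) (W K D : set M) (p : M).

Lemma compact_measure_fin K : compact K -> (mu K < +oo)%E.
Proof.
have [m [m_ball m_int _]] := @lebesgue_rV_ex R n.
exact: (mu_compact hM s m_ball m_int).
Qed.

Lemma tDelta_quasilinear : quasilinear_strictly_elliptic A (tDelta F s).
Proof.
have [m [m_ball m_int m_derive]] := @lebesgue_rV_ex R n.
move=> a; exists (symbol F a), (lower_order_term F s a); split.
  move=> x xi cx xi0; split; first exact: symbol_sym.
  by move=> w; exact: symbol_pos.
move=> u W p oW Wp ap Cu up x.
have Cu1 : Ck_fun A 1 W u by apply: Ck_funW Cu.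
(* The hypothesis is at the point [p] only; on this smaller open set [Du <> 0] throughout and the
   flux is C^1. *)
pose W' := W `&` [set q | Du_neq0 A u q].
have oW' : open W' := open_Du_neq0 oW Cu1.
have WW' : W' `<=` W by move=> q [].
have u0 q : W' q -> Du_neq0 A u q by case.
have Cu' := Ck_fun_sub WW' Cu; have Cu1' := Ck_fun_sub WW' Cu1.
have W'p : W' p by split.
rewrite (tDelta_chart hM s m_ball m_int m_derive oW' Cu1' (flux_C1_nonvanishing F oW' Cu' u0) W'p ap).
exact: (div_flux_quasilinear F s oW' Cu' u0 W'p ap).
Qed.

(** When the total energy is infinite, finiteness over [D] comes from the continuity of the density
    on the compact closure of [D]. *)
Lemma variation_domain_fin u v D : Ck_fun A 1 setT u -> variation_domain F mu u v D ->
  [/\ open D, supp v `<=` D & (energy F mu D u < +oo)%E].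
Proof.
move=> Cu [[ufin ->]|[_ [oD cD vD]]]; first by split; [exact: openT|exact: subsetT|].
split=> //; have ce := @energy_density_continuous _ _ _ _ F u Cu.
have ic := integrable_compact hM compact_measure_fin cD ce.
have mc := compact_borel hM cD.
have := integrable_fin_num mc ic; rewrite fin_numElt => /andP[_]; apply: le_lt_trans.
apply: ge0_subset_integral => //; last exact: subset_closure.
- exact: open_borel_measurable.
- by have /integrableP[] := ic.
- by move=> p _; rewrite lee_fin expR_ge0.
Qed.

Lemma first_variation u v D : Ck_fun A 1 setT u -> test_function A v ->
  variation_domain F mu u v D ->
  (forall t : R, (energy F mu D (fun p => (u p + t * v p)%R) < +oo)%E) /\
  is_derive (0 : R) (1 : R) (energy_along F mu u v D) (weak_pairing F mu u v).
Proof.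
move=> Cu [Cv cv] uvD; have [oD vD Dfin] := variation_domain_fin Cu uvD.
have v0 := @test_function_supp R M v.
split.
  exact: (energy_line_fin hM Cu (Cv 1%N) compact_measure_fin cv v0 oD vD Dfin).
exact: (is_derive_energy_along hM Cu (Cv 1%N) compact_measure_fin cv v0 oD vD Dfin).
Qed.

(** Without an admissible domain criticality would be vacuous for [v]. If the energy is infinite,
    finitely many positivity sets of bumps cover the support, and their union is relatively
    compact. *)
Lemma variation_domain_ex u v : compact (supp v) -> exists D, variation_domain F mu u v D.
Proof.
move=> cv; have [ufin|] := boolP (energy F mu setT u < +oo)%E.
  by exists setT; left.
rewrite -leNgt leye_eq => /eqP uoo.
pose P (X : set M) := exists D : set M, [/\ open D, X `<=` D & compact (closure D)].
have [D [oD vD cD]] : P (supp v).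
  apply: (compact_local cv).
  - by exists set0; split; [exact: open0|by []|rewrite closure0; exact: compact0].
  - move=> X Y [D [oD XD cD]] [E [oE YE cE]]; exists (D `|` E); split.
    + exact: openU.
    + exact: setUSS.
    + by rewrite closureU; exact: compactU.
  - by move=> X Y XY [D [oD YD cD]]; exists D; split=> //; exact: subset_trans XY YD.
  - move=> p _; have [b [K [[Cb _] _ bp cK [_ b0]]]] := bump_ex hM openT I (dom_chart_at A p).
    have oU : open [set q | 0 < b q].
      apply: (@open_comp _ _ b [set t : R | 0 < t]) => [q _|]; last exact: open_gt.
      exact: (Ck_fun_continuous openT (Cb 0%N) I).
    exists [set q | 0 < b q]; split=> //; exists [set q | 0 < b q]; split=> //.
    apply: (subclosed_compact _ cK); first exact: closed_closure.
    have -> : K = closure K by apply/closure_id; exact: compact_closed.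
    by apply: closure_subset => q /= bq; apply: contrapT => /b0 h; rewrite h ltxx in bq.
by exists D; right.
Qed.

(** The derivative of the energy is the weak pairing for every admissible domain, so by uniqueness
    of derivatives one domain decides and all domains agree. *)
Lemma critical_point_weak u : Ck_fun A 1 setT u ->
  critical_point F mu u <-> weak_solution F mu u.
Proof.
move=> Cu; split=> [cu v tv|wu v D tv uvD].
  have [D uvD] := @variation_domain_ex u v tv.2.
  have [_ [_ <-]] := first_variation Cu tv uvD.
  by have [_ ->] := cu v D tv uvD.
by have [_] := first_variation Cu tv uvD; rewrite (wu v tv).
Qed.

Section regular.
Variables (u : M -> R) (W : set M).
Hypotheses (Cu : Ck_fun A 1 setT u) (oW : open W) (Cflux : flux_C1 F W u).

Let CuW : Ck_fun A 1 W u. Proof. exact: (Ck_fun_sub (@subsetT _ W) Cu). Qed.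

Lemma tDelta_local a p : W p -> dom a p -> tDelta F s u p = tDelta_coord F s a u (phi a p).
Proof.
have [m [m_ball m_int m_derive]] := @lebesgue_rV_ex R n.
exact: (tDeltaE hM s m_ball m_int m_derive oW CuW Cflux).
Qed.

Lemma weak_pairing_tDelta K v : compact K -> K `<=` W -> (forall p, ~ K p -> v p = 0) ->
  Ck_fun A 1 setT v ->
  weak_pairing F mu u v = - \int[mu]_(p in [set: borel M]) (v p * tDelta F s u p).
Proof.
have [m [m_ball m_int m_derive]] := @lebesgue_rV_ex R n.
move=> cK KW v0 Cv.
have [_ _ ->] := green_identity_tDelta hM s m_ball m_int m_derive oW CuW Cflux cK KW v0 Cv.
by rewrite opprK.
Qed.

Lemma weak_solution_tDelta : weak_solution F mu u -> forall p, W p -> tDelta F s u p = 0.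
Proof.
have [m [m_ball m_int m_derive]] := @lebesgue_rV_ex R n.
move=> wu; apply: (variational_zero hM s m_ball m_int oW).
  by move=> p; exact: (tDelta_continuous hM m_ball m_int m_derive oW CuW Cflux).
move=> v K tv cK KW v0; apply: oppr_inj.
by rewrite -(weak_pairing_tDelta cK KW v0 (tv.1 1%N)) wu // oppr0.
Qed.

End regular.
End EulerLagrange.

Theorem theorem3p1 (R : realType) (n : nat) (M : ptopologicalType)
    (hM : hausdorff_space M) (cM : @second_countable M)
    (A : smooth_atlas R n M) (F : finsler_metric A)
    (mu : {measure set (borel M) -> \bar R}) (s : smooth_density A mu)
    (hF : forward_complete F) :
  quasilinear_strictly_elliptic A (tDelta F s) /\
  forall u : M -> R, Ck_fun A 1 setT u ->
    [/\ (* first variation, weak form *)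
        forall v D, test_function A v -> variation_domain F mu u v D ->
          (forall t : R, (energy F mu D (fun p => (u p + t * v p)%R) < +oo)%E) /\
          is_derive (0 : R) (1 : R) (energy_along F mu u v D)
            (weak_pairing F mu u v),
        critical_point F mu u <-> weak_solution F mu u,
        (* wherever the field V(u) grad u is differentiable, the equation and
           the first variation are expressed by the operator itself *)
        forall W : set M, open W -> flux_C1 F W u ->
          [/\ forall (a : chart A) p, W p -> dom a p ->
                tDelta F s u p = tDelta_coord F s a u (phi a p),
              forall v D, test_function A v -> supp v `<=` W ->
                variation_domain F mu u v D ->
                is_derive (0 : R) (1 : R) (energy_along F mu u v D)
                  (- \int[mu]_(p in [set: borel M]) (v p * tDelta F s u p)) &
              critical_point F mu u -> forall p, W p -> tDelta F s u p = 0],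
        flux_C1 F setT u ->
          (critical_point F mu u <-> forall p, tDelta F s u p = 0) &
        (* this is so where u is C^2 and Du <> 0 *)
        forall W : set M, open W -> Ck_fun A 2 W u ->
          (forall p, W p -> Du_neq0 A u p) -> flux_C1 F W u].

Proof.
split; first exact: tDelta_quasilinear.
move=> u Cu; have weakE := critical_point_weak hM F s Cu.
split.
- by move=> v D; exact: first_variation.
- exact: weakE.
- move=> W oW Cflux; split.
  + by move=> a p; exact: (tDelta_local hM s Cu oW Cflux).
  + move=> v D tv vW uvD; have [_] := first_variation hM s Cu tv uvD.
    by rewrite (weak_pairing_tDelta hM s Cu oW Cflux tv.2 vW (@test_function_supp R M v) (tv.1 1%N)).
  + by move=> /weakE; exact: weak_solution_tDelta.
- move=> Cflux; split=> [/weakE wu p|d0].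
    exact: (weak_solution_tDelta hM s Cu openT Cflux wu I).
  apply/weakE => v tv.
  rewrite (weak_pairing_tDelta hM s Cu openT Cflux tv.2 (@subsetT _ _) (@test_function_supp R M v) (tv.1 1%N)).
  under eq_Rintegral do rewrite d0 mulr0.
  by rewrite /Rintegral integral0 oppr0.
- by move=> W oW Cu2 u0; exact: flux_C1_nonvanishing.
Qed.
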